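(* Let $\mu$ be a doubling measure on $\mathbb{R}^n$. For all dyadic grids $\mathcal{D}$ on $\mathbb{R}^n$, all positive integers $\kappa$, and all sufficiently small $s>0$, depending only on the doubling constant of $\mu$, we have $$W^s(\mu)=W^s_{\mathcal{D};\kappa}(\mu)=W^s_{\mathcal{D}_{\mathrm{diff}};\kappa}(\mu),$$ with equivalence of norms.
   Context: $\ell(Q)$ is the side length of a cube $Q$ and $|E|_\mu=\mu(E)$. A positive locally finite Borel measure $\mu$ on $\mathbb{R}^n$ is doubling if there is $C_{\mathrm{doub}}$ (the doubling constant) with $|2Q|_\mu\le C_{\mathrm{doub}}|Q|_\mu$ for all cubes $Q$ with sides parallel to the axes ($2Q$ is the concentric double). For $\kappa\in\mathbb{N}=\{1,2,\dots\}$ and a cube $Q$ in a dyadic grid $\mathcal{D}$ with dyadic children $\mathfrak{C}(Q)$, $L^2_{Q;\kappa}(\mu)$ is the space of functions $f=\sum_{Q'\in\mathfrak{C}(Q)}\mathbf 1_{Q'}p_{Q'}$, with each $p_{Q'}$ a polynomial of degree less than $\kappa$, such that $\int_Q f(x)x^\beta d\mu(x)=0$ for all $0\le|\beta|<\kappa$. $\triangle^\mu_{Q;\kappa}$ is the orthogonal projection in $L^2(\mu)$ onto $L^2_{Q;\kappa}(\mu)$, and $\mathbb{E}^\mu_{Q;\kappa}$ is the orthogonal projection in $L^2(\mu)$ onto $\mathrm{Span}\{\mathbf 1_Qx^\beta:0\le|\beta|<\kappa\}$. The spaces are the Hilbert space completions of the functions $f\in L^2(\mu)$ for which the respective norm is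 finite: $$\|f\|^2_{W^s_{\mathcal{D};\kappa}(\mu)}=\sum_{Q\in\mathcal{D}}\ell(Q)^{-2s}\|\triangle^\mu_{Q;\kappa}f\|^2_{L^2(\mu)},\qquad \|f\|^2_{W^s_{\mathcal{D}_{\mathrm{diff}};\kappa}(\mu)}=\sum_{Q\in\mathcal{D}}\int_Q\left|\frac{f(x)-\mathbb{E}^\mu_{Q;\kappa}f(x)}{\ell(Q)^s}\right|^2d\mu(x),$$ $$\|f\|^2_{W^s(\mu)}=\int_{\mathbb{R}^n}\int_{\mathbb{R}^n}\left(\frac{f(x)-f(y)}{|x-y|^s}\right)^2\frac{d\mu(x)\,d\mu(y)}{\left|B\left(\frac{x+y}{2},\frac{|x-y|}{2}\right)\right|_\mu}.$$ *)

(* Defs.v *)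
From HB Require Import structures.
From mathcomp Require Import all_boot all_order all_algebra.
(* The notations of mpoly clash with those of the analysis library. *)
From mathcomp Require Import -(notations) mpoly.
From mathcomp Require Import all_classical all_reals all_analysis.

Set Implicit Arguments.
Unset Strict Implicit.
Unset Printing Implicit Defensive.

Import Order.TTheory GRing.Theory Num.Theory.
Import numFieldNormedType.Exports.
Local Open Scope classical_set_scope.
Local Open Scope ring_scope.

(* R^n is the space 'rV[R]_n with its Borel sigma-algebra. *)
Definition borelRn (R : realType) (n : nat) :=
  g_sigma_algebraType (@open 'rV[R]_n).

(* The library norm on 'rV[R]_n is the sup norm, hence these two definitions. *)
Definition enorm (R : realType) (n : nat) (x : 'rV[R]_n) : R :=
  Num.sqrt (\sum_(i < n) x 0 i ^+ 2).

Definition eball (R : realType) (n : nat) (c : 'rV[R]_n) (r : R)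
  : set 'rV[R]_n := [set x | enorm (x - c) < r].

(* The pair (a, l) stands for the half-open cube of corner a and side length l.
   Half-open cubes are used throughout, so that dyadic cubes of a given size
   tile R^n exactly. *)
Definition cube (R : realType) (n : nat) : Type := ('rV[R]_n * R)%type.

Definition side (R : realType) (n : nat) (Q : cube R n) : R := Q.2.

Definition cube_set (R : realType) (n : nat) (Q : cube R n) : set 'rV[R]_n :=
  [set x | forall i, Q.1 0 i <= x 0 i < Q.1 0 i + side Q].

Definition double_cube (R : realType) (n : nat) (Q : cube R n) : cube R n :=
  (Q.1 - const_mx (side Q / 2), 2 * side Q).

Section DoublingMeasure.
Context (R : realType) (n : nat).
Variable mu : {measure set (borelRn R n) -> \bar R}.

Definition locally_finite : Prop :=
  forall x : 'rV[R]_n, exists2 A, nbhs x A & measurable (A : set (borelRn R n))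
                                            /\ (mu A < +oo)%E.

Definition doubling (C : R) : Prop := forall Q : cube R n, 0 < side Q ->
  (mu (cube_set (double_cube Q)) <= C%:E * mu (cube_set Q))%E.

End DoublingMeasure.

Definition dyadic_grid (R : realType) (n : nat) (D : set (cube R n)) : Prop :=
  [/\ forall Q, D Q -> exists m : int, side Q = 2 ^ m,
      forall (m : int) (x : 'rV[R]_n),
        exists! Q, [/\ D Q, side Q = 2 ^ m & cube_set Q x] &
      forall Q Q', D Q -> D Q' ->
        [\/ cube_set Q `<=` cube_set Q', cube_set Q' `<=` cube_set Q |
            cube_set Q `&` cube_set Q' = set0] ].

Definition children (R : realType) (n : nat) (D : set (cube R n))
    (Q : cube R n) : set (cube R n) :=
  [set Q' | [/\ D Q', side Q' = side Q / 2 & cube_set Q' `<=` cube_set Q]].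

Definition monom (R : realType) (n : nat) (b : multinom n)
  (x : 'rV[R]_n) : R := \prod_(i < n) x 0 i ^+ b i.

Definition poly_eval (R : realType) (n : nat) (p : mpoly n R)
  (x : 'rV[R]_n) : R := meval (fun i => x 0 i) p.

Section SobolevNorms.
Context (R : realType) (n : nat).
Variable mu : {measure set (borelRn R n) -> \bar R}.

(* msize is the degree plus one, so msize p <= kappa says deg p < kappa. *)
Definition alpert_space (D : set (cube R n)) (kappa : nat) (Q : cube R n)
  : set ('rV[R]_n -> R) :=
  [set f | (exists2 p : cube R n -> mpoly n R,
              forall Q', (mmeasure mdeg (p Q') <= kappa)%N &
              f = fun x => \sum_(Q' \in children D Q)
                             \1_(cube_set Q') x * poly_eval (p Q') x)
           /\ (forall b : multinom n, (mdeg b < kappa)%N ->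
                 (\int[mu]_(x in cube_set Q) (f x * monom b x)%:E = 0)%E)].

Definition poly_space (kappa : nat) (Q : cube R n) : set ('rV[R]_n -> R) :=
  [set f | exists c : bmultinom n kappa -> R,
     f = fun x => \sum_b c b * (\1_(cube_set Q) x * monom b x)].

(* An orthogonal projection in L^2(mu) is determined up to a mu-null set only;
   oproj V f is some representative of it, for f in L^2(mu) and V a
   finite-dimensional subspace of L^2(mu). *)
Definition is_oproj (V : set ('rV[R]_n -> R)) (f g : 'rV[R]_n -> R) : Prop :=
  V g /\ forall h, V h -> (\int[mu]_x ((f x - g x) * h x)%:E = 0)%E.

Definition oproj (V : set ('rV[R]_n -> R)) (f : 'rV[R]_n -> R)
  : 'rV[R]_n -> R := xget (fun=> 0) [set g | is_oproj V f g].

Definition alpert_proj D kappa Q f := oproj (alpert_space D kappa Q) f.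

Definition poly_proj kappa Q f := oproj (poly_space kappa Q) f.

Definition norm_dyadic (D : set (cube R n)) (kappa : nat) (s : R)
    (f : 'rV[R]_n -> R) : \bar R :=
  sqrte (\esum_(Q in D) ((side Q `^ (- (2 * s)))%:E *
           \int[mu]_x (alpert_proj D kappa Q f x ^+ 2)%:E))%E.

Definition norm_diff (D : set (cube R n)) (kappa : nat) (s : R)
    (f : 'rV[R]_n -> R) : \bar R :=
  sqrte (\esum_(Q in D) \int[mu]_(x in cube_set Q)
           (`|(f x - poly_proj kappa Q f x) / side Q `^ s| ^+ 2)%:E)%E.

(* On the diagonal x = y this is 0, by the conventions x / 0 = 0 in R and
   0 * +oo = 0 in \bar R. *)
Definition sobolev_integrand (s : R) (f : 'rV[R]_n -> R) (x y : 'rV[R]_n)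
  : \bar R :=
  ((((f x - f y) / enorm (x - y) `^ s) ^+ 2)%R%:E /
   mu (eball (2^-1 *: (x + y))%R (enorm (x - y) / 2)%R))%E.

Definition norm_sobolev (s : R) (f : 'rV[R]_n -> R) : \bar R :=
  sqrte (\int[mu]_x \int[mu]_y sobolev_integrand s f x y)%E.

End SobolevNorms.

(* The completion of { f in L^2(mu) | N f < +oo }, as the set of classes of
   N-Cauchy sequences modulo N-null sequences. Functions that are equal
   mu-almost everywhere are at N-distance 0, so that constant sequences embed
   classes of functions modulo mu-almost everywhere equality. *)
Section Completion.
Context (R : realType) (n : nat).
Variable mu : {measure set (borelRn R n) -> \bar R}.
Variable N : ('rV[R]_n -> R) -> \bar R.

Definition finite_energy : set ('rV[R]_n -> R) :=
  [set f | ((f : borelRn R n -> R) \in Lfun mu 2%:E) /\ (N f < +oo)%E].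

Definition cauchy_energy (u : nat -> 'rV[R]_n -> R) : Prop :=
  (forall k, finite_energy (u k)) /\
  forall e : R, 0 < e -> exists K, forall i j, (K <= i)%N -> (K <= j)%N ->
    (N (u i \- u j)%R < e%:E)%E.

Definition cauchy_class (u : nat -> 'rV[R]_n -> R)
  : set (nat -> 'rV[R]_n -> R) :=
  [set v | cauchy_energy v /\ N (u k \- v k) @[k --> \oo] --> 0%E].

Definition completion : set (set (nat -> 'rV[R]_n -> R)) :=
  [set X | exists2 u, cauchy_energy u & X = cauchy_class u].

(* The value of this limit does not depend on the representative. *)
Definition completion_norm (X : set (nat -> 'rV[R]_n -> R)) : \bar R :=
  limn (fun k => N (xget (fun _ _ => 0) X k)).

End Completion.

Definition equivalent_norms (T : Type) (R : realType) (W : set T)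
    (N1 N2 : T -> \bar R) : Prop :=
  exists2 K : R, 0 < K & forall X, W X ->
    (N1 X <= K%:E * N2 X)%E /\ (N2 X <= K%:E * N1 X)%E.

(* Main.v *)
Require Import Defs.
From HB Require Import structures.
From mathcomp Require Import all_boot all_order all_algebra.
From mathcomp Require Import -(notations) mpoly.
From mathcomp Require Import all_classical all_reals all_analysis.
From mathcomp Require Import measurable_realfun.
From mathcomp Require Import ring lra zify.
Import Order.TTheory GRing.Theory Num.Theory.
Import numFieldNormedType.Exports.
Set Implicit Arguments.
Unset Strict Implicit.
Unset Printing Implicit Defensive.
Local Open Scope classical_set_scope.
Local Open Scope ring_scope.

(** The three energies are compared through the errors
    [gen_err m f], the squared L^2 distance of [f] to the functions that are a
    polynomial of degree less than [kappa] on each cube of side [2 ^ m] of the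
    grid. Grouping the cubes of the grid by size turns the difference energy into
    the weighted sum [diff_energy] of these errors, with the weights
    [2 ^ (- 2 s m)].

    The dyadic norm is comparable to the difference norm. By Pythagoras the
    energy of the Alpert projections of size [2 ^ m] is the drop of the error
    from one generation to the next ([gen_err_step]), so it is at most the
    error. Conversely, piecewise polynomials on small cubes are dense
    ([approximable_L2]), so the error is the sum of the drops of all finer
    generations, and since the weights grow geometrically towards the finer
    generations, this sum costs a constant factor ([diff_energy_le]).

    The difference norm is controlled by the Sobolev norm. The projection
    does better than any constant, in particular better than the constants
    [f x] for [x] in the cube; averaging over [x] bounds the error by a double
    integral over pairs of points in a common cube ([gen_err_le_pairs]).
    For a given pair, the cubes that contain both points are not smaller
    than their distance, and the weights sum to a multiple of the kernel of the
    Sobolev norm ([diff_le_sobolev]).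

    The Sobolev norm is controlled by the difference norm, for small [s].
    This is where the doubling constant enters. Up to a constant, the kernel is
    a weighted sum over [m] of truncations to pairs at distance less than
    [2 ^ m] ([kernel_le]). At each such scale, telescope [f] as [f - E_m f] plus
    the differences [E_(m+k) f - E_(m+k+1) f] of consecutive projections. Such a
    difference is a polynomial on cubes of side [2 ^ (m+k)]. Two points at
    distance less than [2 ^ m] either lie in the same cube, where Markov's
    inequality makes its variation small, or lie near the boundary of their
    cubes. The boundary layers of relative width [2 ^ - k] have relative mass at
    most a multiple of [lam ^ k] for some [lam < 1] that depends on the doubling
    constant alone ([layer_decay]). So the contribution of the [k]-th
    difference is at most [lam ^ k] times the error of generation [m+k]
    ([near_energy_le]). The sum over [m] and [k] against the weights converges
    if [lam * 2 ^ (2 s) < 1] ([sobolev_le_diff]), which determines the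
    threshold for [s].

    Finally, comparable norms that satisfy the triangle inequality have the
    same Cauchy and null sequences, hence the same completion with
    equivalent norms ([comparable_completion], [comparable_equivalent]). *)

(** * Countable sums and integrals *)

Section ESum.
Context (R : realType).
Local Open Scope ereal_scope.

Lemma esumZl (I : choiceType) (S : set I) (k : R) (a : I -> \bar R) :
  (0 <= k)%R -> (forall i, 0 <= a i) ->
  \esum_(i in S) (k%:E * a i) = k%:E * \esum_(i in S) a i.
Proof.
have le_esumZ (c : R) (b : I -> \bar R) : (0 <= c)%R ->
    (forall i, 0 <= b i) ->
    \esum_(i in S) (c%:E * b i) <= c%:E * \esum_(i in S) b i.
  move=> c0 b0; apply: ge_ereal_sup => _ [X [finX XS] <-].
  rewrite -ge0_mule_fsumr// lee_wpmul2l ?lee_fin//.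
  by apply: esum_ge; exists X.
rewrite le_eqVlt => /orP[/eqP <- a0|k0 a0].
  by rewrite mul0e esum1// => i _; rewrite mul0e.
apply/eqP; rewrite eq_le le_esumZ ?(ltW k0)//=.
have kV0 : (0 <= k^-1)%R by rewrite invr_ge0 ltW.
have ka0 i : 0 <= k%:E * a i by rewrite mule_ge0// lee_fin ltW.
have := le_esumZ _ _ kV0 ka0.
under eq_esum do rewrite muleA -EFinM mulVf ?gt_eqF// mul1e.
move=> /(lee_wpmul2l (_ : 0 <= k%:E)); rewrite lee_fin ltW// => /(_ isT).
by rewrite muleA -EFinM divff ?gt_eqF// mul1e.
Qed.

Lemma exchange_esum (I J : choiceType) (S : set I) (T : set J)
    (a : I -> J -> \bar R) : (forall i j, 0 <= a i j) ->
  \esum_(i in S) \esum_(j in T) a i j = \esum_(j in T) \esum_(i in S) a i j.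
Proof.
move=> a0; rewrite !esum_esum//.
rewrite (reindex_esum (T `*`` (fun=> S)) _ (fun p => (p.2, p.1)))//.
split => [[j i] [/= jT iS]//|[j i] [j' i'] _ _ [-> ->]//|[i j] [/= iS jT]].
by exists (j, i).
Qed.

(** Any countable family of extended reals is, up to vanishing terms, a
    sequence; this is what reduces Tonelli's theorem for sums over a countable
    set to monotone convergence. *)
Lemma countable_esum (I : choiceType) (S : set I) : countable S ->
  exists e : nat -> option I, forall a : I -> \bar R, (forall i, 0 <= a i) ->
    \esum_(i in S) a i = \sum_(k <oo) (if e k is Some i then a i else 0).
Proof.
move=> /countable_injP[g ginj].
pose e k := if pselect (exists2 i, S i & g i = k) is left p
            then Some (projT1 (cid2 p)) else None.
exists e => a a0; set b := fun k => if e k is Some i then a i else 0.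
have b0 k : 0 <= b k by rewrite /b; case: (e k).
have be i : S i -> b (g i) = a i.
  move=> Si; rewrite /b /e; case: pselect => [p|[]]; last by exists i.
  by case: (cid2 p) => j Sj gji /=; rewrite (ginj j i) ?inE.
rewrite nneseries_esumT//.
transitivity (\esum_(k in g @` S) b k).
  by rewrite esum_image; [apply: eq_esum => i /be|move=> i j /=; exact: ginj].
rewrite esum_mkcond; apply: eq_esum => k _; case: ifPn => // /negP kS.
rewrite /b /e; case: pselect => // -[i Si gik].
by exfalso; apply: kS; rewrite inE; exists i.
Qed.

End ESum.

Section IntegralESum.
Context d (T : measurableType d) (R : realType).
Variables (mu : {measure set T -> \bar R}).
Local Open Scope ereal_scope.

Lemma measurable_esum (I : choiceType) (S : set I) (D : set T)
    (f : I -> T -> \bar R) : countable S ->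
  (forall i, measurable_fun D (f i)) -> (forall i x, 0 <= f i x) ->
  measurable_fun D (fun x => \esum_(i in S) f i x).
Proof.
move=> /(@countable_esum R)[e eE] mf f0.
under eq_fun do rewrite eE//.
apply: (@ge0_emeasurable_sum _ _ _ D
  (fun k x => if e k is Some i then f i x else 0) xpredT) => [k x _ _|k _];
  by case: (e k).
Qed.

Lemma integral_esum (I : choiceType) (S : set I) (D : set T)
    (f : I -> T -> \bar R) : measurable D -> countable S ->
  (forall i, measurable_fun D (f i)) -> (forall i x, 0 <= f i x) ->
  \int[mu]_(x in D) (\esum_(i in S) f i x) =
  \esum_(i in S) \int[mu]_(x in D) f i x.
Proof.
move=> mD /(@countable_esum R)[e eE] mf f0.
rewrite eE; last by move=> i; exact: integral_ge0.
under eq_integral do rewrite eE//.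
rewrite integral_nneseries//; [|by move=> k; case: (e k)..].
by apply: eq_eseriesr => k _; case: (e k) => //; rewrite integral0.
Qed.

End IntegralESum.

(** * Square-integrable functions *)

Section L2.
Context d (T : measurableType d) (R : realType).
Variables (mu : {measure set T -> \bar R}).
Implicit Types f g h : T -> R.

Definition L2 f := measurable_fun setT f /\
  (\int[mu]_x ((f x) ^+ 2)%:E < +oo)%E.

Lemma L2P f : f \in Lfun mu 2%:E <-> L2 f.
Proof.
split => [fL|[mf fL]].
  have /integrableP[_ fi] := Lfun2_integrable_sqr fL.
  split; first by move: fL; rewrite inE => /andP[]; rewrite inE.
  move: fi; under eq_integral do rewrite gee0_abs ?lee_fin ?sqr_ge0//.
  by [].
rewrite inE; apply/andP; split; rewrite inE//=.
rewrite /finite_norm unlock poweR_lty//.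
have e x : (`|(EFin \o f) x| `^ 2)%E = ((f x) ^+ 2)%:E.
  by rewrite /comp abse_EFin poweR_EFin powR_mulrn// real_normK ?num_real.
by under eq_integral do rewrite e.
Qed.

Lemma L2_measurable f : L2 f -> measurable_fun setT f. Proof. by case. Qed.

Lemma L2_le f g : measurable_fun setT g ->
  L2 f -> (forall x, `|g x| <= `|f x|) -> L2 g.
Proof.
move=> mg [mf fL] gf; split=> //; apply: le_lt_trans fL.
apply: ge0_le_integral => //.
- by move=> x _; rewrite lee_fin sqr_ge0.
- exact/measurable_EFinP/measurable_funX.
- exact/measurable_EFinP/measurable_funX.
- move=> x _; rewrite lee_fin -(real_normK (num_real (g x))).
  by rewrite -(real_normK (num_real (f x))) lerXn2r ?nnegrE//.
Qed.

Lemma L2Z (k : R) f : L2 f -> L2 (fun x => k * f x).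
Proof.
move=> [mf fL]; split; first exact: measurable_funM.
under eq_integral do rewrite exprMn EFinM.
rewrite ge0_integralZl//.
- by rewrite lte_mul_pinfty// lee_fin sqr_ge0.
- exact/measurable_EFinP/measurable_funX.
- by move=> x _; rewrite lee_fin sqr_ge0.
- by rewrite lee_fin sqr_ge0.
Qed.

Lemma L2D f g : L2 f -> L2 g -> L2 (fun x => f x + g x).
Proof.
move=> fL gL; have [mf _] := fL; have [mg _] := gL.
split; first exact: measurable_funD.
have [[_ f2] [_ g2]] := (L2Z 2 fL, L2Z 2 gL).
apply: (@le_lt_trans _ _ (\int[mu]_x (((2 * f x) ^+ 2)%:E + ((2 * g x) ^+ 2)%:E))%E).
  apply: ge0_le_integral => //.
  - by move=> x _; rewrite lee_fin sqr_ge0.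
  - by apply/measurable_EFinP/measurable_funX/measurable_funD.
  - by apply: emeasurable_funD; apply/measurable_EFinP/measurable_funX/measurable_funM.
  - by move=> x _; rewrite -EFinD lee_fin; nra.
rewrite ge0_integralD//.
- by rewrite lte_add_pinfty.
- by move=> x _; rewrite lee_fin sqr_ge0.
- exact/measurable_EFinP/measurable_funX/measurable_funM.
- by move=> x _; rewrite lee_fin sqr_ge0.
- exact/measurable_EFinP/measurable_funX/measurable_funM.
Qed.

Lemma L2N f : L2 f -> L2 (fun x => - f x).
Proof.
by move=> /(L2Z (-1)); under eq_fun do rewrite mulN1r.
Qed.

Lemma L2B f g : L2 f -> L2 g -> L2 (fun x => f x - g x).
Proof. by move=> fL /L2N; exact: L2D. Qed.

Lemma L2_0 : L2 (fun=> 0).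
Proof.
split; first exact: measurable_cst.
rewrite (eq_integral (cst 0%E)) ?integral0// => x _.
by rewrite expr0n.
Qed.

Lemma L2_sum (I : Type) (r : seq I) (P : pred I) (f : I -> T -> R) :
  (forall i, L2 (f i)) -> L2 (fun x => \sum_(i <- r | P i) f i x).
Proof.
move=> fL; elim: r => [|i r IH].
  by under eq_fun do rewrite big_nil; exact: L2_0.
under eq_fun do rewrite big_cons.
by case: (P i) => //; exact: L2D.
Qed.

Lemma L2_indic (A : set T) f : measurable A -> L2 f ->
  L2 (fun x => \1_A x * f x).
Proof.
move=> mA fL; apply: L2_le (fL) _; last first.
  move=> x; rewrite normrM ler_piMl// indicE normr_nat; by case: (_ \in _).
by apply: measurable_funM; [exact: measurable_indic | exact: L2_measurable].
Qed.

Lemma L2_int f g : L2 f -> L2 g ->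
  mu.-integrable setT (fun x => (f x * g x)%:E).
Proof.
by move=> /L2P fL /L2P gL; have /Lfun1_integrable := Lfun2_mul_Lfun1 fL gL.
Qed.

Definition ip f g : R := fine (\int[mu]_x (f x * g x)%:E).

Lemma ipE f g : L2 f -> L2 g -> (\int[mu]_x (f x * g x)%:E = (ip f g)%:E)%E.
Proof. by move=> fL gL; rewrite fineK// integrable_fin_num//; exact: L2_int. Qed.

Lemma ipE2 f : L2 f -> (\int[mu]_x ((f x) ^+ 2)%:E = (ip f f)%:E)%E.
Proof. by move=> fL; rewrite -ipE//; apply: eq_integral => x _; rewrite expr2. Qed.

Lemma ipC f g : ip f g = ip g f.
Proof. by rewrite /ip; congr fine; apply: eq_integral => x _; rewrite mulrC. Qed.

Lemma ip_ge0 f : 0 <= ip f f.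
Proof.
by rewrite fine_ge0// integral_ge0// => x _; rewrite lee_fin -expr2 sqr_ge0.
Qed.

Lemma ipDl f g h : L2 f -> L2 g -> L2 h ->
  ip (fun x => f x + g x) h = ip f h + ip g h.
Proof.
move=> fL gL hL; apply: EFin_inj; rewrite EFinD -!ipE//; last exact: L2D.
under eq_integral do rewrite mulrDl EFinD.
by rewrite integralD//; exact: L2_int.
Qed.

Lemma ipZl (k : R) f h : L2 f -> L2 h -> ip (fun x => k * f x) h = k * ip f h.
Proof.
move=> fL hL; apply: EFin_inj; rewrite EFinM -!ipE//; last exact: L2Z.
under eq_integral do rewrite -mulrA EFinM.
by rewrite integralZl//; exact: L2_int.
Qed.

Lemma ipNl f h : L2 f -> L2 h -> ip (fun x => - f x) h = - ip f h.
Proof.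
move=> fL hL; rewrite -mulN1r -ipZl//; congr ip.
by apply/funext => x; rewrite mulN1r.
Qed.

Lemma ipBl f g h : L2 f -> L2 g -> L2 h ->
  ip (fun x => f x - g x) h = ip f h - ip g h.
Proof. by move=> fL gL hL; rewrite ipDl ?ipNl//; exact: L2N. Qed.

Lemma ipBr f g h : L2 f -> L2 g -> L2 h ->
  ip h (fun x => f x - g x) = ip h f - ip h g.
Proof. by move=> fL gL hL; rewrite ipC ipBl// !(ipC h). Qed.

Lemma ip_suml (I : Type) (r : seq I) (c : I -> R) (v : I -> T -> R) h :
  (forall i, L2 (v i)) -> L2 h ->
  ip (fun x => \sum_(i <- r) c i * v i x) h = \sum_(i <- r) c i * ip (v i) h.
Proof.
move=> vL hL; elim: r => [|i r IH].
  rewrite big_nil -[RHS](mul0r (ip h h)) -ipZl//; congr ip.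
  by apply/funext => x; rewrite big_nil mul0r.
rewrite big_cons -IH -ipZl// -ipDl//; last 2 first.
- exact: L2Z.
- by apply: L2_sum => j; exact: L2Z.
by congr ip; apply/funext => x; rewrite big_cons.
Qed.

(** Null vectors of a positive semidefinite form are orthogonal to everything:
    otherwise the form would be negative somewhere on the line they direct. *)
Lemma ip_null f g : L2 f -> L2 g -> ip g g = 0 -> ip f g = 0.
Proof.
move=> fL gL g0; apply/eqP; apply: contraT => fg0.
pose t := - (ip f f + 1) / (2 * ip f g).
pose w x := f x + t * g x.
have wL : L2 w by apply: L2D => //; exact: L2Z.
have we h : L2 h -> ip w h = ip f h + t * ip g h.
  by move=> hL; rewrite ipDl ?ipZl//; exact: L2Z.
have := ip_ge0 w; rewrite we// ![ip _ w]ipC !we// (ipC g f) g0.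
rewrite mulr0 addr0.
have -> : ip f f + t * ip f g + t * ip f g = -1 by rewrite /t; field.
by lra.
Qed.

End L2.

Section Projection.
Context d (T : measurableType d) (R : realType).
Variables (mu : {measure set T -> \bar R}).
Implicit Types f g h : T -> R.

(** The normal equations of a least-squares problem are always solvable, even
    when the Gram matrix is singular: the right-hand side is orthogonal to the
    kernel of that matrix, because a combination of the vectors which is
    orthogonal to all of them has norm zero. *)
Lemma least_squares (I : finType) (v : I -> T -> R) f :
  (forall i, L2 mu (v i)) -> L2 mu f ->
  exists c : I -> R,
    forall j, ip mu (fun x => f x - \sum_i c i * v i x) (v j) = 0.
Proof.
move=> vL fL; pose k := #|I|; pose w (i : 'I_k) := v (enum_val i).
have wL i : L2 mu (w i) by exact: vL.
pose G := \matrix_(i < k, j < k) ip mu (w i) (w j).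
pose F := \row_(j < k) ip mu f (w j).
have /submxP[D FDG] : (F <= G)%MS.
  rewrite submxE; apply/eqP/rowP => j; rewrite [RHS]mxE.
  pose y i := cokermx G i j; pose u x := \sum_i y i * w i x.
  have uL : L2 mu u by apply: L2_sum => i; exact: L2Z.
  have uw i : ip mu u (w i) = 0.
    have /matrixP/(_ i j) := mulmx_coker G; rewrite [RHS]mxE [LHS]mxE => <-.
    by rewrite ip_suml//; apply: eq_bigr => l _; rewrite mxE ipC mulrC.
  have uu : ip mu u u = 0.
    rewrite {1}/u ip_suml// big1// => i _; by rewrite ipC uw mulr0.
  have := ip_null fL uL uu; rewrite ipC ip_suml// => <-.
  by rewrite mxE; apply: eq_bigr => i _; rewrite mxE ipC mulrC.
exists (fun i => D 0 (enum_rank i)) => j.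
rewrite ipBl//; last by apply: L2_sum => i; exact: L2Z.
rewrite ip_suml//; apply/eqP; rewrite subr_eq0; apply/eqP.
move/rowP: FDG => /(_ (enum_rank j)); rewrite !mxE /w enum_rankK => ->.
rewrite (reindex_onto enum_rank enum_val)/=; last by move=> i _; rewrite enum_valK.
rewrite (eq_bigl xpredT); last by move=> i; rewrite enum_rankK eqxx.
by apply: eq_bigr => i _; rewrite mxE /w !enum_rankK.
Qed.

Lemma ip_pythagoras f g : L2 mu f -> L2 mu g -> ip mu f g = 0 ->
  ip mu (fun x => f x + g x) (fun x => f x + g x) = ip mu f f + ip mu g g.
Proof.
move=> fL gL fg; pose s x := f x + g x; have sL : L2 mu s by exact: L2D.
have se h : L2 mu h -> ip mu s h = ip mu f h + ip mu g h by move=> hL; exact: ipDl.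
rewrite -/s se// (ipC mu f s) (ipC mu g s) !se// (ipC mu g f) fg.
by rewrite addr0 add0r.
Qed.

End Projection.

(** Minimising the right-hand side over [t] turns the hypothesis, which passes
    through sums and integrals termwise, into the triangle inequality. *)
Lemma sqrte_triangle (R : realType) (a b c : \bar R) :
  (0 <= b)%E -> (0 <= c)%E ->
  (forall t : R, 0 < t -> (a <= (1 + t)%:E * b + (1 + t^-1)%:E * c)%E) ->
  (sqrte a <= sqrte b + sqrte c)%E.
Proof.
case: b c => [b| |] [c| |]//= b0 c0 abc; rewrite ?leey//.
have S0 : 0 <= Num.sqrt b + Num.sqrt c by rewrite addr_ge0 ?sqrtr_ge0.
rewrite -EFinD -[Num.sqrt b + Num.sqrt c]ger0_norm// -sqrtr_sqr.
rewrite -[X in (_ <= X)%E]/(sqrte ((Num.sqrt b + Num.sqrt c) ^+ 2)%:E).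
rewrite lee_sqrt ?lee_fin ?sqr_ge0//; set S := Num.sqrt b + Num.sqrt c.
rewrite !lee_fin in b0 c0; apply/lee_addgt0Pr => e e0.
have [eta eta0 etaS] : exists2 eta, 0 < eta & eta * S <= e.
  have S1 : 0 < S + 1 by rewrite ltr_pwDr.
  exists (e / (S + 1)); first by rewrite divr_gt0.
  by rewrite mulrAC ler_pdivrMr//; nra.
have [x0 y0] := (sqrtr_ge0 b, sqrtr_ge0 c).
have [xx yy] := (sqr_sqrtr b0, sqr_sqrtr c0).
rewrite -xx -yy in abc; move: abc etaS; rewrite {}/S.
move: (Num.sqrt b) (Num.sqrt c) x0 y0 {S0 xx yy} => x y x0 y0 abc etaS.
have xe : 0 < x + eta by rewrite ltr_wpDl.
have ye : 0 < y + eta by rewrite ltr_wpDl.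
have /abc {}abc : 0 < (y + eta) / (x + eta) by rewrite divr_gt0.
apply: (le_trans abc); rewrite invf_div -!EFinM -!EFinD lee_fin.
have h1 : (y + eta) / (x + eta) * x ^+ 2 <= (y + eta) * x.
  rewrite -mulrA ler_wpM2l ?(ltW ye)// mulrC ler_pdivrMr//; nra.
have h2 : (x + eta) / (y + eta) * y ^+ 2 <= (x + eta) * y.
  rewrite -mulrA ler_wpM2l ?(ltW xe)// mulrC ler_pdivrMr//; nra.
nra.
Qed.

(** Integrated or summed, this gives the hypothesis of [sqrte_triangle]. *)
Lemma sqr_young (R : realFieldType) (t x y : R) : 0 < t ->
  (x + y) ^+ 2 <= (1 + t) * x ^+ 2 + (1 + t^-1) * y ^+ 2.
Proof.
move=> t0; rewrite -subr_ge0.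
have -> : (1 + t) * x ^+ 2 + (1 + t^-1) * y ^+ 2 - (x + y) ^+ 2 =
  t^-1 * (t * x - y) ^+ 2 by field; lra.
by rewrite mulr_ge0 ?invr_ge0 ?sqr_ge0// ltW.
Qed.

Lemma integral_young d (T : measurableType d) (R : realType)
    (mu : {measure set T -> \bar R}) (A : set T) (t : R) (f g : T -> R) :
  measurable A -> measurable_fun setT f -> measurable_fun setT g -> 0 < t ->
  (\int[mu]_(x in A) ((f x + g x) ^+ 2)%:E <=
    (1 + t)%:E * \int[mu]_(x in A) ((f x) ^+ 2)%:E +
    (1 + t^-1)%:E * \int[mu]_(x in A) ((g x) ^+ 2)%:E)%E.
Proof.
move=> mA mf mg t0.
have c1 : 0 <= 1 + t by rewrite addr_ge0// ltW.
have c2 : 0 <= 1 + t^-1 by rewrite addr_ge0// invr_ge0 ltW.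
have m2 (h : T -> R) : measurable_fun setT h ->
    measurable_fun A (fun x => ((h x) ^+ 2)%:E).
  by move=> mh; apply/measurable_EFinP; apply: measurable_funTS; exact: measurable_funX.
rewrite -!ge0_integralZl ?lee_fin//; first last.
- by move=> x _; rewrite lee_fin sqr_ge0.
- exact: m2.
- by move=> x _; rewrite lee_fin sqr_ge0.
- exact: m2.
rewrite -ge0_integralD//; first last.
- by apply: emeasurable_funM => //; exact: m2.
- by move=> x _; rewrite -EFinM lee_fin mulr_ge0// sqr_ge0.
- by apply: emeasurable_funM => //; exact: m2.
- by move=> x _; rewrite -EFinM lee_fin mulr_ge0// sqr_ge0.
apply: ge0_le_integral => //.
- by move=> x _; rewrite lee_fin sqr_ge0.
- by apply: m2; exact: measurable_funD.
- by apply: emeasurable_funD; apply: emeasurable_funM => //; exact: m2.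
- by move=> x _; rewrite -!EFinM -EFinD lee_fin sqr_young.
Qed.

(** * Borel measurability of cubes, balls and polynomials *)

Section Borel.
Context (R : realType) (n : nat).
Local Notation X := (borelRn R n).

Lemma measurable_coord (i : 'I_n) :
  measurable_fun [set: X] (fun x : X => (x : 'rV[R]_n) 0 i).
Proof.
apply: (measurability _ (RGenOInfty.measurableE R)) => // _ [_ [a ->] <-].
rewrite setTI; apply: sub_sigma_algebra.
apply: (@open_comp _ _ (fun x : 'rV[R]_n => x 0 i)).
  by move=> x _; exact: coord_continuous.
have -> : `]a, +oo[%classic = [set x : R | a < x].
  by apply/seteqP; split => x; rewrite /= in_itv/= andbT.
exact: open_gt.
Qed.

Lemma measurable_cube (Q : cube R n) : measurable (cube_set Q : set X).
Proof.
have -> : cube_set Q = \bigcap_(i in [set: 'I_n])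
    [set x : 'rV[R]_n | Q.1 0 i <= x 0 i < Q.1 0 i + side Q].
  by apply/seteqP; split => x; [move=> xQ i _; exact: xQ|move=> xQ i; exact: xQ].
apply: fin_bigcap_measurable => [|i _]; first exact: finite_finset.
rewrite -[X in measurable X]setTI.
have -> : [set x : 'rV[R]_n | Q.1 0 i <= x 0 i < Q.1 0 i + side Q] =
    (fun x : X => (x : 'rV[R]_n) 0 i) @^-1` `[Q.1 0 i, Q.1 0 i + side Q[%classic.
  by apply/seteqP; split => x; rewrite /= in_itv.
exact: measurable_coord.
Qed.

Lemma measurable_monom (b : mpoly.multinom n) :
  measurable_fun [set: X] (monom b : X -> R).
Proof.
apply: (@measurable_prod _ _ _ _ _ _
  (fun i (x : X) => (x : 'rV[R]_n) 0 i ^+ b i)) => i _.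
by apply: measurable_funX; exact: measurable_coord.
Qed.

Lemma measurable_enorm d (T : measurableType d) (g : T -> 'rV[R]_n) :
  (forall i, measurable_fun [set: T] (fun t => g t 0 i)) ->
  measurable_fun [set: T] (fun t => enorm (g t)).
Proof.
move=> mg; have -> : (fun t => enorm (g t)) =
    (fun u => u `^ 2^-1) \o (fun t => \sum_(i < n) g t 0 i ^+ 2).
  apply/funext => t /=; rewrite powR12_sqrt//.
  by apply: sumr_ge0 => i _; exact: sqr_ge0.
apply: measurableT_comp; first exact: measurable_powR.
by apply: measurable_sum => i; exact: measurable_funX.
Qed.

Lemma measurable_eball (c : 'rV[R]_n) (r : R) : measurable (eball c r : set X).
Proof.
have mf : measurable_fun [set: X] (fun x : X => enorm ((x : 'rV[R]_n) - c)).
  apply: measurable_enorm => i.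
  under eq_fun do rewrite !mxE.
  by apply: measurable_funD => //; exact: measurable_coord.
have -> : eball c r = (fun x : X => enorm ((x : 'rV[R]_n) - c)) @^-1` `]-oo, r[%classic.
  by apply/seteqP; split => x; rewrite /= in_itv.
by rewrite -[X in measurable X]setTI; exact: mf.
Qed.

Lemma coord_le_enorm (x : 'rV[R]_n) i : `|x 0 i| <= enorm x.
Proof.
rewrite -sqrtr_sqr ler_sqrt; last by apply: sumr_ge0 => j _; exact: sqr_ge0.
rewrite (bigD1 i)//= lerDl; apply: sumr_ge0 => j _; exact: sqr_ge0.
Qed.

Lemma enorm_le (x : 'rV[R]_n) (t : R) :
  (forall i, `|x 0 i| <= t) -> 0 <= t -> enorm x <= n%:R * t.
Proof.
move=> xt t0; rewrite -[leRHS]ger0_norm ?mulr_ge0// -sqrtr_sqr.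
rewrite ler_sqrt ?sqr_ge0//.
apply: (@le_trans _ _ (\sum_(i < n) t ^+ 2)).
  apply: ler_sum => i _; rewrite -(real_normK (num_real (x 0 i))).
  by rewrite lerXn2r ?nnegrE.
rewrite sumr_const card_ord exprMn -[leLHS]mulr_natl ler_wpM2r ?sqr_ge0//.
by rewrite -natrX ler_nat; case: (n) => // k; rewrite leq_pmull.
Qed.

Lemma enorm_ge0 (x : 'rV[R]_n) : 0 <= enorm x. Proof. exact: sqrtr_ge0. Qed.

Lemma enorm_eq0 (x : 'rV[R]_n) : enorm x = 0 -> x = 0.
Proof.
move=> x0; apply/rowP => i; rewrite mxE; apply/eqP.
by rewrite -normr_le0 -x0 coord_le_enorm.
Qed.

End Borel.

(** * Doubling measures *)

Section Doubling.
Context (R : realType) (n : nat).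
Variables (mu : {measure set (borelRn R n) -> \bar R}) (C : R).
Hypotheses (C1 : 1 <= C) (dmu : doubling mu C).
Local Notation X := (borelRn R n).

Lemma iter_double_cube k (Q : cube R n) : iter k (@double_cube R n) Q =
  (Q.1 - const_mx ((2 ^+ k - 1) / 2 * side Q), 2 ^+ k * side Q).
Proof.
elim: k => [|k IH] /=.
  rewrite expr0 subrr !mul0r mul1r; case: Q => a l /=; congr (_, _).
  by apply/rowP => i; rewrite !mxE subr0.
rewrite IH /double_cube/=; congr (_, _); last by rewrite exprS mulrA.
by apply/rowP => i; rewrite !mxE exprS /side/=; field.
Qed.

Lemma mu_iter_double k (Q : cube R n) : 0 < side Q ->
  (mu (cube_set (iter k (@double_cube R n) Q)) <=
   (C ^+ k)%:E * mu (cube_set Q))%E.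
Proof.
move=> Q0; elim: k => [|k IH]; first by rewrite expr0 mul1e.
have k0 : 0 < side (iter k (@double_cube R n) Q).
  by rewrite iter_double_cube/= mulr_gt0// exprn_gt0.
apply: (le_trans (dmu k0)).
by rewrite exprS EFinM -muleA lee_wpmul2l// lee_fin (le_trans ler01).
Qed.

(** All comparisons between the masses of two sets at comparable scales and
    distances go through this estimate. Its exponent is a number [k] of
    doublings for which [2 ^ k >= 2 r + 2], so that the constant does not involve
    the dimension. *)
Lemma mu_near (r : nat) (A : set X) (Q : cube R n) :
  0 < side Q -> measurable A ->
  (forall (x : 'rV[R]_n), A x -> forall i, `|x 0 i - Q.1 0 i| <= r%:R * side Q) ->
  (mu A <= (C ^+ (2 * r).+1)%:E * mu (cube_set Q))%E.
Proof.
move=> Q0 mA AQ; apply: le_trans (mu_iter_double _ Q0).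
apply: le_measure; rewrite ?inE//; first exact: measurable_cube.
move=> x Ax i; rewrite iter_double_cube /side/= -/(side Q) !mxE.
set K := 2 ^+ _.
have : 2 * r%:R + 2 <= K :> R.
  rewrite /K -natrX -(natrM _ 2 r) -natrD ler_nat.
  by rewrite addn2; exact: ltn_expl.
move: (AQ x Ax i); rewrite ler_norml => /andP[].
move: (x 0 i) (Q.1 0 i) (r%:R : R) (side Q) Q0 => u a r' l l0 h1 h2 h3.
apply/andP; split; nra.
Qed.

(** A null cube would make all its iterated doubles null, and these exhaust
    the space. *)
Lemma mu_cube_gt0 (Q : cube R n) : mu setT != 0%E -> 0 < side Q ->
  (0 < mu (cube_set Q))%E.
Proof.
move=> muT Q0; rewrite lt0e measure_ge0 andbT; apply: contra muT => /eqP muQ.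
pose F k : set X := cube_set (iter k (@double_cube R n) Q).
have mF k : measurable (F k) by exact: measurable_cube.
have F0 k : mu.-negligible (F k).
  apply/negligibleP; first exact: mF.
  apply/eqP; rewrite eq_le measure_ge0 andbT (le_trans (mu_iter_double k Q0))//.
  by rewrite muQ mule0.
have FT : \bigcup_k F k = setT.
  apply/seteqP; split => // x _.
  pose N := Num.bound ((\sum_(i < n) `|(x : 'rV[R]_n) 0 i - Q.1 0 i|) / side Q).
  exists (2 * N).+1 => // i; rewrite iter_double_cube /side/= -/(side Q) !mxE.
  have s0 : 0 <= \sum_(i < n) `|(x : 'rV[R]_n) 0 i - Q.1 0 i|.
    by apply: sumr_ge0 => j _; exact: normr_ge0.
  have /archi_boundP : 0 <= (\sum_(i < n) `|(x : 'rV[R]_n) 0 i - Q.1 0 i|) / side Q.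
    by rewrite divr_ge0// ltW.
  rewrite -/N ltr_pdivrMr// => hN.
  have : 2 * N%:R + 2 <= 2 ^+ (2 * N).+1 :> R.
    rewrite -natrX -(natrM _ 2 N) -natrD ler_nat.
    by rewrite addn2; exact: ltn_expl.
  have : `|(x : 'rV[R]_n) 0 i - Q.1 0 i| <= N%:R * side Q.
    apply: le_trans (ltW hN); rewrite (bigD1 i)//= lerDl.
    by apply: sumr_ge0 => j _; exact: normr_ge0.
  rewrite ler_norml => /andP[].
  move: ((x : 'rV[R]_n) 0 i) (Q.1 0 i) (N%:R : R) (side Q) (2 ^+ _) Q0.
  move=> u a r' l K l0 h1 h2 h3; apply/andP; split; nra.
have /negligibleP : mu.-negligible (\bigcup_k F k) by exact: negligible_bigcup.
by rewrite FT => -> //; exact: measurableT.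
Qed.

Lemma mu_cube_lty (Q : cube R n) : locally_finite mu -> 0 < side Q ->
  (mu (cube_set Q) < +oo)%E.
Proof.
move=> /(_ 0)[A A0 [mA muA]] Q0.
have [e /= e0 eA] : exists2 e : R, 0 < e & forall x : 'rV[R]_n, ball 0 e x -> A x.
  by have /nbhs_ballP[e e0 eA] := A0; exists e.
pose P : cube R n := (0, e).
have PA : cube_set P `<=` A.
  move=> x xP; apply: eA; split => // i j; rewrite ord1 mxE /ball/= sub0r normrN.
  by move: (xP j); rewrite /P /side/= mxE add0r => /andP[? ?]; rewrite ger0_norm.
have muP : (mu (cube_set P) < +oo)%E.
  by apply: le_lt_trans muA; apply: le_measure; rewrite ?inE//; exact: measurable_cube.
pose s := (\sum_(i < n) `|Q.1 0 i|) + side Q.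
have s0 : 0 <= s by rewrite addr_ge0 ?(ltW Q0)// sumr_ge0.
have sN : s < (Num.bound (s / e))%:R * e.
  by rewrite -ltr_pdivrMr// archi_boundP// divr_ge0// ltW.
have := @mu_near (Num.bound (s / e)) _ P e0 (measurable_cube Q).
move=> h; apply: le_lt_trans (h _) _; last first.
  by rewrite lte_mul_pinfty// lee_fin exprn_ge0// (le_trans ler01).
move=> x xQ i; rewrite mxE subr0; apply: le_trans (ltW sN).
rewrite ler_norml /s.
have : `|Q.1 0 i| <= \sum_(i < n) `|Q.1 0 i|.
  by rewrite (bigD1 i)//= lerDl; apply: sumr_ge0.
have /andP[] := xQ i; have := ler_norm (Q.1 0 i); have := lerNnormlW (lexx `|Q.1 0 i|).
move: Q0; move: (\sum_(i < n) _) => S.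
move: (Q.1 0 i) `|Q.1 0 i| (x 0 i) (side Q) => *; apply/andP; split; lra.
Qed.

End Doubling.

(** * Dyadic grids *)

Section SupDistance.
Context (R : realType) (n : nat).
Implicit Types x y z : 'rV[R]_n.

Definition supdist x y : R := \big[Num.max/0]_(i < n) `|x 0 i - y 0 i|.

Lemma supdist_ltP (t : R) x y : 0 < t ->
  reflect (forall i, `|x 0 i - y 0 i| < t) (supdist x y < t).
Proof.
move=> t0; apply: (iffP (bigmax_ltP _ _ _ _)) => [[_ h] i|h]; last by split.
exact: h.
Qed.

Lemma coord_le_supdist x y i : `|x 0 i - y 0 i| <= supdist x y.
Proof. exact: le_bigmax. Qed.

Lemma supdist_ge0 x y : 0 <= supdist x y.
Proof. by rewrite /supdist; elim/big_ind: _ => // u v u0 v0; rewrite le_max u0. Qed.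

Lemma supdist_le_enorm x y : supdist x y <= enorm (x - y).
Proof.
apply: bigmax_le => [|i _]; first exact: enorm_ge0.
by have := coord_le_enorm (x - y) i; rewrite !mxE.
Qed.

Lemma enorm_le_supdist x y : enorm (x - y) <= n%:R * supdist x y.
Proof.
apply: enorm_le; last exact: supdist_ge0.
by move=> i; rewrite !mxE; exact: coord_le_supdist.
Qed.

Lemma supdistC x y : supdist x y = supdist y x.
Proof. by apply: eq_bigr => i _; rewrite distrC. Qed.

Lemma supdist_gt0 x y : x != y -> 0 < supdist x y.
Proof.
move=> xy; rewrite lt_neqAle supdist_ge0 andbT eq_sym.
apply: contra xy => /eqP d0; rewrite -subr_eq0; apply/eqP/enorm_eq0/eqP.
by rewrite eq_le enorm_ge0 andbT (le_trans (enorm_le_supdist x y))// d0 mulr0.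
Qed.

Lemma measurable_supdist_lt (t : R) : 0 < t -> measurable
  [set p : borelRn R n * borelRn R n | supdist (p.1 : 'rV[R]_n) p.2 < t].
Proof.
move=> t0; pose X := borelRn R n.
have -> : [set p : X * X | supdist (p.1 : 'rV[R]_n) p.2 < t] =
    \bigcap_(i in [set: 'I_n])
      [set p : X * X | `|(p.1 : 'rV[R]_n) 0 i - (p.2 : 'rV[R]_n) 0 i| < t].
  apply/seteqP; split => p /=; first by move/supdist_ltP => h i _; exact: h.
  by move=> h; apply/supdist_ltP => // i; exact: h.
apply: fin_bigcap_measurable => [|i _]; first exact: finite_finset.
have mf : measurable_fun [set: X * X]
    (fun p => `|(p.1 : 'rV[R]_n) 0 i - (p.2 : 'rV[R]_n) 0 i|).
  apply: measurableT_comp => //; apply: measurable_funB.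
  - by apply: (measurableT_comp (measurable_coord i)); exact: measurable_fst.
  - by apply: (measurableT_comp (measurable_coord i)); exact: measurable_snd.
have -> : [set p : X * X | `|(p.1 : 'rV[R]_n) 0 i - (p.2 : 'rV[R]_n) 0 i| < t] =
  (fun p => `|(p.1 : 'rV[R]_n) 0 i - (p.2 : 'rV[R]_n) 0 i|) @^-1` `]-oo, t[%classic.
  by apply/seteqP; split => p; rewrite /= in_itv.
by rewrite -[X in measurable X]setTI; exact: mf.
Qed.

Lemma dyadic_scale (d : R) : 0 < d -> exists m : int, 2 ^ (m - 1) <= d < 2 ^ m.
Proof.
move=> d0; have l2 : 0 < ln 2 :> R by rewrite ln_gt0// ltr1n.
have pe (m : int) : 2 ^ m = expR (m%:~R * ln 2) :> R.
  by rewrite -powR_intmul// /powR gt_eqF.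
exists (Num.floor (ln d / ln 2) + 1); rewrite addrK !pe.
have /andP[h1 h2] := floor_itv (ln d / ln 2).
rewrite -[X in _ <= X < _](lnK d0) ler_expR ltr_expR.
by rewrite -ler_pdivlMr// h1 -ltr_pdivrMr.
Qed.

End SupDistance.

Section Grid.
Context (R : realType) (n : nat) (D : set (cube R n)).
Hypotheses (n0 : (0 < n)%N) (DG : dyadic_grid D).
Local Notation X := (borelRn R n).
Implicit Types (x y z : 'rV[R]_n) (m : int) (Q P : cube R n).

Lemma grid_cube_exists m x :
  exists Q, [/\ D Q, side Q = 2 ^ m & cube_set Q x].
Proof. by have [_ /(_ m x)[Q [h _]] _] := DG; exists Q. Qed.

(** Labelling the cubes of generation [m] by their points makes a function that
    is given cube by cube an ordinary function of [x], and avoids sums over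
    cubes. *)
Definition lev m x : cube R n := projT1 (cid (grid_cube_exists m x)).

Lemma levP m x : [/\ D (lev m x), side (lev m x) = 2 ^ m & cube_set (lev m x) x].
Proof. exact: (projT2 (cid (grid_cube_exists m x))). Qed.

Lemma lev_D m x : D (lev m x). Proof. by have [] := levP m x. Qed.
Lemma lev_side m x : side (lev m x) = 2 ^ m. Proof. by have [] := levP m x. Qed.
Lemma lev_mem m x : cube_set (lev m x) x. Proof. by have [] := levP m x. Qed.

Lemma lev_eq m Q x : D Q -> side Q = 2 ^ m -> cube_set Q x -> lev m x = Q.
Proof.
move=> DQ sQ xQ; have [_ /(_ m x)[P [_ h]] _] := DG.
by rewrite -(h (lev m x))//; [exact: h|exact: levP].
Qed.

Lemma pow2_gt0 m : 0 < 2 ^ m :> R. Proof. exact: exprz_gt0. Qed.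

Lemma lev_side_gt0 m x : 0 < side (lev m x).
Proof. by rewrite lev_side pow2_gt0. Qed.

Lemma cube_sub_coord Q P i : 0 < side Q -> cube_set Q `<=` cube_set P ->
  P.1 0 i <= Q.1 0 i /\ Q.1 0 i + side Q <= P.1 0 i + side P.
Proof.
move=> Q0 QP.
have h (t : R) : 0 <= t < side Q -> P.1 0 i <= Q.1 0 i + t < P.1 0 i + side P.
  move=> /andP[t0 tQ]; pose x := Q.1 + const_mx t.
  have xQ : cube_set Q x by move=> j; rewrite !mxE lerDl t0 ltrD2l.
  by have := QP _ xQ i; rewrite !mxE.
have /andP[h0 h1] : P.1 0 i <= Q.1 0 i + 0 < P.1 0 i + side P by apply: h; lra.
rewrite addr0 in h0 h1; split=> //; rewrite leNgt; apply/negP => PQ.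
have : P.1 0 i <= Q.1 0 i + (P.1 0 i + side P - Q.1 0 i) < P.1 0 i + side P.
  by apply: h; apply/andP; split; lra.
by rewrite [Q.1 0 i + _]addrC subrK ltxx andbF.
Qed.

Lemma side_le Q P : 0 < side Q -> cube_set Q `<=` cube_set P -> side Q <= side P.
Proof. by move=> Q0 /(cube_sub_coord (Ordinal n0) Q0)[]; lra. Qed.

Lemma lev_sub m m' x y : m <= m' -> cube_set (lev m x) y ->
  cube_set (lev m x) `<=` cube_set (lev m' y).
Proof.
move=> mm xy; have [_ _ H] := DG.
have [//|h|h] := H _ _ (lev_D m x) (lev_D m' y); last first.
  by have : (set0 : set 'rV[R]_n) y by rewrite -h; split => //; exact: lev_mem.
have := side_le (lev_side_gt0 m' y) h; rewrite !lev_side ler_eXz2l ?ltr1n// => m'm.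
have e : m = m' by apply/le_anti; rewrite mm m'm.
rewrite -e in h *; rewrite (lev_eq (lev_D m x) (lev_side m x) xy); exact: subset_refl.
Qed.

Lemma lev_meq m x y : cube_set (lev m x) y -> lev m y = lev m x.
Proof. by move=> xy; apply: lev_eq => //; [exact: lev_D|exact: lev_side]. Qed.

Lemma lev_mono m m' x y : m <= m' -> lev m x = lev m y -> lev m' x = lev m' y.
Proof.
move=> mm xy; apply: lev_meq.
by apply: (lev_sub mm (lev_mem m y)); rewrite -xy; exact: lev_mem.
Qed.

Lemma lev_subself m m' x : m <= m' -> cube_set (lev m x) `<=` cube_set (lev m' x).
Proof. by move=> mm; apply: lev_sub => //; exact: lev_mem. Qed.

Definition gen m : set (cube R n) := [set Q | D Q /\ side Q = 2 ^ m].

Lemma gen_lev m x : gen m (lev m x).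
Proof. by split; [exact: lev_D|exact: lev_side]. Qed.

Lemma corner_mem Q : 0 < side Q -> cube_set Q Q.1.
Proof. by move=> Q0 i; rewrite lexx ltrDl. Qed.

Lemma gen_corner m Q : gen m Q -> lev m Q.1 = Q.
Proof. by move=> [DQ sQ]; apply: lev_eq => //; apply: corner_mem; rewrite sQ pow2_gt0. Qed.

Let ratv (q : 'rV[rat]_n) : 'rV[R]_n := map_mx ratr q.

(** Every cube contains a point with rational coordinates, so that each
    generation is countable. *)
Lemma gen_rat m Q : gen m Q -> exists q, lev m (ratv q) = Q.
Proof.
move=> [DQ sQ]; have Q0 : 0 < side Q by rewrite sQ pow2_gt0.
have h i : {q : rat | Q.1 0 i <= ratr q < Q.1 0 i + side Q}.
  apply: cid; have /rat_in_itvoo[q] : Q.1 0 i < Q.1 0 i + side Q by rewrite ltrDl.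
  by rewrite in_itv/= => /andP[/ltW ? ?]; exists q; apply/andP.
exists (\row_i (projT1 (h i))); apply: lev_eq => // i.
by rewrite !mxE; exact: (projT2 (h i)).
Qed.

Lemma countable_gen m : countable (gen m).
Proof.
apply: (@sub_countable _ _ _ [set: 'rV[rat]_n]) => //.
apply: (card_le_trans (B := (fun q => lev m (ratv q)) @` setT)).
  by apply: subset_card_le => Q /gen_rat[q <-]; exists q.
exact: card_image_le.
Qed.

Lemma measurable_lev d (U : measurableType d) (h : cube R n -> X -> U) m :
  (forall Q, measurable_fun [set: X] (h Q)) ->
  measurable_fun [set: X] (fun x : X => h (lev m x) x).
Proof.
move=> mh _ Y mY; rewrite setTI.
have -> : (fun x : X => h (lev m x) x) @^-1` Y =
    \bigcup_(q : 'rV[rat]_n) ((cube_set (lev m (ratv q)) : set X) `&`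
       h (lev m (ratv q)) @^-1` Y).
  apply/seteqP; split => x /=.
    have [q qx] := gen_rat (gen_lev m x).
    by move=> hY; exists q => //; rewrite qx; split=> //; exact: lev_mem.
  by move=> [q _ [/lev_meq xq]] /=; rewrite xq.
apply: countable_bigcupT_measurable => // q.
apply: measurableI; first exact: measurable_cube.
by rewrite -[X in measurable X]setTI; exact: mh.
Qed.

Lemma measurable_lev_cst d (U : measurableType d) (h : cube R n -> U) m :
  measurable_fun [set: X] (fun x : X => h (lev m x)).
Proof. by apply: (measurable_lev (h := fun Q _ => h Q)) => Q; exact: measurable_cst. Qed.

Lemma measurable_lev_set (P : set (cube R n)) m :
  measurable ([set x | P (lev m x)] : set X).
Proof.
have := measurable_lev_cst (fun Q => `[< P Q >]) m.
move=> /(_ measurableT [set true]); rewrite setTI => h.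
have -> : ([set x | P (lev m x)] : set X) = (fun x : X => `[< P (lev m x) >]) @^-1` [set true].
  by apply/seteqP; split => x /=; [move/asboolP|move/asboolP].
exact: h.
Qed.

Local Open Scope ereal_scope.

Lemma esum_lev m x (a : cube R n -> \bar R) : (forall Q, 0 <= a Q) ->
  \esum_(Q in gen m) (if x \in cube_set Q then a Q else 0) = a (lev m x).
Proof.
move=> a0; rewrite -[RHS](@esum_set1 _ _ (lev m x) a)// esum_mkcond [RHS]esum_mkcond.
apply: eq_esum => Q _; case: ifPn.
  move=> /set_mem GQ; case: ifPn => [/set_mem xQ|xQ].
    by have := lev_eq GQ.1 GQ.2 xQ => <-; rewrite ifT// inE.
  rewrite ifF//; apply/negbTE; apply: contra xQ => /set_mem ->.
  by apply/mem_set; exact: lev_mem.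
move=> GQ; rewrite ifF//; apply/negbTE; apply: contra GQ => /set_mem ->.
by apply/mem_set; exact: gen_lev.
Qed.

Lemma integral_lev (mu : {measure set X -> \bar R}) m (h : cube R n -> X -> \bar R) :
  (forall Q, measurable_fun [set: X] (h Q)) -> (forall Q x, 0 <= h Q x) ->
  \esum_(Q in gen m) \int[mu]_(x in cube_set Q) h Q x = \int[mu]_x h (lev m x) x.
Proof.
move=> mh h0; have mQ Q : measurable (cube_set Q : set X) by exact: measurable_cube.
have mr Q : measurable_fun [set: X] (h Q \_ (cube_set Q)).
  by apply/(measurable_restrictT _ (mQ Q)); exact: measurable_funTS.
under eq_esum do rewrite integral_mkcond.
have cG := countable_gen m.
have r0 Q x : 0 <= (h Q \_ (cube_set Q)) x by rewrite patchE; case: ifP.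
rewrite -integral_esum//.
apply: eq_integral => x _.
by rewrite -(esum_lev m x (a := fun Q => h Q x)).
Qed.

Lemma esum_grid (a : cube R n -> \bar R) : (forall Q, 0 <= a Q) ->
  \esum_(Q in D) a Q = \esum_(m in [set: int]) \esum_(Q in gen m) a Q.
Proof.
move=> a0; rewrite esum_esum//.
apply: reindex_esum; split => [[m Q] [/= _ []]//|[m Q] [m' Q'] |Q DQ].
  rewrite !inE => -[/= _ [_ s1]] [/= _ [_ s2]] QQ; rewrite -QQ in s2 *.
  congr (_, _); apply: (@ieexprIz R 2) => //; first by rewrite pnatr_eq1.
  by rewrite /= -s1.
have [/(_ _ DQ)[m sQ] _ _] := DG.
by exists (m, Q).
Qed.

End Grid.

(** * Polynomials on cubes *)

Section Univariate.
Context (R : realFieldType).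

(** A polynomial of bounded degree is controlled on the unit interval by its
    values on any subinterval: induction on the degree, writing
    [q = q.[a] + ('X - a) * q1] and bounding [q1] on the half of the subinterval
    that stays away from the root [a]. The bound on the variation is obtained
    along the same induction. *)
Lemma univariate_bound (kappa : nat) (a b : R) : 0 <= a -> a < b -> b <= 1 ->
  exists2 A : R, 0 <= A & forall (q : {poly R}) (M : R), (size q <= kappa)%N ->
    (forall t, a <= t < b -> `|q.[t]| <= M) ->
    forall s t, 0 <= s <= 1 -> 0 <= t <= 1 ->
      `|q.[t]| <= A * M /\ `|q.[s] - q.[t]| <= A * M * `|s - t|.
Proof.
elim: kappa a b => [|k IH] a b a0 ab b1.
  exists 0 => // q M; rewrite leqn0 size_poly_eq0 => /eqP -> _ s t _ _.
  by rewrite !horner0 subrr normr0 !mul0r.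
pose c := (a + b) / 2.
have [||A A0 hA] := IH c b _ _ b1; [rewrite /c; lra|rewrite /c; lra|].
have ba : 0 < b - a by rewrite subr_gt0.
exists (1 + 8 * A / (b - a)).
  by rewrite addr_ge0// divr_ge0 ?(ltW ba)// mulr_ge0.
move=> q M sq qM s t s01 t01.
have qa : `|q.[a]| <= M by apply: qM; rewrite lexx.
have M0 : 0 <= M by apply: le_trans qa.
have /factor_theorem[q1 qE] : root (q - q.[a]%:P) a by rewrite /root !hornerE subrr.
have qt u : q.[u] = q.[a] + q1.[u] * (u - a).
  have /(congr1 (horner^~ u)) := qE; rewrite !hornerE => <-; ring.
have sq1 : (size q1 <= k)%N.
  have [->|q10] := eqVneq q1 0; first by rewrite size_poly0.
  have := size_Mmonic q10 (monicXsubC a); rewrite -qE size_XsubC addn2/= => sE.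
  rewrite -ltnS -sE; apply: leq_trans (size_polyD _ _) _.
  by rewrite size_polyN geq_max sq (leq_trans (size_polyC_leq1 _)).
have q1M u : c <= u < b -> `|q1.[u]| <= 4 * M / (b - a).
  move=> /andP[cu ub]; rewrite ler_pdivlMr//.
  have : `|q.[u]| <= M by apply: qM; rewrite ub andbT; move: cu; rewrite /c; lra.
  have := ler_normB q.[u] q.[a]; rewrite {1}qt [q.[a] + _]addrC addrK normrM => h1 h2.
  have : (b - a) / 2 <= `|u - a|.
    by apply: le_trans (ler_norm _); move: cu; rewrite /c; lra.
  have := normr_ge0 q1.[u]; move: h1 h2 qa; move: `|q1.[u]| `|u - a| `|q.[u]| `|q.[a]|.
  by move=> *; nra.
have [h1 h2] := hA _ _ sq1 q1M s t s01 t01.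
have [h3 _] := hA _ _ sq1 q1M s s s01 s01.
have ta : `|t - a| <= 1 by rewrite ler_norml; move/andP: t01 => [? ?]; lra.
have AE : A * (4 * M / (b - a)) = 4 * A / (b - a) * M by field; rewrite gt_eqF.
move: h1 h2 h3; rewrite AE; set B := 4 * A / (b - a).
have B0 : 0 <= B by rewrite divr_ge0 ?(ltW ba)// mulr_ge0.
have -> : 8 * A / (b - a) = 2 * B by rewrite /B; field; rewrite gt_eqF.
move=> h1 h2 h3; split.
  rewrite qt (le_trans (ler_normD _ _))// mulrDl mul1r lerD// normrM.
  have := normr_ge0 (t - a); have := normr_ge0 q1.[t].
  by move: h1 ta; move: `|q1.[t]| `|t - a| => u v *; nra.
have -> : q.[s] - q.[t] = (s - t) * q1.[s] + (t - a) * (q1.[s] - q1.[t]).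
  by rewrite (qt s) (qt t); ring.
rewrite (le_trans (ler_normD _ _))// !normrM.
have := normr_ge0 (t - a); have := normr_ge0 q1.[s]; have := normr_ge0 (s - t).
have := normr_ge0 (q1.[s] - q1.[t]).
move: h2 h3 ta; move: `|q1.[s] - q1.[t]| `|q1.[s]| `|t - a| `|s - t|.
move=> w u v z h2 h3 ta w0 z0 u0 v0.
have : z * u <= z * (B * M) by rewrite ler_wpM2l.
have : v * w <= 1 * (B * M * z) by rewrite ler_pM.
have : 0 <= M * z by rewrite mulr_ge0.
by nra.
Qed.

End Univariate.

Section Polynomials.
Context (R : realType) (n kappa : nat).
Implicit Types (x y z : 'rV[R]_n) (Q : cube R n) (g : 'rV[R]_n -> R).

(** The same functions as those of [poly_eval] and [poly_space], with
    coefficients indexed by a finite type. *)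
Definition polyfun g := exists c : mpoly.bmultinom n kappa -> R,
  g = fun x => \sum_b c b * monom b x.

Lemma polyfunD g h : polyfun g -> polyfun h -> polyfun (fun x => g x + h x).
Proof.
move=> [c ->] [c' ->]; exists (fun b => c b + c' b); apply/funext => x.
by rewrite -big_split; apply: eq_bigr => b _; rewrite mulrDl.
Qed.

Lemma polyfunZ (k : R) g : polyfun g -> polyfun (fun x => k * g x).
Proof.
move=> [c ->]; exists (fun b => k * c b); apply/funext => x.
by rewrite big_distrr; apply: eq_bigr => b _; rewrite /= mulrA.
Qed.

Lemma polyfunB g h : polyfun g -> polyfun h -> polyfun (fun x => g x - h x).
Proof.
move=> pg /(polyfunZ (-1)) ph; have := polyfunD pg ph.
by under eq_fun do rewrite mulN1r.
Qed.

Lemma polyfun_monom (b : mpoly.bmultinom n kappa) : polyfun (monom b).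
Proof.
exists (fun b' => (b' == b)%:R); apply/funext => x.
rewrite (bigD1 b)//= eqxx mul1r big1 ?addr0// => b' /negbTE ->.
by rewrite mul0r.
Qed.

Lemma polyfun_cst (k : R) : (0 < kappa)%N -> polyfun (fun=> k).
Proof.
case: kappa polyfunZ polyfun_monom => // k' pZ pm _.
have := pZ k _ (pm mpoly.bm0); congr polyfun; apply/funext => x.
rewrite /monom big1 ?mulr1// => i _.
by rewrite mpoly.mnm0E expr0.
Qed.

Lemma polyfun0 : polyfun (fun=> 0).
Proof.
by exists (fun=> 0); apply/funext => x; rewrite big1// => b _; rewrite mul0r.
Qed.

Definition set_coord (i : 'I_n) (t : R) x : 'rV[R]_n :=
  \row_j (if j == i then t else x 0 j).

Lemma polyfun_line g (i : 'I_n) x : polyfun g ->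
  exists2 q : {poly R}, (size q <= kappa)%N &
    forall t, g (set_coord i t x) = q.[t].
Proof.
move=> [c ->].
pose e (b : mpoly.bmultinom n kappa) := c b * \prod_(j < n | j != i) x 0 j ^+ b j.
exists (\sum_b e b *: 'X^(b i)).
  apply: leq_trans (size_sum _ _ _) _; apply/bigmax_leqP => b _.
  apply: leq_trans (size_scale_leq _ _) _; rewrite size_polyXn.
  have := mpoly.bmdeg b; rewrite mpoly.mdegE (bigD1 i)//=.
  exact: leq_ltn_trans (leq_addr _ _).
move=> t; rewrite horner_sum; apply: eq_bigr => b _.
rewrite hornerZ hornerXn /e -mulrA; congr (_ * _).
rewrite /monom (bigD1 i)//= mxE eqxx mulrC; congr (_ * _).
by apply: eq_bigr => j /negbTE ji; rewrite mxE ji.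
Qed.

Lemma polyfun_bounded g Q : polyfun g ->
  exists M, forall x, cube_set Q x -> `|g x| <= M.
Proof.
move=> [c ->]; pose B := \sum_(i < n) `|Q.1 0 i| + `|side Q|.
have B0 i : `|Q.1 0 i| + `|side Q| <= B.
  by rewrite lerD2r (bigD1 i)//= lerDl; apply: sumr_ge0.
exists (\sum_b `|c b| * \prod_(i < n) B ^+ (mpoly.bmnm b i)) => x xQ.
apply: le_trans (ler_norm_sum _ _ _) _; apply: ler_sum => b _.
rewrite normrM ler_wpM2l// /monom normr_prod; apply: ler_prod => i _.
rewrite normr_ge0/= normrX lerXn2r ?nnegrE//.
  by apply: le_trans (B0 i); rewrite addr_ge0.
apply: le_trans (B0 i).
have /andP[h1 h2] := xQ i; have := ler_norm (Q.1 0 i).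
have := ler_norm (side Q); have := lerNnormlW (lexx `|Q.1 0 i|).
have : 0 <= `|side Q| by [].
by rewrite ler_norml => *; apply/andP; split; lra.
Qed.

(** Markov's inequality, with a constant that is not made explicit: two points
    are joined inside a cube by moving one coordinate after the other, and
    along each such segment the polynomial is univariate. *)
Lemma polyfun_lipschitz : exists2 A : R, 0 <= A &
  forall g Q M, polyfun g -> 0 < side Q ->
    (forall x, cube_set Q x -> `|g x| <= M) ->
    forall x y, cube_set Q x -> cube_set Q y ->
      `|g x - g y| <= A * M * (supdist x y / side Q).
Proof.
have [A A0 hA] := univariate_bound kappa (lexx 0) ltr01 (lexx (1 : R)).
exists (n%:R * A); first by rewrite mulr_ge0.
move=> g Q M pg Q0 gM x y xQ yQ.
pose z k : 'rV[R]_n := \row_j (if (j < k)%N then y 0 j else x 0 j).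
have z0 : z 0%N = x by apply/rowP => j; rewrite mxE.
have zn : z n = y by apply/rowP => j; rewrite mxE ltn_ord.
have zQ k : cube_set Q (z k) by move=> j; rewrite mxE; case: ifP.
have step (k : 'I_n) :
    `|g (z k) - g (z k.+1)| <= A * M * (supdist x y / side Q).
  have [q sq gq] := polyfun_line k (z k) pg.
  pose q' := q \Po ((Q.1 0 k)%:P + side Q *: 'X).
  have s2 : size ((Q.1 0 k)%:P + side Q *: 'X) = 2%N.
    rewrite addrC size_polyDl size_scale ?gt_eqF// size_polyX//.
    by rewrite ltnS size_polyC_leq1.
  have sq' : (size q' <= kappa)%N by rewrite /q' size_comp_poly2.
  have q'E t : q'.[t] = g (set_coord k (Q.1 0 k + side Q * t) (z k)).
    by rewrite gq /q' horner_comp !hornerE.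
  have q'M t : 0 <= t < 1 -> `|q'.[t]| <= M.
    move=> /andP[t0 t1]; rewrite q'E; apply: gM => j; rewrite mxE.
    case: eqP => [->|_]; last exact: zQ.
    by rewrite lerDl ltrD2l gtr_pMr// t1 mulr_ge0// ltW.
  pose u (v : 'rV[R]_n) := (v 0 k - Q.1 0 k) / side Q.
  have u01 v : cube_set Q v -> 0 <= u v <= 1.
    move=> /(_ k)/andP[h1 h2]; rewrite divr_ge0 ?subr_ge0 ?(ltW Q0)//=.
    by rewrite ler_pdivrMr// mul1r lerBlDl ltW.
  have uE v : Q.1 0 k + side Q * u v = v 0 k.
    by rewrite /u mulrC divfK ?gt_eqF// addrC subrK.
  have gx : g (z k) = q'.[u x].
    rewrite q'E uE; congr g; apply/rowP => j; rewrite !mxE.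
    by case: eqP => // ->; rewrite ltnn.
  have gy : g (z k.+1) = q'.[u y].
    rewrite q'E uE; congr g; apply/rowP => j; rewrite !mxE ltnS leq_eqVlt.
    by rewrite (inj_eq val_inj); case: eqP => [->|].
  have [_] := hA _ _ sq' q'M _ _ (u01 _ xQ) (u01 _ yQ); rewrite gx gy.
  move=> /le_trans; apply; have M0 : 0 <= M by apply: le_trans (gM _ xQ).
  rewrite ler_wpM2l ?mulr_ge0// /u -mulrBl opprB addrA subrK.
  rewrite normrM normfV (gtr0_norm Q0) ler_wpM2r ?invr_ge0 ?(ltW Q0)//.
  exact: coord_le_supdist.
have -> : g x - g y = \sum_(k < n) (g (z k) - g (z k.+1)).
  rewrite -(big_mkord xpredT (fun k => g (z k) - g (z k.+1))).
  rewrite (telescope_sumr_eq (fun k => - g (z k)))//; last first.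
    by move=> k _; rewrite opprK addrC.
  by rewrite z0 zn opprK addrC.
apply: le_trans (ler_norm_sum _ _ _) _; apply: le_trans (ler_sum _ (fun k _ => step k)) _.
by rewrite sumr_const card_ord -[leLHS]mulr_natl !mulrA.
Qed.

End Polynomials.

(** * Polynomials against a doubling measure *)

(** The standing assumptions; the null measure is treated apart. *)
Record doubling_setting (R : realType) (n : nat)
    (mu : {measure set (borelRn R n) -> \bar R}) (C : R)
    (D : set (cube R n)) : Prop := DoublingSetting {
  setting_dim : (0 < n)%N;
  setting_C : 1 <= C;
  setting_doubling : doubling mu C;
  setting_finite : locally_finite mu;
  setting_nonzero : mu setT != 0%E;
  setting_grid : dyadic_grid D }.

Section Setting.
Context (R : realType) (n : nat).
Variables (mu : {measure set (borelRn R n) -> \bar R}) (C : R).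
Variable (D : set (cube R n)).
Hypothesis S : doubling_setting mu C D.
Local Notation X := (borelRn R n).
Local Notation lev := (lev (setting_grid S)).
Implicit Types (x y z : 'rV[R]_n) (m : int) (Q P : cube R n).

Definition mass Q : R := fine (mu (cube_set Q)).

Lemma massE Q : 0 < side Q -> mu (cube_set Q) = (mass Q)%:E.
Proof.
move=> Q0; rewrite fineK// ge0_fin_numE//.
exact: (mu_cube_lty (setting_C S) (setting_doubling S) (setting_finite S)).
Qed.

Lemma mass_gt0 Q : 0 < side Q -> 0 < mass Q.
Proof.
move=> Q0; rewrite -lte_fin -massE//.
exact: (mu_cube_gt0 (setting_C S) (setting_doubling S) (setting_nonzero S)).
Qed.

Lemma mass_ge0 Q : 0 <= mass Q. Proof. exact: fine_ge0. Qed.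

Lemma C_exp_ge0 k : 0 <= C ^+ k.
Proof. by rewrite exprn_ge0// (le_trans ler01 (setting_C S)). Qed.

Lemma C_exp_ge1 k : 1 <= C ^+ k.
Proof. exact: exprn_ege1 (setting_C S). Qed.

(** The exponents [5], [7] and [2 * 2 ^ k + 1] of [C] below are values of
    [2 * r + 1], where [r] is the number of side lengths of [Q] within which the
    larger set stays from the corner of [Q]. *)
Lemma mass_near (r : nat) P Q : 0 < side P -> 0 < side Q ->
  (forall x, cube_set P x -> forall i, `|x 0 i - Q.1 0 i| <= r%:R * side Q) ->
  mass P <= C ^+ (2 * r).+1 * mass Q.
Proof.
move=> P0 Q0 PQ; rewrite -lee_fin EFinM -!massE//.
by apply: (mu_near (setting_C S) (setting_doubling S)) => //; exact: measurable_cube.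
Qed.

Lemma lev_dist m x y : cube_set (lev m x) y -> supdist x y < 2 ^ m.
Proof.
move=> xy; apply/supdist_ltP => [|i]; first exact: pow2_gt0.
have := lev_mem (setting_grid S) m x; move=> /(_ i); have := xy i.
rewrite lev_side ltr_norml => /andP[? ?] /andP[? ?]; apply/andP; split; lra.
Qed.

Lemma lev_corner_dist m x i : `|x 0 i - (lev m x).1 0 i| <= 2 ^ m.
Proof.
have /(_ i) := lev_mem (setting_grid S) m x; rewrite lev_side ler_norml.
by move=> /andP[? ?]; apply/andP; split; lra.
Qed.

Lemma mass_lev_near m x y : supdist x y < 2 ^ m ->
  mass (lev m x) <= C ^+ 7 * mass (lev m y).
Proof.
move=> /supdist_ltP; rewrite pow2_gt0 => /(_ isT) xy.
apply: (@mass_near 3); try exact: lev_side_gt0.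
move=> z /lev_dist /supdist_ltP; rewrite pow2_gt0 => /(_ isT) xz i.
have := xy i; have := xz i; have := lev_corner_dist m y i; rewrite lev_side.
rewrite !ler_norml !ltr_norml => /andP[? ?] /andP[? ?] /andP[? ?].
by apply/andP; split; lra.
Qed.

Lemma mu_supball_le m x :
  (mu [set y : X | (supdist x y < 2 ^ m)%R] <= (C ^+ 5 * mass (lev m x))%:E)%E.
Proof.
rewrite EFinM -massE; last exact: lev_side_gt0.
apply: (mu_near (r := 2) (setting_C S) (setting_doubling S)); first exact: lev_side_gt0.
  have := measurable_xsection (x : X) (measurable_supdist_lt (n := n) (pow2_gt0 R m)).
  by congr measurable; apply/seteqP; split => y; rewrite /xsection/= inE.
move=> y /supdist_ltP; rewrite pow2_gt0 => /(_ isT) xy i.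
have := xy i; have := lev_corner_dist m x i; rewrite lev_side.
rewrite !ler_norml !ltr_norml => /andP[? ?] /andP[? ?].
by apply/andP; split; lra.
Qed.

Lemma pow2_nat m (k : nat) : 2 ^ m = 2 ^+ k * 2 ^ (m - k%:Z) :> R.
Proof.
have n2 : (2 : R) != 0 by rewrite pnatr_eq0.
by rewrite (_ : 2 ^+ k = 2 ^ k%:Z)// -expfzDr// addrC subrK.
Qed.

Lemma mass_sub (k : nat) m x y : cube_set (lev m x) y ->
  mass (lev m x) <= C ^+ (2 * 2 ^ k).+1 * mass (lev (m - k%:Z) y).
Proof.
move=> xy; apply: mass_near; try exact: lev_side_gt0.
move=> z xz i; rewrite lev_side natrX -pow2_nat.
have h0 : 0 < 2 ^ (m - k%:Z) :> R by exact: pow2_gt0.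
have mk : m - k%:Z <= m by rewrite gerBl.
have := xy i; have := xz i.
move=> h1 h2; have h := lev_subself (DG := setting_grid S) (setting_dim S) (x := y) mk.
have := h _ (corner_mem (lev_side_gt0 (setting_grid S) (m - k%:Z) y)) i.
rewrite (lev_meq xy).
move: h1 h2; rewrite lev_side => /andP[? ?] /andP[? ?] /andP[? ?].
by rewrite ler_norml; apply/andP; split; lra.
Qed.

Variable kappa : nat.

Lemma measurable_polyfun (g : X -> R) : polyfun kappa g -> measurable_fun [set: X] g.
Proof.
move=> [c ->]; apply: measurable_sum => b; apply: measurable_funM => //.
exact: measurable_monom.
Qed.

Lemma L2_bounded Q (g : X -> R) M : measurable_fun [set: X] g -> 0 < side Q ->
  (forall x, cube_set Q x -> `|g x| <= M) -> L2 mu (fun x => \1_(cube_set Q) x * g x).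
Proof.
move=> mg Q0 gM; have mQ : measurable (cube_set Q : set X) by exact: measurable_cube.
have mf : measurable_fun [set: X] (fun x : X => \1_(cube_set Q) x * g x).
  by apply: measurable_funM => //; exact: measurable_indic.
split => //.
apply: (@le_lt_trans _ _ (\int[mu]_x ((M ^+ 2)%:E * (\1_(cube_set Q : set X) x)%:E))%E).
  apply: ge0_le_integral => //.
  - by move=> x _; rewrite lee_fin sqr_ge0.
  - by apply/measurable_EFinP; apply: measurable_funX.
  - by apply: emeasurable_funM => //; apply/measurable_EFinP; exact: measurable_indic.
  - move=> x _; rewrite -EFinM lee_fin indicE.
    have [/set_mem xQ|_] := boolP (x \in _); last by rewrite mul0r expr0n/= mulr0.
    rewrite mul1r mulr1 -(real_normK (num_real (g x))) lerXn2r ?nnegrE ?gM//.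
    exact: le_trans (gM _ xQ).
rewrite ge0_integralZl//; last 2 first.
- by apply/measurable_EFinP; exact: measurable_indic.
- by rewrite lee_fin sqr_ge0.
by rewrite integral_indic// setIT massE// -EFinM ltry.
Qed.

Lemma L2_polyfun Q (g : X -> R) : polyfun kappa g -> 0 < side Q ->
  L2 mu (fun x => \1_(cube_set Q) x * g x).
Proof.
move=> pg Q0; have [M gM] := polyfun_bounded Q pg.
by apply: (L2_bounded _ Q0 gM); exact: measurable_polyfun.
Qed.

(** A polynomial stays above half of its supremum on a dyadic subcube whose
    relative size is fixed by Markov's inequality, and doubling gives that
    subcube a fixed fraction of the mass. *)
Lemma polyfun_sup_le_L2 : exists2 K : R, 0 <= K &
  forall m x0 (g : X -> R), polyfun kappa g ->
  exists M : R, [/\ 0 <= M, forall x, cube_set (lev m x0) x -> `|g x| <= M &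
    ((M ^+ 2 * mass (lev m x0))%:E <=
      K%:E * \int[mu]_(x in cube_set (lev m x0)) ((g x) ^+ 2)%:E)%E].
Proof.
have [A A0 hA] := polyfun_lipschitz R n kappa.
pose k := Num.bound (4 * A).
have kA : 4 * A <= 2 ^+ k.
  apply: (@le_trans _ _ k%:R); first by rewrite ltW// archi_boundP// mulr_ge0.
  by rewrite -natrX ler_nat ltnW// ltn_expl.
pose K := C ^+ (2 * 2 ^ k).+1.
exists (4 * K); first by rewrite mulr_ge0// C_exp_ge0.
move=> m x0 g pg; set P := lev m x0.
have P0 : 0 < side P by exact: lev_side_gt0.
have [M0 gM0] := polyfun_bounded P pg.
pose E := [set `|g x| | x in cube_set P].
have supE : has_sup E.
  split; first by exists `|g x0|; exists x0 => //; exact: lev_mem.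
  by exists M0 => _ [x xP <-]; exact: gM0.
pose M := sup E.
have gM x : cube_set P x -> `|g x| <= M.
  by move=> xP; apply: ub_le_sup; [exact: supE.2|exists x].
have M_ge0 : 0 <= M by apply: le_trans (gM x0 _) => //; exact: lev_mem.
exists M; split => //.
move: M_ge0; rewrite le_eqVlt => /orP[/eqP <-|M_gt0].
  rewrite expr0n mul0r mule_ge0 ?lee_fin ?mulr_ge0 ?C_exp_ge0//.
  by apply: integral_ge0 => x _; rewrite lee_fin sqr_ge0.
have [_ [z zP <-] gz] : exists2 t, E t & M - M / 4 < t.
  by apply: sup_adherent => //; rewrite divr_gt0.
set P' := lev (m - k%:Z) z.
have P'0 : 0 < side P' by exact: lev_side_gt0.
have P'P : cube_set P' `<=` cube_set P.
  rewrite /P -(lev_meq zP); apply: lev_subself; first exact: (setting_dim S).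
  by rewrite gerBl.
have gP' x : cube_set P' x -> M / 2 <= `|g x|.
  move=> xP'; have := hA _ _ _ pg P0 gM z x zP (P'P _ xP').
  have : A * M * (supdist z x / side P) <= M / 4.
    have := lev_dist xP'; rewrite /P lev_side (pow2_nat m k).
    have h0 : 0 < 2 ^ (m - k%:Z) :> R by exact: pow2_gt0.
    have h1 : 0 < 2 ^+ k :> R by rewrite exprn_gt0.
    move=> zx; rewrite mulrA ler_pdivrMr ?mulr_gt0//.
    have := supdist_ge0 z x; move: (supdist z x) (2 ^ _) (2 ^+ k) zx h0 h1 kA.
    move=> d e f de e0 f0 Af d0.
    have : A * M * d <= A * M * e.
      by apply: ler_wpM2l; [exact: mulr_ge0 A0 (ltW M_gt0)|exact: ltW].
    have : 4 * A * (M * e) <= f * (M * e).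
      by apply: ler_wpM2r => //; rewrite mulr_ge0// ltW.
    lra.
  have := ler_normD (g z - g x) (g x); rewrite subrK.
  by move: gz; lra.
have mP : measurable (cube_set P : set X) by exact: measurable_cube.
have mP' : measurable (cube_set P' : set X) by exact: measurable_cube.
have mg := measurable_polyfun pg.
apply: (@le_trans _ _ ((4 * K)%:E * \int[mu]_(x in cube_set P') ((g x) ^+ 2)%:E)%E);
    last first.
  apply: lee_wpmul2l; first by rewrite lee_fin mulr_ge0// C_exp_ge0.
  apply: ge0_subset_integral => //.
  - by apply/measurable_EFinP; apply: measurable_funTS; exact: measurable_funX.
  - by move=> x _; rewrite lee_fin sqr_ge0.
apply: (@le_trans _ _ ((4 * K)%:E * \int[mu]_(x in cube_set P') (cst (M ^+ 2 / 4)%:E x))%E);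
    last first.
  apply: lee_wpmul2l; first by rewrite lee_fin mulr_ge0// C_exp_ge0.
  apply: ge0_le_integral => //.
  - by move=> x _; rewrite lee_fin divr_ge0// sqr_ge0.
  - by apply/measurable_EFinP; apply: measurable_funTS; exact: measurable_funX.
  - move=> x xP'; rewrite lee_fin -[leRHS](real_normK (num_real _)).
    have := gP' _ xP'; have : 0 <= M / 2 by rewrite divr_ge0 ?ltW.
    by move=> *; nra.
rewrite integral_cst// massE// -!EFinM lee_fin.
have -> : 4 * K * (M ^+ 2 / 4 * mass P') = M ^+ 2 * (K * mass P') by field.
by rewrite ler_wpM2l ?sqr_ge0// mass_sub.
Qed.

End Setting.

(** * Boundary layers of dyadic cubes *)

Section Layer.
Context (R : realType) (n : nat).
Implicit Types (x y : 'rV[R]_n) (P : cube R n).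

Definition layer (t : R) P : set 'rV[R]_n :=
  cube_set P `\` cube_set (P.1 + const_mx t, side P - 2 * t).

Lemma layer_coord t P x : cube_set P x -> layer t P x ->
  exists i, x 0 i < P.1 0 i + t \/ P.1 0 i + side P - t <= x 0 i.
Proof.
move=> xP [_ h]; apply: contrapT => h'; apply: h => i; rewrite !mxE /side/=.
have : ~ (x 0 i < P.1 0 i + t \/ P.1 0 i + side P - t <= x 0 i).
  by move=> h''; apply: h'; exists i.
move=> /not_orP[/negP]; rewrite -leNgt => h1 /negP; rewrite -ltNge -/(side P) => h2.
by apply/andP; split; lra.
Qed.

(** Off the layer of width [t], a displacement by less than [t] stays in the
    cube. *)
Lemma not_layer_ball t P x y : cube_set P x -> ~ layer t P x ->
  supdist x y < t -> cube_set P y.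
Proof.
move=> xP xL xy i; have := coord_le_supdist x y i.
have : cube_set (P.1 + const_mx t, side P - 2 * t) x.
  by apply: contrapT => h; apply: xL.
move=> /(_ i); rewrite !mxE /side/= -/(side P) ler_norml => /andP[? ?] /andP[? ?].
by apply/andP; split; lra.
Qed.

Lemma layer_mono t t' P : t <= t' -> layer t P `<=` layer t' P.
Proof.
move=> tt x [xP xt]; split => // xt'; apply: xt => i; move: (xt' i).
by rewrite !mxE /side/= => /andP[? ?]; apply/andP; split; lra.
Qed.

Lemma measurable_layer t P : measurable (layer t P : set (borelRn R n)).
Proof. by apply: measurableD; exact: measurable_cube. Qed.

(** The rate at which boundary layers lose mass when their width is halved:
    its cube is at least [1 - C ^- 17], which bounds the part of its mass that a
    cube keeps when a grid cube of an eighth of its size is removed. *)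
Definition layer_rate (C : R) : R := 1 - (C ^+ 17)^-1 / 3.

Lemma layer_rate_bounds (C : R) : 1 <= C -> 2 / 3 <= layer_rate C < 1.
Proof.
move=> C1; have h : 1 <= C ^+ 17 by exact: exprn_ege1.
have h0 : 0 < C ^+ 17 by apply: lt_le_trans h.
have : (C ^+ 17)^-1 <= 1 by rewrite invf_le1.
have : 0 < (C ^+ 17)^-1 by rewrite invr_gt0.
by rewrite /layer_rate => *; apply/andP; split; lra.
Qed.

End Layer.

Section LayerDecay.
Context (R : realType) (n : nat).
Variables (mu : {measure set (borelRn R n) -> \bar R}) (C : R).
Variable (D : set (cube R n)).
Hypothesis S : doubling_setting mu C D.
Local Notation X := (borelRn R n).
Local Notation lev := (lev (setting_grid S)).
Local Notation mass := (mass mu).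
Implicit Types (x y z : 'rV[R]_n) (m : int) (Q P : cube R n).

Let rho : R := 1 - (C ^+ 17)^-1.
Local Notation lam := (layer_rate C).

Lemma layer_rate_itv : 2 / 3 <= lam < 1.
Proof. exact: layer_rate_bounds (setting_C S). Qed.

Lemma layer_rate_gt0 : 0 < lam.
Proof. by have /andP[h _] := layer_rate_itv; lra. Qed.

Let rho_ge0 : 0 <= rho.
Proof.
have h := C_exp_ge1 S 17; have h0 : 0 < C ^+ 17 by apply: lt_le_trans h.
by rewrite subr_ge0 invf_le1.
Qed.

Let rho_lam : rho <= lam ^+ 3.
Proof.
rewrite /rho /layer_rate; set u := (C ^+ 17)^-1.
have : u <= 1 by move: rho_ge0; rewrite /rho -/u; lra.
have : 0 <= u by rewrite invr_ge0 (C_exp_ge0 S).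
move=> u0 u1; have := mulr_ge0 u0 u0 => uu.
have -> : (1 - u / 3) ^+ 3 = 1 - u + u * u * (9 - u) / 27 by field.
have : 0 <= u * u * (9 - u) by rewrite mulr_ge0//; lra.
by lra.
Qed.

Lemma mu_gen m (B : set X) : measurable B ->
  mu B = \esum_(Q in gen D m) mu (B `&` cube_set Q).
Proof.
move=> mB; have mQ Q : measurable (cube_set Q : set X) by exact: measurable_cube.
have -> : mu B = (\int[mu]_x (\1_B x)%:E)%E by rewrite integral_indic// setIT.
rewrite -(integral_lev (setting_grid S) mu m (h := fun _ x => (\1_B x)%:E)).
- by apply: eq_esum => Q _; rewrite integral_indic.
- by move=> Q; apply/measurable_EFinP; exact: measurable_indic.
- by move=> Q x; rewrite lee_fin.
Qed.

(** Tile the cube [P] by the cubes [Q] of side [2 ^ m] of the grid. Those which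
    meet the layer of width [2 ^ m / 4] lie in the layer of width [2 * 2 ^ m].
    The centre of [Q] is at distance at least [2 ^ m / 2] from the complement of
    [P], so the grid cube of side [2 ^ m / 8] around it avoids the thin layer,
    and by doubling this subcube has a fixed fraction of the mass of [Q]. *)
Lemma layer_step j m x0 : m <= j ->
  (mu (layer (2 ^ (m - 2)) (lev j x0) : set X) <=
   rho%:E * mu (layer (2 ^ (m + 1)) (lev j x0) : set X))%E.
Proof.
move=> mj; set P := lev j x0.
set L := layer (2 ^ (m - 2)) P; set L' := layer (2 ^ (m + 1)) P.
have mL : measurable (L : set X) by exact: measurable_layer.
have mL' : measurable (L' : set X) by exact: measurable_layer.
have p0 : 0 < 2 ^ m :> R by exact: pow2_gt0.
have e1 : 2 ^ (m + 1) = 2 * 2 ^ m :> R.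
  by rewrite (pow2_nat R (m + 1) 1) expr1 addrK.
have e2 : 2 ^ (m - 2) = 2 ^ m / 4 :> R.
  by rewrite (pow2_nat R m 2) expr2; field.
have e3 : 2 ^ (m - 3) = 2 ^ m / 8 :> R.
  by rewrite (pow2_nat R m 3) !exprS expr0; field.
rewrite (mu_gen m mL) (mu_gen m mL') -esumZl//.
apply: le_esum => Q GQ; have [DQ sQ] := GQ.
have Q0 : 0 < side Q by rewrite sQ.
have mQ : measurable (cube_set Q : set X) by exact: measurable_cube.
have [->|] := eqVneq (L `&` cube_set Q) set0.
  by rewrite measure0 mule_ge0// lee_fin.
move=> /set0P[x [xL xQ]].
have levQ y : cube_set Q y -> lev m y = Q by exact: lev_eq.
have QP : cube_set Q `<=` cube_set P.
  rewrite /P -(lev_meq xL.1) -(levQ x xQ).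
  exact: (lev_subself (setting_dim S)).
have QL' : cube_set Q `<=` L'.
  move=> y yQ; split; first exact: QP.
  have [i hi] := layer_coord xL.1 xL.
  move=> /(_ i); rewrite !mxE /side/= -/(side P) e1 => /andP[h1 h2].
  have /andP[x1 x2] := xQ i; have /andP[y1 y2] := yQ i.
  by move: hi; rewrite e2 sQ in x2 y2 * => -[]; lra.
have -> : L' `&` cube_set Q = cube_set Q by apply/setIidr.
pose c := Q.1 + const_mx (2 ^ m / 2).
have cQ : cube_set Q c by move=> i; rewrite !mxE sQ; apply/andP; split; lra.
pose Q' := lev (m - 3) c.
have Q'0 : 0 < side Q' by exact: lev_side_gt0.
have mQ' : measurable (cube_set Q' : set X) by exact: measurable_cube.
have Q'Q : cube_set Q' `<=` cube_set Q.
  rewrite -(levQ c cQ); apply: (lev_subself (setting_dim S)); lia.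
have Q'L z : cube_set Q' z -> ~ L z.
  move=> zQ' zL; have [i] := layer_coord zL.1 zL.
  have [h1 h2] := cube_sub_coord i Q0 QP; rewrite sQ in h2.
  have /supdist_ltP := lev_dist zQ'; rewrite pow2_gt0 => /(_ isT i).
  rewrite !mxE e2 e3 ltr_norml => /andP[h3 h4].
  by move=> []; lra.
apply: (@le_trans _ _ (mu (cube_set Q `\` cube_set Q'))).
  apply: le_measure; rewrite ?inE; [exact: measurableI|exact: measurableD|].
  by move=> z [zL zQ]; split => // /Q'L.
have muQ : (mu (cube_set Q) < +oo)%E by rewrite (massE S)// ltry.
have -> : (mu (cube_set Q `\` cube_set Q') = mu (cube_set Q) - mu (cube_set Q'))%E.
  rewrite measureD//; congr (_ - mu _)%E.
  by apply/seteqP; split => z; [case|move=> zQ'; split => //; exact: Q'Q].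
rewrite !(massE S)// -EFinB -EFinM lee_fin /rho mulrBl mul1r lerD2l lerN2.
have h := C_exp_ge1 S 17; have h0 : 0 < C ^+ 17 by apply: lt_le_trans h.
rewrite mulrC ler_pdivrMr// mulrC.
have := mass_sub 3 (lev_mem (setting_grid S) m c).
by rewrite (levQ c cQ).
Qed.

Lemma layer_le_mass j t x0 :
  (mu (layer t (lev j x0) : set X) <= (mass (lev j x0))%:E)%E.
Proof.
rewrite -(massE S) ?lev_side_gt0//; apply: le_measure; rewrite ?inE.
- exact: measurable_layer.
- exact: measurable_cube.
- by move=> x [].
Qed.

(** One step divides the width by [8] and multiplies the mass by at most
    [lam ^+ 3]; the factor [lam ^- 3] accounts for the remainder of [i] modulo
    [3] and for the first step. *)
Lemma layer_decay j x0 (i : nat) :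
  (mu (layer (2 ^ (j - i%:Z)) (lev j x0) : set X) <=
    (lam ^- 3 * lam ^+ i * mass (lev j x0))%:E)%E.
Proof.
have /andP[lam23 lam1] := layer_rate_itv; have lam0 := layer_rate_gt0.
have l3 k : 0 < lam ^+ k by rewrite exprn_gt0.
have lle k l : (k <= l)%N -> lam ^+ l <= lam ^+ k.
  by move=> kl; apply: ler_wiXn2l => //; exact: ltW.
have step (k : nat) :
    (mu (layer (2 ^ (j - 1 - (3 * k)%:Z)) (lev j x0) : set X) <=
      (rho ^+ k * mass (lev j x0))%:E)%E.
  elim: k => [|k IH].
    by rewrite expr0 mul1r; exact: layer_le_mass.
  have := @layer_step j (j - 2 - (3 * k)%:Z) x0.
  have -> : j - 2 - (3 * k)%:Z - 2 = j - 1 - (3 * k.+1)%:Z by lia.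
  have -> : j - 2 - (3 * k)%:Z + 1 = j - 1 - (3 * k)%:Z by lia.
  move=> h; apply: le_trans (h _) _; first lia.
  rewrite exprS -mulrA EFinM; apply: lee_wpmul2l; last exact: IH.
  by rewrite lee_fin.
case: i => [|i].
  rewrite expr0 mulr1; apply: le_trans (layer_le_mass _ _ _) _.
  rewrite lee_fin ler_peMl ?mass_ge0// -exprVn exprn_ege1// invf_ge1//.
  exact: ltW.
pose k := (i %/ 3)%N.
have ik : (3 * k <= i <= 3 * k + 2)%N by rewrite /k; lia.
apply: (@le_trans _ _ (mu (layer (2 ^ (j - 1 - (3 * k)%:Z)) (lev j x0) : set X))).
  apply: le_measure; rewrite ?inE; try exact: measurable_layer.
  apply: layer_mono; rewrite ler_eXz2l ?ltr1n//; lia.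
apply: le_trans (step k) _; rewrite lee_fin ler_wpM2r ?mass_ge0//.
apply: (@le_trans _ _ ((lam ^+ 3) ^+ k)); first by rewrite lerXn2r ?nnegrE// ltW.
rewrite -exprM mulrC ler_pdivlMr// -exprD; apply: lle; lia.
Qed.

End LayerDecay.

(** * Orthogonal projections *)

Section PolyEval.
Context (R : realType) (n kappa : nat).

Lemma poly_eval_polyfun (p : mpoly.mpoly n R) :
  (mpoly.mmeasure (@mpoly.mdeg n) p <= kappa)%N -> polyfun kappa (poly_eval p).
Proof.
move=> /mpoly.mpolywE pE; exists (fun b => mpoly.mcoeff b p).
apply/funext => x; rewrite [in LHS]pE /poly_eval raddf_sum/=.
by apply: eq_bigr => b _; rewrite mpoly.mevalZ mpoly.mevalX.
Qed.

Lemma polyfun_poly_eval (g : 'rV[R]_n -> R) : polyfun kappa g ->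
  exists2 p : mpoly.mpoly n R,
    (mpoly.mmeasure (@mpoly.mdeg n) p <= kappa)%N & poly_eval p = g.
Proof.
move=> [c ->]; exists (\sum_(b : mpoly.bmultinom n kappa)
    c b *: mpoly.mpolyX R b).
  apply: leq_trans (mpoly.mmeasure_sum _ _ _ _) _; apply/bigmax_leqP => b _.
  apply: leq_trans (mpoly.mmeasureZ_le _ _ _) _; rewrite mpoly.mmeasureX.
  exact: mpoly.bmdeg.
apply/funext => x; rewrite /poly_eval raddf_sum/=.
by apply: eq_bigr => b _; rewrite mpoly.mevalZ mpoly.mevalX.
Qed.

Lemma poly_spaceP (Q : cube R n) (f : 'rV[R]_n -> R) : poly_space kappa Q f <->
  exists2 g, polyfun kappa g & f = (fun x => \1_(cube_set Q) x * g x).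
Proof.
split=> [[c ->]|[_ [c ->] ->]].
  exists (fun x => \sum_b c b * monom b x); first by exists c.
  by apply/funext => x; rewrite big_distrr; apply: eq_bigr => b _; rewrite /= mulrCA.
exists c; apply/funext => x; rewrite big_distrr.
by apply: eq_bigr => b _; rewrite /= mulrCA.
Qed.

End PolyEval.

Section OrthogonalProjection.
Context (R : realType) (n : nat).
Variables (mu : {measure set (borelRn R n) -> \bar R}).
Local Notation X := (borelRn R n).
Implicit Types (V : set ('rV[R]_n -> R)) (f g h : X -> R).

Lemma is_oprojP V f g : (forall h, V h -> L2 mu h) -> L2 mu f ->
  is_oproj mu V f g <->
  V g /\ forall h, V h -> ip mu (fun x => f x - g x) h = 0.
Proof.
move=> VL fL; split => -[Vg gP]; split => // h Vh.
  by rewrite /ip gP.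
rewrite (ipE (f := fun x => f x - g x)) ?gP//; [exact: L2B fL (VL _ Vg)|exact: VL].
Qed.

(** Two representatives of an orthogonal projection differ by a null vector,
    which no inner product can see. *)
Lemma is_oproj_ip V f g g' : (forall h, V h -> L2 mu h) -> L2 mu f ->
  (forall h h', V h -> V h' -> V (fun x => h x - h' x)) ->
  is_oproj mu V f g -> is_oproj mu V f g' ->
  forall h, L2 mu h -> ip mu h g = ip mu h g'.
Proof.
move=> VL fL VB /(is_oprojP _ VL fL)[Vg gP] /(is_oprojP _ VL fL)[Vg' g'P] h hL.
have [gL g'L] := (VL _ Vg, VL _ Vg').
have Vw := VB _ _ Vg Vg'; have wL := VL _ Vw.
have : ip mu h (fun x => g x - g' x) = 0.
  apply: ip_null => //.
  have e1 := gP _ Vw; have e2 := g'P _ Vw.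
  by rewrite ipBl// in e1; rewrite ipBl// in e2; rewrite ipBl//; lra.
by rewrite ipBr// => /eqP; rewrite subr_eq0 => /eqP.
Qed.

Lemma ip_indic (A : set X) f h : ip mu (fun x => \1_A x * f x) (fun x => \1_A x * h x)
  = ip mu f (fun x => \1_A x * h x).
Proof.
congr fine; apply: eq_integral => x _; congr EFin; rewrite indicE.
by case: (x \in A); rewrite ?mul1r// !mul0r mulr0.
Qed.

Lemma integral_indicM (A : set X) f : measurable A ->
  (\int[mu]_(x in A) (f x)%:E = \int[mu]_x (\1_A x * f x)%:E)%E.
Proof.
move=> mA; rewrite integral_mkcond; apply: eq_integral => x _.
by rewrite patchE indicE; case: ifP => _; rewrite ?mul1r ?mul0r.
Qed.

Lemma integral_sqr_indic (A : set X) f : measurable A ->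
  L2 mu (fun x => \1_A x * f x) ->
  (\int[mu]_(x in A) ((f x) ^+ 2)%:E =
   (ip mu (fun x => \1_A x * f x) (fun x => \1_A x * f x))%:E)%E.
Proof.
move=> mA fL; rewrite -ipE2// integral_indicM//; apply: eq_integral => x _.
by rewrite indicE; case: (x \in A); rewrite ?mul1r// !mul0r expr0n.
Qed.

End OrthogonalProjection.

Section PolyProj.
Context (R : realType) (n : nat).
Variables (mu : {measure set (borelRn R n) -> \bar R}) (C : R).
Variable (D : set (cube R n)).
Hypothesis S : doubling_setting mu C D.
Variable kappa : nat.
Local Notation X := (borelRn R n).
Local Notation lev := (lev (setting_grid S)).
Implicit Types (x y z : 'rV[R]_n) (m : int) (Q P : cube R n) (f g h : X -> R).

Lemma poly_space_L2 Q h : 0 < side Q -> poly_space kappa Q h -> L2 mu h.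
Proof. by move=> Q0 /poly_spaceP[g pg ->]; exact: (L2_polyfun S pg Q0). Qed.

Lemma poly_projP Q f : 0 < side Q -> L2 mu f ->
  is_oproj mu (poly_space kappa Q) f (poly_proj mu kappa Q f).
Proof.
move=> Q0 fL; rewrite /poly_proj /oproj; case: xgetP => // noproj; exfalso.
pose v (b : mpoly.bmultinom n kappa) x := \1_(cube_set Q) x * monom b x.
have vL b : L2 mu (v b) by apply: (L2_polyfun S (polyfun_monom R b) Q0).
have [c cP] := least_squares vL fL.
apply: (noproj (fun x => \sum_b c b * v b x)) => /=.
apply/is_oprojP => //; first by move=> h; exact: poly_space_L2.
split; first by exists c.
move=> _ [e ->]; rewrite ipC ip_suml//; last first.
  by apply: L2B => //; apply: L2_sum => b; exact: L2Z.
by rewrite big1// => b _; rewrite ipC cP mulr0.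
Qed.

Lemma pol_exists Q f : exists g, polyfun kappa g /\ (0 < side Q -> L2 mu f ->
  poly_proj mu kappa Q f = (fun x => \1_(cube_set Q) x * g x)).
Proof.
have [[Q0 fL]|h] := pselect (0 < side Q /\ L2 mu f).
  by have [/poly_spaceP[g pg gE] _] := poly_projP Q0 fL; exists g.
by exists (fun=> 0); split; [exact: polyfun0|move=> Q0 fL; case: h].
Qed.

(** Unlike [poly_proj], this is not cut off outside [Q], so that Markov's
    inequality applies to it. *)
Definition pol Q f : X -> R := projT1 (cid (pol_exists Q f)).

Lemma pol_polyfun Q f : polyfun kappa (pol Q f).
Proof. by have [] := projT2 (cid (pol_exists Q f)). Qed.

Lemma poly_projE Q f : 0 < side Q -> L2 mu f ->
  poly_proj mu kappa Q f = (fun x => \1_(cube_set Q) x * pol Q f x).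
Proof. by have [] := projT2 (cid (pol_exists Q f)). Qed.

Lemma measurable_pol Q f : measurable_fun [set: X] (pol Q f).
Proof. exact: measurable_polyfun (pol_polyfun Q f). Qed.

Definition res Q f : X -> R := fun x => \1_(cube_set Q) x * (f x - pol Q f x).

Let mQ Q : measurable (cube_set Q : set X). Proof. exact: measurable_cube. Qed.

Lemma L2_sub_polyfun Q f g : 0 < side Q -> L2 mu f -> polyfun kappa g ->
  L2 mu (fun x => \1_(cube_set Q) x * (f x - g x)).
Proof.
move=> Q0 fL pg; under eq_fun do rewrite mulrBr.
by apply: L2B; [exact: L2_indic|exact: (L2_polyfun S pg Q0)].
Qed.

Lemma res_L2 Q f : 0 < side Q -> L2 mu f -> L2 mu (res Q f).
Proof. by move=> Q0 fL; apply: L2_sub_polyfun => //; exact: pol_polyfun. Qed.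

Lemma res_orth Q f g : 0 < side Q -> L2 mu f -> polyfun kappa g ->
  ip mu (res Q f) (fun x => \1_(cube_set Q) x * g x) = 0.
Proof.
move=> Q0 fL pg; have VL h := @poly_space_L2 Q h Q0.
have /(is_oprojP _ VL fL)[Vp pP] := poly_projP Q0 fL.
rewrite -(pP (fun x => \1_(cube_set Q) x * g x)); last first.
  by apply/poly_spaceP; exists g.
rewrite poly_projE// -ip_indic.
rewrite -[RHS]ip_indic; congr (ip mu _ _); apply/funext => x; rewrite /res indicE.
by case: (x \in _); rewrite ?mul1r ?mul0r.
Qed.

Definition err Q f : \bar R := (\int[mu]_(x in cube_set Q) ((f x - pol Q f x) ^+ 2)%:E)%E.

Lemma errE Q f : 0 < side Q -> L2 mu f -> err Q f = (ip mu (res Q f) (res Q f))%:E.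
Proof.
move=> Q0 fL; rewrite /err (integral_sqr_indic (f := fun x => f x - pol Q f x))//.
exact: res_L2.
Qed.

Lemma err_ge0 Q f : (0 <= err Q f)%E.
Proof. by apply: integral_ge0 => x _; rewrite lee_fin sqr_ge0. Qed.

Lemma err_le Q f g : 0 < side Q -> L2 mu f -> polyfun kappa g ->
  (err Q f <= \int[mu]_(x in cube_set Q) ((f x - g x) ^+ 2)%:E)%E.
Proof.
move=> Q0 fL pg; have rL := res_L2 Q0 fL.
have pd := polyfunB (pol_polyfun Q f) pg.
have dL := L2_polyfun S pd Q0.
have e : (fun x => \1_(cube_set Q) x * (f x - g x)) =
    (fun x => res Q f x + \1_(cube_set Q) x * (pol Q f x - g x)).
  by apply/funext => x; rewrite /res -mulrDr addrA subrK.
rewrite errE// (integral_sqr_indic (f := fun x => f x - g x))//; last first.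
  exact: L2_sub_polyfun.
rewrite e (ip_pythagoras rL dL); last exact: res_orth.
by rewrite lee_fin lerDl ip_ge0.
Qed.

End PolyProj.

(** * Generations of projections *)

Section Generations.
Context (R : realType) (n : nat).
Variables (mu : {measure set (borelRn R n) -> \bar R}) (C : R).
Variable (D : set (cube R n)).
Hypothesis S : doubling_setting mu C D.
Variable kappa : nat.
Local Notation X := (borelRn R n).
Local Notation lev := (lev (setting_grid S)).
Local Notation pol := (pol S kappa).
Local Notation res := (res S kappa).
Local Notation err := (err S kappa).
Implicit Types (x y z : 'rV[R]_n) (m : int) (Q P : cube R n) (f g h : X -> R).

Let mQ Q : measurable (cube_set Q : set X). Proof. exact: measurable_cube. Qed.

Definition gen_proj m f : X -> R := fun x => pol (lev m x) f x.

Lemma measurable_proj m f : measurable_fun [set: X] (gen_proj m f).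
Proof. by apply: (measurable_lev (setting_grid S) (h := fun Q => pol Q f)) => Q; exact: measurable_pol. Qed.

Definition gen_err m f : \bar R := (\int[mu]_x ((f x - gen_proj m f x) ^+ 2)%:E)%E.

Lemma gen_err_ge0 m f : (0 <= gen_err m f)%E.
Proof. by apply: integral_ge0 => x _; rewrite lee_fin sqr_ge0. Qed.

Lemma gen_errE m f : measurable_fun [set: X] f ->
  gen_err m f = (\esum_(Q in gen D m) err Q f)%E.
Proof.
move=> mf; rewrite /gen_err /gen_proj.
rewrite -(integral_lev (setting_grid S) mu m
  (h := fun Q x => ((f x - pol Q f x) ^+ 2)%:E))//.
  move=> Q; apply/measurable_EFinP; apply: measurable_funX.
  by apply: measurable_funB => //; exact: measurable_pol.
by move=> Q x; rewrite lee_fin sqr_ge0.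
Qed.

Lemma gen_side m Q : gen D m Q -> 0 < side Q.
Proof. by move=> [_ ->]; exact: pow2_gt0. Qed.

(** The projections on the cubes are best approximations, so that any
    competitor given cube by cube bounds the error. *)
Lemma gen_err_le m f (p : cube R n -> X -> R) : L2 mu f ->
  (forall Q, polyfun kappa (p Q)) ->
  (gen_err m f <= \int[mu]_x ((f x - p (lev m x) x) ^+ 2)%:E)%E.
Proof.
move=> fL pp; have mf := L2_measurable fL; rewrite gen_errE//.
rewrite -(integral_lev (setting_grid S) mu m
  (h := fun Q x => ((f x - p Q x) ^+ 2)%:E)).
- by apply: le_esum => Q GQ; apply: err_le => //; exact: gen_side GQ.
- move=> Q; apply/measurable_EFinP; apply: measurable_funX.
  by apply: measurable_funB => //; exact: (measurable_polyfun (pp Q)).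
- by move=> Q x; rewrite lee_fin sqr_ge0.
Qed.

Lemma gen_err_le_sqr m f : L2 mu f ->
  (gen_err m f <= \int[mu]_x ((f x) ^+ 2)%:E)%E.
Proof.
move=> fL; apply: le_trans (gen_err_le m fL (p := fun _ _ => 0) _) _.
  by move=> Q; exact: polyfun0.
by under eq_integral do rewrite subr0.
Qed.

Lemma L2_sub_proj m f : L2 mu f -> L2 mu (fun x => f x - gen_proj m f x).
Proof.
move=> fL; split.
  by apply: measurable_funB; [exact: L2_measurable fL|exact: measurable_proj].
by apply: le_lt_trans (gen_err_le_sqr m fL) _; case: fL.
Qed.

Lemma L2_proj m f : L2 mu f -> L2 mu (gen_proj m f).
Proof.
move=> fL; have := L2B fL (L2_sub_proj m fL).
by under eq_fun do rewrite opprB addrC subrK.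
Qed.

Lemma gen_err_young (t : R) m f g : 0 < t -> L2 mu f -> L2 mu g ->
  (gen_err m f <= (1 + t)%:E * gen_err m g + (1 + t^-1)%:E * gen_err m (f \- g)%R)%E.
Proof.
move=> t0 fL gL; have dL := L2B fL gL.
apply: le_trans (gen_err_le m fL (p := fun Q x => pol Q g x + pol Q (f \- g) x) _) _.
  by move=> Q; apply: polyfunD; exact: pol_polyfun.
apply: le_trans (integral_young mu measurableT (L2_measurable (L2_sub_proj m gL))
  (L2_measurable (L2_sub_proj m dL)) t0).
rewrite le_eqVlt; apply/orP; left; apply/eqP; apply: eq_integral => x _.
by congr ((_ ^+ 2)%:E); rewrite /gen_proj /=; ring.
Qed.

Lemma integral_lev_eq0 m f : mu.-integrable setT (EFin \o f) ->
  (forall Q, gen D m Q -> (\int[mu]_(x in cube_set Q) (f x)%:E = 0)%E) ->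
  (\int[mu]_x (f x)%:E = 0)%E.
Proof.
move=> fi f0; have [mf fy] := integrableP _ _ _ fi.
have mp := measurable_funepos mf; have mn := measurable_funeneg mf.
rewrite integralE.
rewrite -(integral_lev (setting_grid S) mu m (h := fun _ => ((EFin \o f)^\+)%E))//.
rewrite -(integral_lev (setting_grid S) mu m (h := fun _ => ((EFin \o f)^\-)%E))//.
rewrite (_ : (\esum_(Q in gen D m) \int[mu]_(x in cube_set Q) ((EFin \o f)^\+ x) =
  \esum_(Q in gen D m) \int[mu]_(x in cube_set Q) ((EFin \o f)^\- x))%E); last first.
  apply: eq_esum => Q GQ; have := f0 Q GQ; rewrite integralE.
  have fiQ : mu.-integrable (cube_set Q) (EFin \o f) by exact: integrableS fi.
  move=> /eqP; rewrite sube_eq.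
  - by rewrite add0e => /eqP.
  - exact: integrable_pos_fin_num.
  - by rewrite fin_num_adde_defr// integrable_neg_fin_num.
rewrite (integral_lev (setting_grid S) mu m (h := fun _ => ((EFin \o f)^\-)%E))//.
by rewrite subee// integrable_neg_fin_num.
Qed.

(** On each cube these are the normal equations of the projection; the
    integrability of the product allows to add them over the cubes. *)
Lemma proj_orth m f (p : cube R n -> X -> R) : L2 mu f ->
  (forall Q, polyfun kappa (p Q)) -> L2 mu (fun x => p (lev m x) x) ->
  ip mu (fun x => f x - gen_proj m f x) (fun x => p (lev m x) x) = 0.
Proof.
move=> fL pp pL; rewrite /ip (@integral_lev_eq0 m)//.
  exact: (L2_int (L2_sub_proj m fL) pL).
move=> Q GQ; have Q0 := gen_side GQ.
have /(congr1 (@EFin R)) := res_orth S Q0 fL (pp Q).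
rewrite -ipE; [|exact: res_L2|exact: (L2_polyfun S (pp Q) Q0)].
move=> e0; rewrite -[RHS]e0 integral_indicM//; apply: eq_integral => x _.
rewrite /res /gen_proj indicE; have [/set_mem xQ|_] := boolP (x \in _); last first.
  by rewrite !mul0r.
by rewrite !mul1r (lev_eq _ GQ.1 GQ.2 xQ).
Qed.

(** A child is determined by the set of coordinates in which its corner is
    above that of [Q]. *)
Lemma finite_children m Q : gen D m Q -> finite_set (children D Q).
Proof.
move=> [DQ sQ].
pose pt (v : {ffun 'I_n -> bool}) : 'rV[R]_n := \row_i (Q.1 0 i + side Q / 2 * (v i)%:R).
apply: (@sub_finite_set _ _ ((fun v => lev (m - 1) (pt v)) @` setT)); last first.
  exact: finite_image.
move=> Q' [DQ' sQ' Q'Q]; have Q0 : 0 < side Q by rewrite sQ pow2_gt0.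
have Q'0 : 0 < side Q' by rewrite sQ' divr_gt0.
exists [ffun i => Q.1 0 i < Q'.1 0 i] => //.
apply: lev_eq => //.
  by rewrite sQ' sQ (pow2_nat R m 1) expr1; field.
move=> i; rewrite mxE ffunE.
have [] := cube_sub_coord i Q'0 Q'Q; rewrite sQ'.
case: ltP => /= h1 h2 h3; apply/andP; split; lra.
Qed.

(** The children of [Q] are the cubes of generation [m - 1] inside [Q], and
    exactly one of them contributes at each point. *)
Lemma alpert_sumE m Q (p : cube R n -> X -> R) x : gen D m Q ->
  \sum_(Q' \in children D Q) \1_(cube_set Q') x * p Q' x =
  \1_(cube_set Q) x * p (lev (m - 1) x) x.
Proof.
move=> [DQ sQ]; rewrite [in RHS]indicE; have [/set_mem xQ|xQ] := boolP (x \in _).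
  have sub : cube_set (lev (m - 1) x) `<=` cube_set Q.
    rewrite -(lev_eq (setting_grid S) DQ sQ xQ).
    by apply: (lev_subself (setting_dim S)); rewrite gerBl.
  have s2 : 2 ^ m / 2 = 2 ^ (m - 1) :> R by rewrite (pow2_nat R m 1) expr1; field.
  rewrite -(fsbig_widen [set lev (m - 1) x])//; last 2 first.
  - by move=> _ ->; split=> //; rewrite ?lev_side ?sQ//; exact: lev_D.
  - move=> Q' [[DQ' sQ' _] /= Q'n]; rewrite indicE memNset ?mul0r// => xQ'.
    by apply: Q'n; apply/esym; apply: lev_eq; rewrite // sQ' sQ s2.
  by rewrite fsbig_set1 indicE mem_set ?mul1r//; exact: lev_mem.
rewrite mul0r fsbig1// => Q' [_ _ Q'Q]; rewrite indicE memNset ?mul0r// => xQ'.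
by move/negP: xQ; apply; apply/mem_set; exact: Q'Q.
Qed.

Lemma alpert_spaceP m Q h : gen D m Q -> alpert_space mu D kappa Q h <->
  (exists2 p : cube R n -> X -> R, (forall Q', polyfun kappa (p Q')) &
     h = fun x => \1_(cube_set Q) x * p (lev (m - 1) x) x) /\
  (forall b : mpoly.multinom n, (mpoly.mdeg b < kappa)%N ->
     (\int[mu]_(x in cube_set Q) (h x * monom b x)%:E = 0)%E).
Proof.
move=> GQ; split=> -[[p pp hE] hM]; split => //.
  exists (fun Q' => poly_eval (p Q')); first by move=> Q'; exact: poly_eval_polyfun.
  by rewrite hE; apply/funext => x; exact: (alpert_sumE (fun Q' => poly_eval (p Q')) x GQ).
pose q Q' := projT1 (cid2 (polyfun_poly_eval (pp Q'))).
have qk Q' : (mpoly.mmeasure (@mpoly.mdeg n) (q Q') <= kappa)%N.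
  by rewrite /q; case: (cid2 _).
have qE Q' : poly_eval (q Q') = p Q' by rewrite /q; case: (cid2 _).
exists q => //; rewrite hE; apply/funext => x.
by rewrite -(alpert_sumE p x GQ); apply: eq_fsbigr => Q' _; rewrite qE.
Qed.

Lemma alpert_L2 m Q h : gen D m Q -> alpert_space mu D kappa Q h -> L2 mu h.
Proof.
move=> GQ /(alpert_spaceP _ GQ)[[p pp ->] _]; have Q0 := gen_side GQ.
have mp : measurable_fun [set: X] (fun x : X => p (lev (m - 1) x) x).
  by apply: (measurable_lev (setting_grid S) (h := p)) => Q'; exact: (measurable_polyfun (pp Q')).
have b Q' := cid (polyfun_bounded Q' (pp Q')).
have /finite_seqP[s sE] := finite_children GQ.
pose M := \sum_(Q' <- s) `|projT1 (b Q')|.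
apply: (L2_bounded S (M := M) mp Q0) => x xQ.
have hx : children D Q (lev (m - 1) x).
  have [DQ sQ] := GQ; split; first exact: lev_D.
    by rewrite lev_side sQ (pow2_nat R m 1) expr1; field.
  rewrite -(lev_eq (setting_grid S) DQ sQ xQ).
  by apply: (lev_subself (setting_dim S)); rewrite gerBl.
have h1 := projT2 (b (lev (m - 1) x)) x (lev_mem _ _ _).
apply: le_trans h1 _; apply: le_trans (ler_norm _) _.
rewrite /M (big_rem (lev (m - 1) x))/=; last by rewrite sE in hx.
by rewrite lerDl; apply: sumr_ge0.
Qed.

Lemma alpert_ip0 m Q h g : gen D m Q -> alpert_space mu D kappa Q h ->
  polyfun kappa g -> ip mu (fun x => \1_(cube_set Q) x * g x) h = 0.
Proof.
move=> GQ Vh [c ->]; have hL := alpert_L2 GQ Vh; have Q0 := gen_side GQ.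
have [[p pp hE] hM] := (alpert_spaceP h GQ).1 Vh.
rewrite (_ : (fun x => _) = fun x : X =>
  \sum_b c b * (\1_(cube_set Q) x * monom b x)); last first.
  by apply/funext => x; rewrite big_distrr; apply: eq_bigr => b _; rewrite /= mulrCA.
rewrite ip_suml//; last first.
  by move=> b; exact: (L2_polyfun S (polyfun_monom R b) Q0).
rewrite big1// => b _; rewrite /ip.
under eq_integral do rewrite -mulrA [monom _ _ * _]mulrC.
rewrite -(integral_indicM mu (fun x => h x * monom b x))//.
by rewrite hM ?mulr0//; exact: mpoly.bmdeg.
Qed.

Lemma alpert_spaceB m Q h h' : gen D m Q -> alpert_space mu D kappa Q h ->
  alpert_space mu D kappa Q h' -> alpert_space mu D kappa Q (fun x => h x - h' x).
Proof.
move=> GQ Vh Vh'; have [hL h'L] := (alpert_L2 GQ Vh, alpert_L2 GQ Vh').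
have Q0 := gen_side GQ.
have [[p pp hE] hM] := (alpert_spaceP h GQ).1 Vh.
have [[p' pp' hE'] hM'] := (alpert_spaceP h' GQ).1 Vh'.
apply/(alpert_spaceP _ GQ); split.
  exists (fun Q' x => p Q' x - p' Q' x); first by move=> Q'; exact: polyfunB.
  by rewrite hE hE'; apply/funext => x; rewrite mulrBr.
move=> b bk; pose B := mpoly.BMultinom bk.
have mL : L2 mu (fun x => \1_(cube_set Q) x * monom b x).
  exact: (L2_polyfun S (polyfun_monom R B) Q0).
have e g : (\int[mu]_(x in cube_set Q) (g x * monom b x)%:E =
    \int[mu]_x (g x * (\1_(cube_set Q) x * monom b x))%:E)%E.
  by rewrite integral_indicM//; apply: eq_integral => x _; rewrite mulrCA.
have := hM b bk; have := hM' b bk; rewrite !e !ipE//; last exact: L2B.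
by rewrite ipBl// => -[->] [->]; rewrite subrr.
Qed.

(** The Alpert projection of [f] on [Q], in terms of the projections on [Q] and
    on its children. *)
Definition incr m Q f : X -> R :=
  fun x => \1_(cube_set Q) x * (gen_proj (m - 1) f x - gen_proj m f x).

Lemma L2_proj_sub_indic m Q f : L2 mu f ->
  L2 mu (fun x => \1_(cube_set Q) x * (f x - gen_proj m f x)).
Proof. by move=> fL; apply: L2_indic => //; exact: L2_sub_proj. Qed.

Lemma incr_L2 m Q f : L2 mu f -> L2 mu (incr m Q f).
Proof. by move=> fL; apply: L2_indic => //; apply: L2B; exact: L2_proj. Qed.

(** The indicator of [Q] is constant on the cubes of generation [m - 1], so this
    is an instance of [proj_orth]. *)
Lemma proj_orth_in m Q f (p : cube R n -> X -> R) : gen D m Q -> L2 mu f ->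
  (forall Q', polyfun kappa (p Q')) ->
  L2 mu (fun x => \1_(cube_set Q) x * p (lev (m - 1) x) x) ->
  ip mu (fun x => f x - gen_proj (m - 1) f x)
        (fun x => \1_(cube_set Q) x * p (lev (m - 1) x) x) = 0.
Proof.
move=> GQ fL pp; have [DQ sQ] := GQ.
pose q Q' x := if lev m Q'.1 == Q then p Q' x else 0.
have -> : (fun x : X => \1_(cube_set Q) x * p (lev (m - 1) x) x) =
    (fun x : X => q (lev (m - 1) x) x).
  apply/funext => x; rewrite /q indicE.
  have -> : lev m (lev (m - 1) x).1 = lev m x.
    apply: (lev_mono (setting_dim S) (m := m - 1)); first by rewrite gerBl.
    by apply: lev_meq; apply: corner_mem; exact: lev_side_gt0.
  have [xQ|xQ] := boolP (x \in cube_set Q).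
    by rewrite (lev_eq _ DQ sQ (set_mem xQ)) eqxx mul1r.
  rewrite mul0r ifF//; apply/negbTE; apply: contra xQ => /eqP <-.
  by apply/mem_set; exact: lev_mem.
move=> qL; apply: proj_orth => // Q'; rewrite /q.
by case: (lev m Q'.1 == Q); [exact: pp|exact: polyfun0].
Qed.

(** [f - incr m Q f] is, on [Q], the sum of [f - gen_proj (m - 1) f], which is
    orthogonal to the piecewise polynomials, and of a polynomial, to which the
    Alpert space is orthogonal by the vanishing of its moments. *)
Lemma incr_is_oproj m Q f : gen D m Q -> L2 mu f ->
  is_oproj mu (alpert_space mu D kappa Q) f (incr m Q f).
Proof.
move=> GQ fL; have Q0 := gen_side GQ; have [DQ sQ] := GQ.
have uL := incr_L2 m Q fL.
have levQ x : cube_set Q x -> lev m x = Q by exact: lev_eq.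
have VL h : alpert_space mu D kappa Q h -> L2 mu h by exact: alpert_L2 GQ.
have rE : (fun x : X => \1_(cube_set Q) x * (f x - gen_proj m f x)) = res Q f.
  apply/funext => x; rewrite /res /gen_proj indicE.
  have [/set_mem xQ|_] := boolP (x \in _); last by rewrite !mul0r.
  by rewrite levQ.
have aL := L2_proj_sub_indic (m - 1) Q fL; have bL := L2_proj_sub_indic m Q fL.
apply/is_oprojP => //; split.
  apply/(alpert_spaceP _ GQ); split.
    exists (fun Q' x => pol Q' f x - pol Q f x).
      by move=> Q'; apply: polyfunB; exact: pol_polyfun.
    apply/funext => x; rewrite /incr /gen_proj indicE.
    have [/set_mem xQ|_] := boolP (x \in _); last by rewrite !mul0r.
    by rewrite [lev m x]levQ.
  move=> b bk; pose B := mpoly.BMultinom bk.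
  have pB : polyfun kappa (monom b) := polyfun_monom R B.
  have mL : L2 mu (fun x => \1_(cube_set Q) x * monom b x) := L2_polyfun S pB Q0.
  transitivity (\int[mu]_x (incr m Q f x * (\1_(cube_set Q) x * monom b x))%:E)%E.
    by rewrite integral_indicM//; apply: eq_integral => x _; rewrite mulrCA.
  rewrite ipE//.
  have -> : incr m Q f = fun x => \1_(cube_set Q) x * (f x - gen_proj m f x) -
      \1_(cube_set Q) x * (f x - gen_proj (m - 1) f x).
    by apply/funext => x; rewrite /incr; ring.
  rewrite ipBl// rE res_orth// ip_indic.
  have := proj_orth_in (p := fun _ => monom b) GQ fL => ->//.
  by rewrite subrr.
move=> h Vh; have [[p pp hE] hM] := (alpert_spaceP h GQ).1 Vh.
have hL := VL _ Vh.
have hQ : h = fun x => \1_(cube_set Q) x * h x.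
  rewrite hE; apply/funext => x; rewrite indicE.
  by case: (x \in _); rewrite ?mul1r ?mul0r.
have pL : L2 mu (fun x => \1_(cube_set Q) x * pol Q f x).
  exact: (L2_polyfun S (pol_polyfun S kappa Q f) Q0).
rewrite [X in ip mu _ X]hQ -ip_indic -hQ.
have -> : (fun x => \1_(cube_set Q) x * (f x - incr m Q f x)) =
    fun x => \1_(cube_set Q) x * (f x - gen_proj (m - 1) f x) +
             \1_(cube_set Q) x * pol Q f x.
  apply/funext => x; rewrite /incr indicE.
  have [/set_mem xQ|_] := boolP (x \in _); last by rewrite !mul0r addr0.
  by rewrite !mul1r /gen_proj [lev m x]levQ//; ring.
rewrite ipDl// (alpert_ip0 GQ Vh (pol_polyfun S kappa Q f)) addr0.
rewrite [X in ip mu _ X]hQ ip_indic -hQ hE.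
by apply: proj_orth_in => //; rewrite -hE.
Qed.

Lemma alpert_projP m Q f : gen D m Q -> L2 mu f ->
  is_oproj mu (alpert_space mu D kappa Q) f (alpert_proj mu D kappa Q f).
Proof.
move=> GQ fL; rewrite /alpert_proj /oproj; case: xgetP => // no.
by exfalso; exact: no (incr_is_oproj GQ fL).
Qed.

(** The squared error of a cube exceeds that of its children by the energy of
    the Alpert projection. *)
Lemma err_children m Q f : gen D m Q -> L2 mu f ->
  (err Q f = \int[mu]_(x in cube_set Q) ((f x - gen_proj (m - 1) f x) ^+ 2)%:E +
     \int[mu]_x ((alpert_proj mu D kappa Q f x) ^+ 2)%:E)%E.
Proof.
move=> GQ fL; have Q0 := gen_side GQ; have [DQ sQ] := GQ.
have uL := incr_L2 m Q fL; have uP := incr_is_oproj GQ fL.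
have VL h : alpert_space mu D kappa Q h -> L2 mu h by exact: alpert_L2 GQ.
have aP := alpert_projP GQ fL.
have aL : L2 mu (alpert_proj mu D kappa Q f) by apply: VL; case: aP.
have VB h h' := @alpert_spaceB m Q h h' GQ.
have ipe h : L2 mu h -> ip mu h (alpert_proj mu D kappa Q f) = ip mu h (incr m Q f).
  by move=> hL; exact: (is_oproj_ip VL fL VB aP uP hL).
rewrite ipE2// ipe// ipC ipe//.
have bL := L2_proj_sub_indic (m - 1) Q fL.
rewrite (integral_sqr_indic (f := fun x => f x - gen_proj (m - 1) f x))// -EFinD.
rewrite -ip_pythagoras//; last first.
  have [/(alpert_spaceP _ GQ)[[p pp uE] _] _] := uP.
  rewrite /incr ip_indic -/(incr m Q f) uE.
  by apply: proj_orth_in => //; rewrite -uE.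
rewrite errE//; congr (ip mu _ _)%:E; apply/funext => x; rewrite /res /incr indicE.
- have [/set_mem xQ|_] := boolP (x \in _); last by rewrite !mul0r addr0.
  by rewrite !mul1r /gen_proj (lev_eq (m := m) _ DQ sQ xQ); ring.
- have [/set_mem xQ|_] := boolP (x \in _); last by rewrite !mul0r addr0.
  by rewrite !mul1r /gen_proj (lev_eq (m := m) _ DQ sQ xQ); ring.
Qed.

Definition gen_alpert m f : \bar R :=
  (\esum_(Q in gen D m) \int[mu]_x ((alpert_proj mu D kappa Q f x) ^+ 2)%:E)%E.

Lemma gen_alpert_ge0 m f : (0 <= gen_alpert m f)%E.
Proof.
by apply: esum_ge0 => Q _; apply: integral_ge0 => x _; rewrite lee_fin sqr_ge0.
Qed.

(** Pythagoras, summed over the cubes of a generation. *)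
Lemma gen_err_step m f : L2 mu f ->
  (gen_err m f = gen_err (m - 1) f + gen_alpert m f)%E.
Proof.
move=> fL; have mf := L2_measurable fL; rewrite (gen_errE m mf).
rewrite (eq_esum (b := fun Q => \int[mu]_(x in cube_set Q)
  ((f x - gen_proj (m - 1) f x) ^+ 2)%:E +
  \int[mu]_x ((alpert_proj mu D kappa Q f x) ^+ 2)%:E)%E); last first.
  by move=> Q GQ; exact: err_children.
rewrite esumD => [|Q _|Q _].
- congr (_ + _)%E.
  rewrite (integral_lev (setting_grid S) mu m
    (h := fun _ x => ((f x - gen_proj (m - 1) f x) ^+ 2)%:E))//.
  + move=> _; apply/measurable_EFinP; apply: measurable_funX.
    exact: (L2_measurable (L2_sub_proj _ fL)).
  + by move=> _ x; rewrite lee_fin sqr_ge0.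
- by apply: integral_ge0 => x _; rewrite lee_fin sqr_ge0.
- by apply: integral_ge0 => x _; rewrite lee_fin sqr_ge0.
Qed.

End Generations.

(** * Density of piecewise polynomials *)

Lemma eq_indic (R : pzRingType) (T U : Type) (A : set T) (B : set U) x y :
  (A x <-> B y) -> \1_A x = \1_B y :> R.
Proof.
move=> AB; rewrite !indicE; congr ((nat_of_bool _)%:R).
by apply/idP/idP => /set_mem /AB h; apply/mem_set.
Qed.

Section Density.
Context (R : realType) (n : nat).
Variables (mu : {measure set (borelRn R n) -> \bar R}) (C : R).
Variable (D : set (cube R n)).
Hypothesis S : doubling_setting mu C D.
Variable kappa : nat.
Hypothesis k0 : (0 < kappa)%N.
Local Notation X := (borelRn R n).
Local Notation lev := (lev (setting_grid S)).
Local Notation pol := (pol S kappa).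
Local Notation gen_proj := (gen_proj S kappa).
Local Notation gen_err := (gen_err S kappa).
Implicit Types (x y z : 'rV[R]_n) (m : int) (Q P : cube R n) (f g h : X -> R).

Lemma gen_err_mono m m' f : L2 mu f -> m <= m' -> (gen_err m f <= gen_err m' f)%E.
Proof.
move=> fL mm; have [k ->] : exists k : nat, m' = m + k%:Z.
  by exists `|m' - m|%N; lia.
elim: k => [|k IH]; first by rewrite addr0.
apply: (le_trans IH); rewrite (gen_err_step S kappa (m + k.+1%:Z) fL).
have -> : m + k.+1%:Z - 1 = m + k%:Z by lia.
by rewrite leeDl// gen_alpert_ge0.
Qed.

Definition approximable f := L2 mu f /\
  forall e : R, 0 < e -> exists m, (gen_err m f <= e%:E)%E.

Let pol_polyfun Q g : polyfun kappa (pol Q g). Proof. exact: pol_polyfun. Qed.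

Let gen_err_double m f g : L2 mu f -> L2 mu g ->
  (gen_err m f <= 2%:E * gen_err m g + 2%:E * gen_err m (f \- g)%R)%E.
Proof.
by move=> fL gL; have := gen_err_young S kappa m ltr01 fL gL; rewrite invr1 (_ : 1 + 1 = 2).
Qed.

Let double_small (a b : \bar R) (e : R) : (a <= (e / 4)%:E)%E -> (b <= (e / 4)%:E)%E ->
  (2%:E * a + 2%:E * b <= e%:E)%E.
Proof.
move=> ha hb; have -> : e%:E = (2%:E * (e / 4)%:E + 2%:E * (e / 4)%:E)%E.
  by rewrite -!EFinM -EFinD; congr EFin; field.
by apply: leeD; apply: lee_wpmul2l => //; rewrite lee_fin.
Qed.

Lemma approximable_lim f : L2 mu f ->
  (forall e : R, 0 < e -> exists2 g, approximable g &
    (\int[mu]_x ((f x - g x) ^+ 2)%:E <= e%:E)%E) -> approximable f.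
Proof.
move=> fL fg; split => // e e0; have e4 : 0 < e / 4 by rewrite divr_gt0.
have [g [gL ga] gf] := fg _ e4; have [m gm] := ga _ e4; exists m.
apply: le_trans (gen_err_double m fL gL) _; apply: double_small; first exact: gm.
exact: le_trans (gen_err_le_sqr S kappa m (L2B fL gL)) gf.
Qed.

Lemma approximableD f g : approximable f -> approximable g ->
  approximable (fun x => f x + g x).
Proof.
move=> [fL fa] [gL ga]; split; first exact: L2D.
move=> e e0; have e4 : 0 < e / 4 by rewrite divr_gt0.
have [m1 h1] := fa _ e4; have [m2 h2] := ga _ e4.
pose m := Num.min m1 m2; exists m.
have {}h1 : (gen_err m f <= (e / 4)%:E)%E.
  by apply: le_trans h1; apply: gen_err_mono => //; rewrite /m ge_min lexx.
have {}h2 : (gen_err m g <= (e / 4)%:E)%E.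
  by apply: le_trans h2; apply: gen_err_mono => //; rewrite /m ge_min lexx orbT.
have := gen_err_double m (L2D fL gL) gL.
have -> : (fun x => f x + g x) \- g = f by apply/funext => x; rewrite /= addrK.
by move=> /le_trans; apply; exact: double_small.
Qed.

Lemma approximableZ (k : R) f : approximable f -> approximable (fun x => k * f x).
Proof.
move=> [fL fa]; split; first exact: L2Z.
move=> e e0; have d0 : 0 < k ^+ 2 + 1 by rewrite ltr_wpDl// sqr_ge0.
have [m hm] := fa (e / (k ^+ 2 + 1)) (divr_gt0 e0 d0); exists m.
have kL := L2Z k fL.
apply: le_trans (gen_err_le S m kL (p := fun Q x => k * pol Q f x) _) _.
  by move=> Q; exact: polyfunZ.
have -> : (fun x : X => ((k * f x - k * pol (lev m x) f x) ^+ 2)%:E) =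
    (fun x : X => ((k ^+ 2)%:E * ((f x - gen_proj m f x) ^+ 2)%:E)%E).
  by apply/funext => x; rewrite /gen_proj -EFinM -mulrBr exprMn.
rewrite ge0_integralZl//.
- apply: (@le_trans _ _ ((k ^+ 2)%:E * (e / (k ^+ 2 + 1))%:E)%E).
    by apply: lee_wpmul2l; rewrite ?lee_fin ?sqr_ge0.
  rewrite -EFinM lee_fin mulrA ler_pdivrMr// mulrC ler_wpM2l ?(ltW e0)//.
  by rewrite lerDl.
- by apply/measurable_EFinP; apply: measurable_funX; apply: L2_measurable; exact: L2_sub_proj.
- by move=> x _; rewrite lee_fin sqr_ge0.
- by rewrite lee_fin sqr_ge0.
Qed.

Lemma approximableB f g : approximable f -> approximable g ->
  approximable (fun x => f x - g x).
Proof.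
move=> fa /(approximableZ (-1)) ga; have := approximableD fa ga.
by under eq_fun do rewrite mulN1r.
Qed.

Lemma approximable0 : approximable (fun=> 0).
Proof.
split; first exact: L2_0.
move=> e e0; exists 0; apply: le_trans (gen_err_le_sqr S kappa 0 (L2_0 mu)) _.
rewrite (eq_integral (cst 0%E)) ?integral0 ?lee_fin ?(ltW e0)// => x _.
by rewrite expr0n.
Qed.

Lemma approximable_sum (I : Type) (r : seq I) (f : I -> X -> R) :
  (forall i, approximable (f i)) -> approximable (fun x => \sum_(i <- r) f i x).
Proof.
move=> fa; elim: r => [|i r IH].
  by under eq_fun do rewrite big_nil; exact: approximable0.
by under eq_fun do rewrite big_cons; exact: approximableD (fa i) IH.
Qed.

Lemma approximable_step m (c : cube R n -> R) :
  L2 mu (fun x => c (lev m x)) -> approximable (fun x => c (lev m x)).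
Proof.
move=> cL; split => // e e0; exists m.
apply: le_trans (gen_err_le S m cL (p := fun Q _ => c Q) _) _.
  by move=> Q; exact: polyfun_cst.
rewrite (eq_integral (cst 0%E)) ?integral0 ?lee_fin ?(ltW e0)// => x _.
by rewrite subrr expr0n.
Qed.

Let indicE01 (A : set X) x : (\1_A x : R) ^+ 2 = \1_A x.
Proof. by rewrite indicE; case: (_ \in _); rewrite ?expr1n ?expr0n. Qed.

Lemma L2_indicator (A : set X) : measurable A -> (mu A < +oo)%E -> L2 mu (\1_A).
Proof.
move=> mA muA; split; first exact: measurable_indic.
by under eq_integral do rewrite indicE01; rewrite integral_indic// setIT.
Qed.

(** Sets of finite mass whose indicators, being constant on the unit cubes of
    the grid, are approximable. *)
Definition exhaust (N : nat) : set X :=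
  [set x | exists2 y, cube_set (lev 0 x) y & forall i, `|y 0 i| <= N%:R].

Lemma measurable_exhaust N : measurable (exhaust N).
Proof.
exact: (measurable_lev_set (setting_grid S)
  [set Q | exists2 y, cube_set Q y & forall i, `|y 0 i| <= N%:R]).
Qed.

Lemma exhaust_lty N : (mu (exhaust N) < +oo)%E.
Proof.
have Q0 : 0 < side (lev 0 0) by exact: lev_side_gt0.
apply: (@le_lt_trans _ _ ((C ^+ (2 * (N + 2)).+1)%:E * mu (cube_set (lev 0 0)))%E);
    last first.
  by rewrite (massE S Q0) -EFinM ltry.
apply: (mu_near (setting_C S) (setting_doubling S)) => //.
  exact: measurable_exhaust.
move=> x [y xy yN] i; rewrite lev_side expr0z mulr1 natrD.
have := lev_dist xy; rewrite expr0z => /supdist_ltP; rewrite ltr01 => /(_ isT i).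
have := yN i; have := lev_corner_dist S 0 0 i; rewrite expr0z mxE.
rewrite !ler_norml ltr_norml => /andP[? ?] /andP[? ?] /andP[? ?].
by apply/andP; split; lra.
Qed.

Lemma exhaust_nd N M : (N <= M)%N -> exhaust N `<=` exhaust M.
Proof.
move=> NM x [y xy yN]; exists y => // i; apply: le_trans (yN i) _.
by rewrite ler_nat.
Qed.

Lemma exhaust_mem x : exists N, exhaust N x.
Proof.
pose s := \sum_(i < n) `|x 0 i|; exists (Num.bound s); exists x.
  exact: lev_mem.
move=> i; apply: (@le_trans _ _ s).
  by rewrite /s (bigD1 i)//= lerDl; apply: sumr_ge0.
by apply/ltW/archi_boundP; apply: sumr_ge0.
Qed.

Lemma approximable_exhaust N : approximable (\1_(exhaust N)).
Proof.
have -> : (\1_(exhaust N) : X -> R) = (fun x => (fun Q => \1_[set Q |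
    exists2 y, cube_set Q y & forall i, `|y 0 i| <= N%:R] Q) (lev 0 x)).
  by apply/funext => x; apply: eq_indic.
apply: approximable_step.
have := L2_indicator (measurable_exhaust N) (exhaust_lty N).
by congr L2; apply/funext => x; apply: eq_indic.
Qed.

Let cut N (A : set X) : X -> R := \1_(A `&` exhaust N).

Lemma cut_L2 N A : measurable A -> L2 mu (cut N A).
Proof.
move=> mA; have mK := measurable_exhaust N.
apply: L2_indicator; first exact: measurableI.
by apply: le_lt_trans (exhaust_lty N); apply: le_measure; rewrite ?inE//; exact: measurableI.
Qed.

(** Inside a set of finite mass, an increasing union is approximated in measure
    by its members. *)
Lemma approximable_bigcup N (A : (set X)^nat) : (forall k, measurable (A k)) ->
  nondecreasing_seq A -> (forall k, approximable (cut N (A k))) ->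
  approximable (cut N (\bigcup_k A k)).
Proof.
move=> mA ndA aA; have mK := measurable_exhaust N.
pose F k := A k `&` exhaust N.
have mF k : measurable (F k) by exact: measurableI.
have FE : \bigcup_k F k = (\bigcup_k A k) `&` exhaust N by rewrite setI_bigcupl.
have mU : measurable (\bigcup_k F k) by exact: bigcupT_measurable.
have muU : (mu (\bigcup_k F k) < +oo)%E.
  apply: le_lt_trans (exhaust_lty N); apply: le_measure; rewrite ?inE//.
  by rewrite FE => x [].
apply: approximable_lim; first by apply: cut_L2; exact: bigcupT_measurable.
move=> e e0.
have ndF : nondecreasing_seq F.
  by move=> i j ij; apply/subsetPset; apply: setSI; apply/subsetPset; exact: ndA.
have cv : (fun k => mu (F k)) @ \oo --> mu (\bigcup_k F k).
  exact: nondecreasing_cvg_mu.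
have [k hk] : exists k, (mu (\bigcup_k F k) <= mu (F k) + e%:E)%E.
  have finU : mu (\bigcup_k F k) \is a fin_num by rewrite ge0_fin_numE.
  rewrite -(fineK finU); move: cv; rewrite -[in X in X -> _](fineK finU).
  move=> /fine_cvgP[_ /cvgrPdist_le /(_ _ e0)[k _ hk]].
  exists k; have muFk : mu (F k) \is a fin_num.
    rewrite ge0_fin_numE//; apply: le_lt_trans (exhaust_lty N).
    by apply: le_measure; rewrite ?inE// => x [].
  rewrite -(fineK muFk) -EFinD lee_fin -lerBlDl.
  by apply: le_trans (hk k (leqnn k)); exact: ler_norm.
exists (cut N (A k)) => //.
have muFk : (mu (F k) < +oo)%E.
  by apply: le_lt_trans (exhaust_lty N); apply: le_measure; rewrite ?inE// => x [].
have sub : F k `<=` \bigcup_k F k by exact: bigcup_sup.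
have -> : (fun x : X => ((cut N (\bigcup_k A k) x - cut N (A k) x) ^+ 2)%:E) =
    (fun x : X => (\1_(\bigcup_k F k `\` F k) x)%:E).
  apply/funext => x; rewrite /cut -FE !indicE in_setD.
  have [h1|h1] := boolP (x \in F k).
    by rewrite (mem_set (sub _ (set_mem h1))) subrr expr0n.
  by rewrite subr0 andbT; case: (_ \in _); rewrite ?expr1n ?expr0n.
rewrite integral_indic//; last exact: measurableD.
rewrite setIT; have : (mu (\bigcup_k F k `\` F k) = mu (\bigcup_k F k) - mu (F k))%E.
  rewrite measureD//; congr (_ - mu _)%E; exact: setIidr.
move=> ->; rewrite leeBlDl//; first by rewrite ge0_fin_numE.
Qed.

(** An open set is the increasing union over [k] of the cubes of side [2 ^ - k]
    that it contains. *)
Lemma approximable_open N (A : set X) : open (A : set 'rV[R]_n) ->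
  approximable (cut N A).
Proof.
move=> oA; pose F (k : nat) : set X := [set x | cube_set (lev (- k%:Z) x) `<=` A].
have FA : \bigcup_k F k = A.
  apply/seteqP; split => x; first by move=> [k _]; apply; exact: lev_mem.
  move=> Ax; have /nbhs_ballP[e /= e0 eA] : nbhs (x : 'rV[R]_n) A by exact: open_nbhs_nbhs.
  pose k := Num.bound e^-1; exists k => // y xy; apply: eA; split=> // i j.
  rewrite ord1 /ball/=; apply: le_lt_trans (coord_le_supdist _ _ _) _.
  apply: lt_trans (lev_dist xy) _.
  have : e^-1 < 2 ^+ k.
    apply: lt_trans (archi_boundP _) _; first by rewrite invr_ge0 ltW.
    by rewrite -natrX ltr_nat ltn_expl.
  move=> h; have := pow2_nat R 0 k; rewrite expr0z sub0r => e1.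
  have K0 : 0 < 2 ^+ k :> R by rewrite exprn_gt0.
  rewrite -(ltr_pM2l K0); apply: (@le_lt_trans _ _ 1); first by rewrite [leRHS]e1.
  by rewrite -ltr_pdivrMr// div1r.
have mF k : measurable (F k).
  exact: (measurable_lev_set (setting_grid S) [set Q | cube_set Q `<=` A]).
have ndF : nondecreasing_seq F.
  move=> i j ij; apply/subsetPset => x xi; apply: subset_trans xi.
  by apply: (lev_subself (setting_dim S)); rewrite lerN2.
rewrite -FA; apply: approximable_bigcup => // k.
pose c Q : R := \1_[set Q | cube_set Q `<=` A] Q *
  \1_[set Q | exhaust N Q.1] Q.
have cE : cut N (F k) = (fun x => c (lev (- k%:Z) x)).
  apply/funext => x; rewrite /cut indicI /c -[LHS]/(\1_(F k) x * \1_(exhaust N) x).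
  congr (_ * _).
  have lx : lev 0 (lev (- k%:Z) x).1 = lev 0 x.
    apply: (lev_mono (setting_dim S) (m := - k%:Z)); first by rewrite oppr_le0.
    by apply: lev_meq; apply: corner_mem; exact: lev_side_gt0.
  by apply: eq_indic; rewrite /exhaust/= lx.
by rewrite cE; apply: approximable_step; rewrite -cE; exact: cut_L2.
Qed.

(** Open sets are stable under intersection, and the sets [A] considered here
    form a Dynkin system. *)
Lemma approximable_indicator N (A : set X) : measurable A -> approximable (cut N A).
Proof.
suff : @measurable _ X `<=` [set A | measurable A /\ approximable (cut N A)].
  by move=> h mA; have [] := h _ mA.
apply: (@lambda_system_subset _ (@open 'rV[R]_n)).
- exact: openI.
- split.
  + by move=> B _; exact: subsetT.
  + split; first exact: measurableT.
    by rewrite /cut setTI; exact: approximable_exhaust.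
  + move=> {}A B BA [mA aA] [mB aB]; split; first exact: measurableD.
    have := approximableB aA aB; congr approximable; apply/funext => x.
    rewrite /cut !indicE (in_setI x (A `\` B)) in_setD !in_setI.
    have [/set_mem/BA/mem_set ->|_] := boolP (x \in B).
      by rewrite /= subrr.
    by rewrite andbT subr0.
  + move=> F ndF hF; split; first by apply: bigcupT_measurable => k; case: (hF k).
    by apply: approximable_bigcup => // k; case: (hF k).
- by move=> {}A oA; split; [exact: sub_sigma_algebra|exact: approximable_open].
- by [].
Qed.

Import HBNNSimple.

Lemma approximable_nnsfun N (g : {nnsfun X >-> R}) :
  approximable (fun x => \1_(exhaust N) x * g x).
Proof.
have /finite_seqP[r rE] : finite_set (range g) by exact: fimfunP.
have -> : (fun x : X => \1_(exhaust N) x * g x) =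
    (fun x => \sum_(y <- undup r) y * cut N (g @^-1` [set y]) x).
  have rE' : range g = [set` undup r].
    by rewrite rE; apply/seteqP; split => y /=; rewrite mem_undup.
  apply/funext => x.
  have -> : g x = \sum_(y <- undup r) y * \1_(g @^-1` [set y]) x.
    rewrite [LHS]fimfunE (_ : range _ = [set` undup r])//.
    by rewrite -fsbig_seq ?undup_uniq.
  rewrite mulr_sumr; apply: eq_bigr => y _.
  by rewrite /cut indicI/= mulrCA [\1_(exhaust N) x * _]mulrC.
apply: approximable_sum => y; apply: approximableZ.
exact: approximable_indicator.
Qed.

Lemma approximable_ge0 f : L2 mu f -> (forall x, 0 <= f x) -> approximable f.
Proof.
move=> fL f0; have mf := L2_measurable fL.
have mEf : measurable_fun [set: X] (EFin \o f) by exact/measurable_EFinP.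
pose g := nnsfun_approx measurableT mEf.
have Ef0 x : [set: X] x -> (0 <= (EFin \o f) x)%E by rewrite lee_fin.
pose h k x := \1_(exhaust k) x * g k x.
have g0 k x : 0 <= g k x by exact: fun_ge0.
have gf k x : g k x <= f x.
  by rewrite -lee_fin /g nnsfun_approxE; apply: (@le_approx _ X R setT (EFin \o f)).
have hf k x : 0 <= f x - h k x <= f x.
  rewrite /h indicE; case: (_ \in _); rewrite ?mul1r ?mul0r ?subr0 ?lexx ?f0//.
  by rewrite subr_ge0 gf lerBlDr lerDl g0.
have mh k : measurable_fun [set: X] (h k).
  by apply: measurable_funM => //; apply: measurable_indic; exact: measurable_exhaust.
have cvg0 x : (fun k => ((f x - h k x) ^+ 2)%:E) @ \oo --> 0%E.
  have [N xN] := exhaust_mem x.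
  apply: (@cvg_trans _ ((fun k => ((f x - g k x) ^+ 2)%:E) @ \oo)).
    apply: near_eq_cvg; exists N => // k /= Nk.
    by rewrite /h indicE mem_set ?mul1r//; exact: (exhaust_nd Nk).
  apply/fine_cvgP; split; first exact: nearW.
  have /fine_cvgP[_ hx] := @cvg_nnsfun_approx _ _ _ _ measurableT _ mEf Ef0 x I.
  have : (fun k => (f x - g k x) ^+ 2) @ \oo --> (f x - f x) ^+ 2.
    by apply: cvgM; apply: cvgB => //; exact: cvg_cst.
  by rewrite subrr expr0n.
have if2 : mu.-integrable setT (fun x => ((f x) ^+ 2)%:E).
  by have := L2_int fL fL; under eq_fun do rewrite -expr2.
have hL k : L2 mu (h k).
  apply: (L2_le (mh k) fL) => x; rewrite !ger0_norm//.
  - by have /andP[+ _] := hf k x; rewrite subr_ge0.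
  - by rewrite /h mulr_ge0// indicE ler0n.
have mfh k : measurable_fun [set: X] (fun x => ((f x - h k x) ^+ 2)%:E).
  by apply/measurable_EFinP; apply: measurable_funX; exact: measurable_funB.
have := @dominated_cvg _ _ _ mu setT measurableT
  (fun k x => ((f x - h k x) ^+ 2)%:E) (cst 0%E) (fun x => ((f x) ^+ 2)%:E)
  mfh
  (fun x _ => cvg0 x) (fun=> fun=> isT) if2.
have dom k (x : X) : [set: X] x -> (`|((f x - h k x) ^+ 2)%:E| <= ((f x) ^+ 2)%:E)%E.
  move=> _; rewrite gee0_abs ?lee_fin ?sqr_ge0//.
  by have /andP[? ?] := hf k x; rewrite lerXn2r ?nnegrE.
move=> /(_ dom); rewrite integral0 => cv.
apply: approximable_lim => // e e0.
have [[N1 _ fin] /cvgrPdist_le /(_ _ e0)[N2 _ hN]] := (fine_cvgP _ _).1 cv.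
pose k := maxn N1 N2; exists (h k); first exact: approximable_nnsfun.
have := hN k (leq_maxr _ _); have := fin k (leq_maxl _ _) => /= fk.
by rewrite sub0r normrN ger0_norm ?fine_ge0 ?integral_ge0// => [|x _];
  rewrite -?lee_fin ?fineK// lee_fin sqr_ge0.
Qed.

(** Piecewise polynomials of small generations approximate every
    square-integrable function: by linearity and monotone limits this is about
    indicators, by a Dynkin system argument about open sets, and an open set is
    the increasing union of the dyadic cubes it contains. *)
Lemma approximable_L2 f : L2 mu f -> approximable f.
Proof.
move=> fL; have mf := L2_measurable fL.
have pL (g : X -> R) : L2 mu g -> L2 mu (fun x => Num.max (g x) 0).
  move=> gL; apply: (L2_le _ gL); first by apply: measurable_maxr => //; exact: L2_measurable gL.
  by move=> x; rewrite /Num.max; case: ltP => // _; rewrite normr0.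
have g0 (g : X -> R) x : 0 <= Num.max (g x) 0 by rewrite le_max lexx orbT.
have h1 := approximable_ge0 (pL _ fL) (g0 f).
have h2 := approximable_ge0 (pL _ (L2N fL)) (g0 (fun x => - f x)).
have := approximableB h1 h2; congr approximable; apply/funext => x /=.
by rewrite /Num.max; case: ltP => ?; case: ltP => ?; lra.
Qed.

End Density.

(** * The two dyadic norms *)

Section Geometric.
Context (R : realType).
Local Open Scope ereal_scope.

Lemma esum_shift (F : int -> \bar R) (k : int) :
  \esum_(m in [set: int]) F (m + k)%R = \esum_(m in [set: int]) F m.
Proof.
rewrite [RHS](reindex_esum [set: int] _ (fun m => m + k)%R)//.
split => // [m m' _ _ /addIr//|m _].
by exists (m - k)%R; rewrite // subrK.
Qed.

Lemma esum_geometric (q : R) : (0 <= q < 1)%R ->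
  \esum_(k in [set: nat]) (q ^+ k)%:E <= ((1 - q)^-1)%:E.
Proof.
move=> /andP[q0 q1]; have q1' : (0 < 1 - q)%R by rewrite subr_gt0.
rewrite -nneseries_esumT; last by move=> k; rewrite lee_fin exprn_ge0.
apply: lime_le; first by apply: is_cvg_nneseries => k _ _; rewrite lee_fin exprn_ge0.
apply: nearW => N; rewrite sumEFin lee_fin big_mkord.
rewrite -[leRHS]mul1r ler_pdivlMr// mulrC -[(1 - q)%R]opprB mulNr -subrX1 opprB.
by rewrite gerBl exprn_ge0.
Qed.

(** Young's convolution inequality on the integers, for a geometric kernel. *)
Lemma esum_convolution (q : R) (sh : nat -> int) (F : int -> \bar R) :
  (0 <= q < 1)%R -> (forall m, 0 <= F m) ->
  \esum_(m in [set: int]) \esum_(k in [set: nat]) ((q ^+ k)%:E * F (m + sh k)%R)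
  <= ((1 - q)^-1)%:E * \esum_(m in [set: int]) F m.
Proof.
move=> q01 F0; have [q0 q1] := andP q01.
have qk k : (0 <= q ^+ k)%R by rewrite exprn_ge0.
rewrite exchange_esum; last by move=> i j; rewrite mule_ge0// lee_fin.
under eq_esum do rewrite esumZl// esum_shift.
have c0 : 0 <= \esum_(m in [set: int]) F m by exact: esum_ge0.
move: (\esum_(m in _) F m) c0 => [c| |]// c0; last first.
  by rewrite gt0_muley ?leey// lte_fin invr_gt0 subr_gt0.
under eq_esum do rewrite muleC.
rewrite esumZl// muleC; apply: lee_wpmul2r => //; exact: esum_geometric.
Qed.

End Geometric.

Section DyadicNorms.
Context (R : realType) (n : nat).
Variables (mu : {measure set (borelRn R n) -> \bar R}) (C : R).
Variable (D : set (cube R n)).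
Hypothesis S : doubling_setting mu C D.
Variable kappa : nat.
Hypothesis k0 : (0 < kappa)%N.
Variable s : R.
Local Notation X := (borelRn R n).
Local Notation gen_err := (gen_err S kappa).
Local Notation gen_alpert := (gen_alpert mu D kappa).
Implicit Types (m : int) (Q P : cube R n) (f g h : X -> R).

Definition weight m : R := (2 ^ m) `^ (- (2 * s)).

Lemma weight_ge0 m : 0 <= weight m. Proof. exact: powR_ge0. Qed.

(** The factor by which the weights decrease from one generation to the next. *)
Definition ratio : R := 2 `^ (2 * s).

Lemma ratio_gt0 : 0 < ratio. Proof. exact: powR_gt0. Qed.

Lemma ratio_gt1 : 0 < s -> 1 < ratio.
Proof.
move=> s0; have -> : 1 = 1 `^ (2 * s) :> R by rewrite powR1.
by apply: gt0_ltr_powR; rewrite ?mulr_gt0 ?nnegrE ?ltr1n.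
Qed.

Lemma weight_shift m (k : nat) : weight m = ratio ^- k * weight (m - k%:Z).
Proof.
rewrite /weight (pow2_nat R m k) powRM ?exprn_ge0// ?(ltW (pow2_gt0 _ _))//.
congr (_ * _); rewrite /ratio -!powR_mulrn ?powR_ge0// -!powRrM -powRN.
by congr (_ `^ _); ring.
Qed.

Definition dyadic_energy f : \bar R :=
  (\esum_(m in [set: int]) ((weight m)%:E * gen_alpert m f))%E.

Definition diff_energy f : \bar R :=
  (\esum_(m in [set: int]) ((weight m)%:E * gen_err m f))%E.

Lemma norm_dyadicE f : norm_dyadic mu D kappa s f = sqrte (dyadic_energy f).
Proof.
have e0 Q : (0 <= \int[mu]_x ((alpert_proj mu D kappa Q f x) ^+ 2)%:E)%E.
  by apply: integral_ge0 => x _; rewrite lee_fin sqr_ge0.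
rewrite /norm_dyadic (esum_grid (setting_grid S)); last first.
  by move=> Q; rewrite mule_ge0// lee_fin powR_ge0.
congr sqrte; apply: eq_esum => m _.
rewrite -(esumZl _ (weight_ge0 m) e0).
by apply: eq_esum => Q [_ sQ]; rewrite sQ.
Qed.

Lemma norm_diffE f : L2 mu f -> norm_diff mu D kappa s f = sqrte (diff_energy f).
Proof.
move=> fL; have mf := L2_measurable fL.
rewrite /norm_diff (esum_grid (setting_grid S)); last first.
  by move=> Q; apply: integral_ge0 => x _; rewrite lee_fin sqr_ge0.
congr sqrte; apply: eq_esum => m _.
rewrite (gen_errE S kappa m mf) -(esumZl _ (weight_ge0 m) (fun Q => err_ge0 S kappa Q f)).
apply: eq_esum => Q [DQ sQ]; have Q0 : 0 < side Q by rewrite sQ pow2_gt0.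
rewrite /err -ge0_integralZl//.
- apply: eq_integral => x /set_mem xQ; rewrite (poly_projE S kappa Q0 fL).
  rewrite indicE mem_set// mul1r real_normK ?num_real// exprMn -EFinM mulrC.
  congr (_ * _)%:E; rewrite /weight sQ.
  rewrite -powR_inv1 ?powR_ge0// -powR_mulrn ?powR_ge0// -!powRrM.
  by congr (_ `^ _); ring.
- exact: measurable_cube.
- apply/measurable_EFinP; apply: measurable_funTS; apply: measurable_funX.
  by apply: measurable_funB => //; exact: measurable_pol.
- by move=> x _; rewrite lee_fin sqr_ge0.
- by rewrite lee_fin weight_ge0.
Qed.

Lemma dyadic_energy_le f : L2 mu f -> (dyadic_energy f <= diff_energy f)%E.
Proof.
move=> fL; apply: le_esum => m _; apply: lee_wpmul2l.
  by rewrite lee_fin weight_ge0.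
by rewrite (gen_err_step S kappa m fL) leeDr// gen_err_ge0.
Qed.

(** The error is the sum of the energies of all finer generations; this is
    where density is needed. *)
Lemma gen_err_le_alpert m f : L2 mu f ->
  (gen_err m f <= \esum_(k in [set: nat]) gen_alpert (m - k%:Z) f)%E.
Proof.
move=> fL; apply/lee_addgt0Pr => e e0.
have [_ /(_ _ e0)[m0 hm0]] := approximable_L2 S k0 fL.
pose N := `|m - m0|%N.
have sumN (K : nat) : gen_err m f = (gen_err (m - K%:Z) f +
    \sum_(0 <= k < K) gen_alpert (m - k%:Z) f)%E.
  elim: K => [|K IH]; first by rewrite subr0 big_geq// adde0.
  rewrite IH (gen_err_step S kappa (m - K%:Z) fL) big_nat_recr//= -addeA.
  have -> : m - K%:Z - 1 = m - K.+1%:Z by lia.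
  by congr (_ + _)%E; rewrite addeC.
rewrite (sumN N) addeC; apply: leeD.
  have a0 (k : nat) : (0 <= gen_alpert (m - k%:Z) f)%E.
    exact: (gen_alpert_ge0 mu D kappa).
  by rewrite -nneseries_esumT//; exact: nneseries_lim_ge.
apply: le_trans hm0; apply: (gen_err_mono S) => //.
by rewrite /N; lia.
Qed.

(** The energy of a generation is counted in the errors of all coarser ones,
    whose weights decrease geometrically because [s] is positive. *)
Lemma diff_energy_le f : 0 < s -> L2 mu f ->
  (diff_energy f <= ((1 - ratio^-1)^-1)%:E * dyadic_energy f)%E.
Proof.
move=> s0 fL.
have r1 := ratio_gt1 s0.
apply: le_trans (esum_convolution (q := ratio^-1) (fun k => - k%:Z)
  (F := fun m => ((weight m)%:E * gen_alpert m f)%E) _ _).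
- apply: le_esum => m _.
  apply: (@le_trans _ _ ((weight m)%:E * \esum_(k in [set: nat]) gen_alpert (m - k%:Z) f)%E).
    by apply: lee_wpmul2l; [rewrite lee_fin weight_ge0|exact: gen_err_le_alpert].
  rewrite -esumZl ?weight_ge0//; last by move=> k; exact: gen_alpert_ge0.
  by apply: le_esum => k _; rewrite (weight_shift m k) exprVn EFinM muleA.
- by rewrite invr_ge0 (ltW ratio_gt0) invf_lt1// ratio_gt0.
- by move=> m; rewrite mule_ge0 ?lee_fin ?weight_ge0 ?gen_alpert_ge0.
Qed.

End DyadicNorms.

(** * The difference norm is controlled by the Sobolev norm *)

Section IteratedIntegral.
Context d (T : measurableType d) (R : realType) (mu : {measure set T -> \bar R}).
Hypothesis sf : sigma_finite setT mu.
Local Open Scope ereal_scope.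

(** [mu] itself, carrying the structure of a sigma-finite measure. *)
Definition sfm of sigma_finite setT mu : set T -> \bar R := mu.
HB.instance Definition _ := Measure.copy (sfm sf) mu.
HB.instance Definition _ := Measure_isSigmaFinite.Build _ _ _ (sfm sf) sf.

Implicit Type F : T -> T -> \bar R.

Lemma measurable_inner F :
  measurable_fun setT (fun p : T * T => F p.1 p.2) -> (forall x y, 0 <= F x y) ->
  measurable_fun setT (fun x => \int[mu]_y F x y).
Proof.
move=> mF F0; exact: (@measurable_fun_fubini_tonelli_F _ _ T T R (sfm sf)
  (fun p => F p.1 p.2) mF (fun p => F0 p.1 p.2)).
Qed.

Lemma swap_integrals F :
  measurable_fun setT (fun p : T * T => F p.1 p.2) -> (forall x y, 0 <= F x y) ->
  \int[mu]_x \int[mu]_y F x y = \int[mu]_y \int[mu]_x F x y.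
Proof.
move=> mF F0; exact: (@fubini_tonelli _ _ T T R (sfm sf) (sfm sf)
  (fun p => F p.1 p.2) mF (fun p => F0 p.1 p.2)).
Qed.

Lemma measurable_section F x :
  measurable_fun setT (fun p : T * T => F p.1 p.2) -> measurable_fun setT (F x).
Proof. by move=> mF; exact: (measurable_fun_pair2 x mF). Qed.

Lemma le_iterated F G :
  measurable_fun setT (fun p : T * T => F p.1 p.2) ->
  measurable_fun setT (fun p : T * T => G p.1 p.2) ->
  (forall x y, 0 <= F x y) -> (forall x y, F x y <= G x y) ->
  \int[mu]_x \int[mu]_y F x y <= \int[mu]_x \int[mu]_y G x y.
Proof.
move=> mF mG F0 FG.
have G0 x y : 0 <= G x y by exact: le_trans (FG x y).
apply: ge0_le_integral => //.
- by move=> x _; exact: integral_ge0.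
- exact: measurable_inner.
- exact: measurable_inner.
- move=> x _; apply: ge0_le_integral => //.
  + exact: measurable_section mF.
  + exact: measurable_section mG.
Qed.

Lemma iteratedZ (k : R) F :
  measurable_fun setT (fun p : T * T => F p.1 p.2) -> (forall x y, 0 <= F x y) ->
  (0 <= k)%R ->
  \int[mu]_x \int[mu]_y (k%:E * F x y) = k%:E * \int[mu]_x \int[mu]_y F x y.
Proof.
move=> mF F0 k0.
under eq_integral do (rewrite ge0_integralZl ?lee_fin//;
  last by exact: measurable_section mF).
rewrite ge0_integralZl ?lee_fin//.
- exact: measurable_inner.
- by move=> x _; exact: integral_ge0.
Qed.

Lemma iteratedD F G :
  measurable_fun setT (fun p : T * T => F p.1 p.2) ->
  measurable_fun setT (fun p : T * T => G p.1 p.2) ->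
  (forall x y, 0 <= F x y) -> (forall x y, 0 <= G x y) ->
  \int[mu]_x \int[mu]_y (F x y + G x y) =
  \int[mu]_x \int[mu]_y F x y + \int[mu]_x \int[mu]_y G x y.
Proof.
move=> mF mG F0 G0.
under eq_integral do (rewrite ge0_integralD//;
  [|by exact: measurable_section mF|by exact: measurable_section mG]).
rewrite ge0_integralD//.
- by move=> x _; exact: integral_ge0.
- exact: measurable_inner.
- by move=> x _; exact: integral_ge0.
- exact: measurable_inner.
Qed.

Lemma iterated_esum (I : choiceType) (A : set I) (F : I -> T -> T -> \bar R) :
  countable A ->
  (forall i, measurable_fun setT (fun p : T * T => F i p.1 p.2)) ->
  (forall i x y, 0 <= F i x y) ->
  \int[mu]_x \int[mu]_y (\esum_(i in A) F i x y) =
  \esum_(i in A) \int[mu]_x \int[mu]_y F i x y.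
Proof.
move=> cA mF F0; rewrite -integral_esum//.
- apply: eq_integral => x _; rewrite integral_esum// => i.
  exact: measurable_section (mF i).
- by move=> i; exact: measurable_inner.
- by move=> i x; exact: integral_ge0.
Qed.

End IteratedIntegral.

Section Weights.
Context (R : realType) (n : nat).
Variables (mu : {measure set (borelRn R n) -> \bar R}) (C : R).
Variable (D : set (cube R n)).
Hypothesis S : doubling_setting mu C D.
Variable s : R.
Local Notation X := (borelRn R n).
Local Notation lev := (lev (setting_grid S)).
Local Notation mass := (mass mu).
Implicit Types (x y z c : 'rV[R]_n) (m : int) (Q P : cube R n) (f g h : X -> R).

Lemma setting_sigma_finite : sigma_finite setT mu.
Proof.
exists (exhaust S).
  by apply/seteqP; split => // x _; have [N xN] := exhaust_mem S x; exists N.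
by move=> N; split; [exact: measurable_exhaust|exact: exhaust_lty].
Qed.

Definition ball_mass c (r : R) : R := fine (mu (eball c r)).

Lemma ball_mass_ge0 c r : 0 <= ball_mass c r.
Proof. exact: fine_ge0. Qed.

Lemma ball_massE c r : 0 < r -> mu (eball c r) = (ball_mass c r)%:E.
Proof.
move=> r0; rewrite /ball_mass fineK// ge0_fin_numE//.
pose P : cube R n := (c, r).
have := mu_near (r := 1) (setting_C S) (setting_doubling S) (Q := P) r0 (measurable_eball c r).
move=> h; apply: le_lt_trans (h _) _; last by rewrite (massE S (r0 : 0 < side P)) -EFinM ltry.
move=> x xc i; rewrite mul1r; apply: le_trans (ltW xc).
by have := coord_le_enorm (x - c) i; rewrite !mxE.
Qed.

(** Cubes and balls of comparable size and position have comparable masses;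
    in the second direction, the ball contains a cube of side [r / n]. *)
Lemma ball_mass_le (N : nat) c r Q : 0 < r -> 0 < side Q ->
  (forall x, enorm (x - c) < r -> forall i, `|x 0 i - Q.1 0 i| <= N%:R * side Q) ->
  ball_mass c r <= C ^+ (2 * N).+1 * mass Q.
Proof.
move=> r0 Q0 h; rewrite -lee_fin -ball_massE// EFinM -(massE S)//.
by apply: (mu_near (setting_C S) (setting_doubling S)) => //; exact: measurable_eball.
Qed.

Lemma mass_le_ball (N : nat) c r Q : 0 < r -> 0 < side Q ->
  (forall x, cube_set Q x -> forall i, `|x 0 i - c 0 i| <= N%:R * r) ->
  mass Q <= C ^+ (2 * (N.+1 * n)).+1 * ball_mass c r.
Proof.
move=> r0 Q0 h; have n0 := setting_dim S; have n1 : 0 < n%:R :> R by rewrite ltr0n.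
pose t : R := r / n%:R; have t0 : 0 < t by rewrite divr_gt0.
have rE : r = n%:R * t by rewrite /t mulrC divfK ?gt_eqF.
pose P : cube R n := (c - const_mx (t / 2), t).
have tr : t <= r by rewrite rE ler_peMl ?(ltW t0)// ler1n.
apply: (@le_trans _ _ (C ^+ (2 * (N.+1 * n)).+1 * mass P)).
  apply: (mass_near S) => // x xQ i; rewrite !mxE opprB addrA.
  have := h x xQ i; rewrite /side/= natrM -mulrA -rE -(natr1 N) mulrDl mul1r.
  by rewrite !ler_norml => /andP[? ?]; apply/andP; split; lra.
rewrite ler_wpM2l ?(C_exp_ge0 S)//.
rewrite -lee_fin -ball_massE// -(massE S)//; apply: le_measure; rewrite ?inE.
- exact: measurable_cube.
- exact: measurable_eball.
move=> x xP; rewrite /eball/=.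
apply: (@le_lt_trans _ _ (n%:R * (t / 2))); last first.
  by rewrite mulrA -rE ltr_pdivrMr// ltr_pMr//; lra.
apply: enorm_le; last by rewrite divr_ge0// ltW.
move=> i; have := xP i; rewrite !mxE /side/= ler_norml => /andP[? ?].
by apply/andP; split; lra.
Qed.

Lemma ball_mass_gt0 c r : 0 < r -> 0 < ball_mass c r.
Proof.
move=> r0; pose P : cube R n := (c, r).
have h : mass P <= C ^+ (2 * (2 * n)).+1 * ball_mass c r.
  apply: mass_le_ball => // x xP i; have := xP i; rewrite /side/= mul1r ler_norml.
  by move=> /andP[? ?]; apply/andP; split; lra.
have : 0 < C ^+ (2 * (2 * n)).+1 * ball_mass c r by apply: lt_le_trans h; exact: (mass_gt0 S).
by rewrite pmulr_rgt0//; apply: lt_le_trans (C_exp_ge1 S _).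
Qed.

(** The kernel of the Sobolev norm, as a real-valued function. *)
Definition kernel x y : R := ((enorm (x - y) `^ s) ^+ 2)^-1 *
  (ball_mass (2^-1 *: (x + y)) (enorm (x - y) / 2))^-1.

Lemma kernel_ge0 x y : 0 <= kernel x y.
Proof. by rewrite mulr_ge0// invr_ge0 ?sqr_ge0 ?ball_mass_ge0. Qed.

Lemma enorm_gt0 x y : x != y -> 0 < enorm (x - y).
Proof. by move=> xy; apply: lt_le_trans (supdist_gt0 xy) (supdist_le_enorm _ _). Qed.

Lemma sobolev_integrandE f x y :
  sobolev_integrand mu s f x y = ((f x - f y) ^+ 2 * kernel x y)%:E.
Proof.
rewrite /sobolev_integrand; have [->|xy] := eqVneq x y.
  by rewrite !subrr !mul0r expr0n mul0e mul0r.
have e0 := enorm_gt0 xy; have r0 : 0 < enorm (x - y) / 2 by rewrite divr_gt0.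
rewrite ball_massE// inver gt_eqF ?ball_mass_gt0// -EFinM; congr EFin.
by rewrite exprMn exprVn mulrA.
Qed.

Lemma measurable_coord1 i : measurable_fun [set: X * X]
  (fun p : X * X => (p.1 : 'rV[R]_n) 0 i).
Proof. by apply: (measurableT_comp (measurable_coord i)); exact: measurable_fst. Qed.

Lemma measurable_coord2 i : measurable_fun [set: X * X]
  (fun p : X * X => (p.2 : 'rV[R]_n) 0 i).
Proof. by apply: (measurableT_comp (measurable_coord i)); exact: measurable_snd. Qed.

Lemma measurable_dist : measurable_fun [set: X * X]
  (fun p : X * X => enorm ((p.1 : 'rV[R]_n) - p.2)).
Proof.
apply: measurable_enorm => i; under eq_fun do rewrite !mxE.
by apply: measurable_funB; [exact: measurable_coord1|exact: measurable_coord2].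
Qed.

(** The mass of the ball is that of a section of a measurable set of triples of
    points. *)
Lemma measurable_ball_mass : measurable_fun [set: X * X] (fun p : X * X =>
  ball_mass (2^-1 *: ((p.1 : 'rV[R]_n) + p.2)) (enorm ((p.1 : 'rV[R]_n) - p.2) / 2)).
Proof.
pose A : set ((X * X) * X) := [set q | enorm ((q.2 : 'rV[R]_n) -
  2^-1 *: ((q.1.1 : 'rV[R]_n) + q.1.2)) < enorm ((q.1.1 : 'rV[R]_n) - q.1.2) / 2].
have mA : measurable A.
  have m1 : measurable_fun [set: (X * X) * X] (fun q : (X * X) * X =>
      enorm ((q.2 : 'rV[R]_n) - 2^-1 *: ((q.1.1 : 'rV[R]_n) + q.1.2))).
    apply: measurable_enorm => i; under eq_fun do rewrite !mxE.
    apply: measurable_funB.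
      by apply: (measurableT_comp (measurable_coord i)); exact: measurable_snd.
    apply: measurable_funM => //; apply: measurable_funD.
      by apply: (measurableT_comp (measurable_coord1 i)); exact: measurable_fst.
    by apply: (measurableT_comp (measurable_coord2 i)); exact: measurable_fst.
  have m2 : measurable_fun [set: (X * X) * X] (fun q : (X * X) * X =>
      enorm ((q.1.1 : 'rV[R]_n) - q.1.2) / 2).
    apply: measurable_funM => //.
    by apply: (measurableT_comp measurable_dist); exact: measurable_fst.
  have mlt := measurable_fun_ltr m1 m2.
  have -> : A = (fun q : (X * X) * X => enorm ((q.2 : 'rV[R]_n) -
    2^-1 *: ((q.1.1 : 'rV[R]_n) + q.1.2)) <
    enorm ((q.1.1 : 'rV[R]_n) - q.1.2) / 2) @^-1` [set true].
    by apply/seteqP; split => q.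
  by rewrite -[X in measurable X]setTI; exact: mlt.
have := @measurable_fun_xsection _ _ (X * X)%type X R (sfm setting_sigma_finite) A mA.
move=> mx; have := @measurableT_comp _ _ _ _ _ _ fine _ _ (fine_measurable measurableT) mx.
congr measurable_fun; apply/funext => p /=; rewrite /ball_mass /sfm; congr (fine (mu _)).
by apply/seteqP; split => z; rewrite /xsection/= inE.
Qed.

Lemma measurable_powRc d (T : measurableType d) (F : T -> R) (t : R) :
  measurable_fun [set: T] F -> measurable_fun [set: T] (fun a => F a `^ t).
Proof.
move=> mF; rewrite (_ : (fun a => _) = (fun u => u `^ t) \o F)//.
by apply: measurableT_comp => //; exact: measurable_powR.
Qed.

Lemma measurable_kernel : measurable_fun [set: X * X]
  (fun p : X * X => kernel p.1 p.2).
Proof.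
have inv1 (t : R) : 0 <= t -> t^-1 = t `^ (-1) by move=> t0; rewrite powR_inv1.
rewrite /kernel; under eq_fun do rewrite inv1 ?sqr_ge0// [X in _ * X]inv1 ?ball_mass_ge0//.
apply: measurable_funM; apply: measurable_powRc; last exact: measurable_ball_mass.
by apply: measurable_funX; apply: measurable_powRc; exact: measurable_dist.
Qed.

Lemma measurable_sqdiff f : measurable_fun [set: X] f ->
  measurable_fun [set: X * X] (fun p : X * X => (f p.1 - f p.2) ^+ 2).
Proof.
move=> mf; apply: measurable_funX; apply: measurable_funB.
- by apply: (measurableT_comp mf); exact: measurable_fst.
- by apply: (measurableT_comp mf); exact: measurable_snd.
Qed.

Definition sobolev_energy f : \bar R :=
  (\int[mu]_x \int[mu]_y ((f x - f y) ^+ 2 * kernel x y)%:E)%E.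

Lemma norm_sobolevE f : norm_sobolev mu s f = sqrte (sobolev_energy f).
Proof.
congr sqrte; apply: eq_integral => x _; apply: eq_integral => y _.
exact: sobolev_integrandE.
Qed.

Lemma measurable_sobolev f : measurable_fun [set: X] f ->
  measurable_fun [set: X * X]
    (fun p : X * X => ((f p.1 - f p.2) ^+ 2 * kernel p.1 p.2)%:E).
Proof.
move=> mf; apply/measurable_EFinP; apply: measurable_funM.
- exact: measurable_sqdiff.
- exact: measurable_kernel.
Qed.

End Weights.

Section DiffLeSobolev.
Context (R : realType) (n : nat).
Variables (mu : {measure set (borelRn R n) -> \bar R}) (C : R).
Variable (D : set (cube R n)).
Hypothesis S : doubling_setting mu C D.
Variable kappa : nat.
Hypothesis k0 : (0 < kappa)%N.
Variable s : R.
Hypothesis s0 : 0 < s.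
Local Notation X := (borelRn R n).
Local Notation lev := (lev (setting_grid S)).
Local Notation mass := (mass mu).
Local Notation weight := (weight s).
Local Notation ratio := (ratio s).
Local Notation kernel := (kernel mu s).
Local Notation sf := (setting_sigma_finite S).
Implicit Types (x y z c : 'rV[R]_n) (m : int) (Q P : cube R n) (f g h : X -> R).

Definition same_cube m : set (X * X) := [set p | lev m p.1 = lev m p.2].

Lemma measurable_same_cube m : measurable (same_cube m).
Proof.
pose Q (q : 'rV[rat]_n) := lev m (map_mx ratr q).
have -> : same_cube m = \bigcup_(q : 'rV[rat]_n)
    ((cube_set (Q q) : set X) `*` (cube_set (Q q) : set X)).
  apply/seteqP; split => -[x y]; rewrite /same_cube/=.
    move=> xy; have [q qx] := gen_rat (setting_grid S) (gen_lev (setting_grid S) m x).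
    by exists q => //; split; rewrite /= /Q qx; [|rewrite xy]; exact: lev_mem.
  by move=> [q _ [/= /lev_meq -> /lev_meq ->]].
apply: countable_bigcupT_measurable => // q.
by apply: measurableX; exact: measurable_cube.
Qed.

Definition local_kernel m x y : R := \1_(same_cube m) ((x, y) : X * X) / mass (lev m x).

Lemma local_kernel_ge0 m x y : 0 <= local_kernel m x y.
Proof. by rewrite divr_ge0 ?mass_ge0// indicE ler0n. Qed.

Lemma measurable_local m f : measurable_fun [set: X] f ->
  measurable_fun [set: X * X]
    (fun p : X * X => ((f p.1 - f p.2) ^+ 2 * local_kernel m p.1 p.2)%:E).
Proof.
move=> mf; apply/measurable_EFinP; apply: measurable_funM; first exact: measurable_sqdiff.
apply: measurable_funM.
  have := @measurable_indic _ _ R setT _ (measurable_same_cube m).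
  by congr measurable_fun; apply/funext => -[].
apply: (measurableT_comp (f := fun x : X => (mass (lev m x))^-1)) => //.
exact: (measurable_lev_cst (setting_grid S) (fun Q => (mass Q)^-1)).
Qed.

(** On a cube, the projection does at least as well as the constant [f x], for
    each [x] in the cube; average this over [x]. *)
Lemma gen_err_le_pairs m f : L2 mu f ->
  (gen_err S kappa m f <=
    \int[mu]_x \int[mu]_y ((f x - f y) ^+ 2 * local_kernel m x y)%:E)%E.
Proof.
move=> fL; have mf := L2_measurable fL; rewrite gen_errE//.
pose F Q x y : R := \1_(cube_set Q) y * ((f x - f y) ^+ 2 / mass Q).
have F0 Q x y : 0 <= F Q x y.
  by rewrite mulr_ge0 ?indicE ?ler0n// divr_ge0 ?mass_ge0 ?sqr_ge0.
have mF Q : measurable_fun [set: X * X] (fun p : X * X => (F Q p.1 p.2)%:E).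
  apply/measurable_EFinP; apply: measurable_funM; last first.
    by apply: measurable_funM => //; exact: measurable_sqdiff.
  apply: (measurableT_comp (f := fun y : X => \1_(cube_set Q : set X) y : R)) => //.
  by apply: measurable_indic; exact: measurable_cube.
pose H Q x := (\int[mu]_y (F Q x y)%:E)%E.
have H0 Q x : (0 <= H Q x)%E by apply: integral_ge0 => y _; rewrite lee_fin.
have mH Q : measurable_fun [set: X] (H Q).
  by apply: (measurable_inner sf (F := fun x y => (F Q x y)%:E)) => // x y; rewrite lee_fin.
have -> : (\int[mu]_x \int[mu]_y ((f x - f y) ^+ 2 * local_kernel m x y)%:E =
    \int[mu]_x H (lev m x) x)%E.
  apply: eq_integral => x _; apply: eq_integral => y _; congr EFin.
  rewrite /F /local_kernel mulrCA; congr (_ * _); apply: eq_indic.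
  split; first by move=> /= ->; exact: lev_mem.
  by move=> /lev_meq.
rewrite -(integral_lev (setting_grid S) mu m mH H0).
apply: le_esum => Q GQ; have Q0 := gen_side GQ; have M0 := mass_gt0 S Q0.
have mQ : measurable (cube_set Q : set X) by exact: measurable_cube.
have errH x : (((mass Q)^-1)%:E * err S kappa Q f <= H Q x)%E.
  apply: (@le_trans _ _ (((mass Q)^-1)%:E *
      \int[mu]_(y in cube_set Q) ((f y - f x) ^+ 2)%:E)%E).
    apply: lee_wpmul2l; first by rewrite lee_fin invr_ge0 ltW.
    by apply: (err_le S Q0 fL (g := fun=> f x)); exact: polyfun_cst.
  rewrite -ge0_integralZl//.
  - rewrite /H integral_mkcond le_eqVlt; apply/orP; left; apply/eqP.
    apply: eq_integral => y _; rewrite patchE /F indicE.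
    case: ifP => _; last by rewrite mul0r.
    by rewrite mul1r -EFinM -(opprB (f x)) sqrrN mulrC.
  - apply/measurable_EFinP; apply: measurable_funTS; apply: measurable_funX.
    exact: measurable_funB.
  - by move=> y _; rewrite lee_fin sqr_ge0.
  - by rewrite lee_fin invr_ge0 ltW.
apply: (@le_trans _ _ (\int[mu]_(x in cube_set Q)
    (cst (((mass Q)^-1)%:E * err S kappa Q f) x))%E).
  rewrite integral_cst// (massE S Q0) muleAC -EFinM mulVf ?gt_eqF// mul1e.
  exact: lexx.
apply: ge0_le_integral => //.
- by move=> x _; rewrite mule_ge0 ?err_ge0// lee_fin invr_ge0 ltW.
- exact: measurable_funTS.
Qed.

Lemma weight_sum_le m0 : (\esum_(m in [set m | (m0 <= m)%R]) (weight m)%:E <=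
  ((1 - ratio^-1)^-1 * weight m0)%:E)%E.
Proof.
have r1 := ratio_gt1 s0; have r0 := ratio_gt0 s.
have -> : [set m | m0 <= m] = (fun k : nat => m0 + k%:Z) @` setT.
  apply/seteqP; split => [m /= h|_ [k _ <-]] /=; last by rewrite lerDl.
  by exists `|m - m0|%N => //; lia.
rewrite esum_image; last by move=> k l _ _ /addrI [].
rewrite (eq_esum (b := fun k => (weight m0)%:E * ((ratio^-1) ^+ k)%:E)%E); last first.
  by move=> k _; rewrite (weight_shift s _ k) addrK exprVn mulrC EFinM.
rewrite esumZl ?weight_ge0//; last by move=> k; rewrite lee_fin exprn_ge0// invr_ge0 ltW.
rewrite mulrC EFinM; apply: lee_wpmul2l; first by rewrite lee_fin weight_ge0.
by apply: esum_geometric; rewrite invr_ge0 (ltW r0)/= invf_lt1.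
Qed.

Definition K_diff : R := (1 - ratio^-1)^-1 * (n%:R `^ (2 * s)) * C ^+ (2 * n.+1).+1.

Lemma geometric_ge0 : 0 <= (1 - ratio^-1)^-1.
Proof.
have r1 := ratio_gt1 s0; have r0 := ratio_gt0 s.
by rewrite invr_ge0 subr_ge0 ltW// invf_lt1.
Qed.

Lemma K_diff_ge0 : 0 <= K_diff.
Proof.
apply: mulr_ge0; last exact: (C_exp_ge0 S).
by apply: mulr_ge0; [exact: geometric_ge0|exact: powR_ge0].
Qed.

(** Only cubes larger than the distance of the two points contribute, so the
    sum over the generations is a geometric series; and the mass of such a cube
    dominates that of the ball in the kernel. *)
Lemma local_kernel_sum x y : x != y ->
  (\esum_(m in [set: int]) (weight m * local_kernel m x y)%:E <=
    (K_diff * kernel x y)%:E)%E.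
Proof.
move=> xy; have d0 := supdist_gt0 xy; have e0 := enorm_gt0 xy.
have n0 := setting_dim S; have n1 : 1 <= n%:R :> R by rewrite ler1n.
have [m0 /andP[h1 h2]] := dyadic_scale d0.
have r0 : 0 < enorm (x - y) / 2 by rewrite divr_gt0.
set c := 2^-1 *: (x + y); set r := enorm (x - y) / 2 in r0.
have B0 := ball_mass_gt0 S c r0; set B := ball_mass mu c r in B0.
pose K := C ^+ (2 * n.+1).+1 / B.
have K0 : 0 <= K by rewrite divr_ge0 ?(C_exp_ge0 S)// ltW.
have term m : same_cube m (x, y) -> m0 <= m /\ (mass (lev m x))^-1 <= K.
  rewrite /same_cube/= => lxy.
  have xyQ : cube_set (lev m x) y by rewrite lxy; exact: lev_mem.
  have dm := lev_dist xyQ; split.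
    have : 2 ^ (m0 - 1) < 2 ^ m :> R by apply: le_lt_trans dm.
    by rewrite ltr_eXz2l ?ltr1n// ltrBlDr ltzD1.
  have M0 := mass_gt0 S (lev_side_gt0 (setting_grid S) m x).
  rewrite /K ler_pdivlMr// mulrC ler_pdivrMr//.
  apply: (ball_mass_le S r0); first exact: lev_side_gt0.
  move=> z zB i; rewrite lev_side.
  suff : `|z 0 i - (lev m x).1 0 i| <= n%:R * 2 ^ m + 2 ^ m.
    by move=> h; apply: le_trans h _; rewrite -[in leRHS]natr1 mulrDl mul1r.
  have := coord_le_enorm (z - c) i; rewrite !mxE => zc.
  have := enorm_le_supdist x y; have nd : n%:R * supdist x y <= n%:R * 2 ^ m.
    by rewrite ler_wpM2l// ltW.
  move=> ed; have : `|z 0 i - 2^-1 * (x 0 i + y 0 i)| <= n%:R * 2 ^ m / 2.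
    apply: le_trans zc _; apply: le_trans (ltW zB) _.
    by rewrite /r ler_wpM2r//; apply: le_trans ed nd.
  have := lev_mem (setting_grid S) m x i; have := xyQ i; rewrite lev_side.
  have p0 := pow2_gt0 R m; have : 0 <= n%:R * 2 ^ m :> R by rewrite mulr_ge0 ?(ltW p0).
  move: (n%:R * 2 ^ m) => u.
  rewrite !ler_norml.
  by move=> ? /andP[? ?] /andP[? ?] /andP[? ?]; apply/andP; split; lra.
have ew : weight m0 <= n%:R `^ (2 * s) * ((enorm (x - y) `^ s) ^+ 2)^-1.
  have p0 := pow2_gt0 R m0.
  have -> : (enorm (x - y) `^ s) ^+ 2 = enorm (x - y) `^ (2 * s).
    by rewrite -powR_mulrn ?powR_ge0// -powRrM mulrC.
  rewrite /weight powRN ler_pdivlMr ?powR_gt0// mulrC ler_pdivrMr ?powR_gt0//.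
  rewrite -powRM ?ler0n ?(ltW p0)//; apply: ge0_ler_powR.
  - by rewrite mulr_ge0// ltW.
  - by rewrite nnegrE ltW.
  - by rewrite nnegrE mulr_ge0// ltW.
  - apply: le_trans (enorm_le_supdist x y) _; apply: ler_wpM2l => //; exact: ltW.
apply: (@le_trans _ _ (\esum_(m in [set m | (m0 <= m)%R]) (K%:E * (weight m)%:E))%E).
  rewrite [leRHS]esum_mkcond; apply: le_esum => m _.
  have [h|h] := pselect (same_cube m (x, y)).
    have [mm hK] := term m h; rewrite mem_set// -EFinM lee_fin mulrC.
    rewrite ler_wpM2r ?weight_ge0// /local_kernel indicE mem_set// mul1r.
    exact: hK.
  rewrite /local_kernel indicE memNset// mul0r mulr0.
  by case: ifP => _ //; rewrite mule_ge0// lee_fin ?weight_ge0.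
rewrite esumZl//; last by move=> m; rewrite lee_fin weight_ge0.
apply: (@le_trans _ _ (K%:E * ((1 - ratio^-1)^-1 * weight m0)%:E)%E).
  by apply: lee_wpmul2l; rewrite ?lee_fin//; exact: weight_sum_le.
rewrite -EFinM lee_fin /K_diff /kernel -/c -/r -/B.
have G0 := geometric_ge0.
apply: (@le_trans _ _ (K * ((1 - ratio^-1)^-1 *
  (n%:R `^ (2 * s) * ((enorm (x - y) `^ s) ^+ 2)^-1)))).
  by apply: ler_wpM2l => //; apply: ler_wpM2l.
by rewrite /K le_eqVlt; apply/orP; left; apply/eqP; ring.
Qed.

Lemma diff_le_sobolev f : L2 mu f ->
  (diff_energy S kappa s f <= K_diff%:E * sobolev_energy mu s f)%E.
Proof.
move=> fL; have mf := L2_measurable fL; have KD := K_diff_ge0.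
have cint : countable [set: int] by [].
have mloc m := measurable_local m mf.
have l0 m x y : (0 <= ((f x - f y) ^+ 2 * local_kernel m x y)%:E)%E.
  by rewrite lee_fin mulr_ge0 ?sqr_ge0 ?local_kernel_ge0.
have wl0 m x y : (0 <= (weight m)%:E * ((f x - f y) ^+ 2 * local_kernel m x y)%:E)%E.
  by rewrite mule_ge0// lee_fin weight_ge0.
have mwl m : measurable_fun [set: X * X] (fun p : X * X =>
    (weight m)%:E * ((f p.1 - f p.2) ^+ 2 * local_kernel m p.1 p.2)%:E)%E.
  by apply: emeasurable_funM => //; exact: mloc.
have kk0 x y : (0 <= ((f x - f y) ^+ 2 * kernel x y)%:E)%E.
  by rewrite lee_fin mulr_ge0 ?sqr_ge0 ?kernel_ge0.
apply: (@le_trans _ _ (\esum_(m in [set: int]) \int[mu]_x \int[mu]_y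
    ((weight m)%:E * ((f x - f y) ^+ 2 * local_kernel m x y)%:E))%E).
  apply: le_esum => m _; rewrite (iteratedZ sf (mloc m) (l0 m)) ?weight_ge0//.
  by apply: lee_wpmul2l; [rewrite lee_fin weight_ge0|exact: gen_err_le_pairs].
rewrite -(iterated_esum sf cint mwl wl0).
rewrite /sobolev_energy -(iteratedZ sf (measurable_sobolev S s mf) kk0 KD).
apply: (le_iterated sf).
- exact: measurable_esum.
- by apply: emeasurable_funM => //; exact: (measurable_sobolev S s mf).
- by move=> x y; apply: esum_ge0 => m _.
move=> x y; have [->|xy] := eqVneq x y.
  rewrite esum1 ?mule_ge0// => m _.
  by rewrite subrr expr0n mul0r mule0.
rewrite (eq_esum (b := fun m => ((f x - f y) ^+ 2)%:E *
    (weight m * local_kernel m x y)%:E)%E); last first.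
  by move=> m _; rewrite -!EFinM; congr EFin; ring.
rewrite esumZl ?sqr_ge0//; last first.
  by move=> m; rewrite lee_fin mulr_ge0 ?weight_ge0 ?local_kernel_ge0.
apply: (@le_trans _ _ (((f x - f y) ^+ 2)%:E * (K_diff * kernel x y)%:E)%E).
  by apply: lee_wpmul2l; rewrite ?lee_fin ?sqr_ge0//; exact: local_kernel_sum.
by rewrite -!EFinM lee_fin le_eqVlt; apply/orP; left; apply/eqP; ring.
Qed.

End DiffLeSobolev.

(** * The Sobolev norm is controlled by the difference norm *)

(** A geometric weight on the terms replaces the number of terms in the
    Cauchy-Schwarz inequality by a constant. *)
Lemma weighted_cauchy_schwarz (R : realFieldType) (theta : R) (a : nat -> R) N :
  1 < theta ->
  (\sum_(k < N) a k) ^+ 2 <=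
    (1 - theta^-1)^-1 * \sum_(k < N) theta ^+ k * a k ^+ 2.
Proof.
move=> t1; have t0 : 0 < theta by lra.
have t10 : 0 < theta - 1 by lra.
have ti : 0 < 1 - theta^-1 by rewrite subr_gt0 invf_lt1.
elim: N a => [|N IH] a; first by rewrite !big_ord0 expr0n mulr0.
rewrite !big_ord_recl expr0 mul1r.
have tt : 0 < (theta - 1)^-1 by rewrite invr_gt0.
apply: le_trans (sqr_young (a 0%N) _ tt) _.
have -> : 1 + (theta - 1)^-1 = (1 - theta^-1)^-1.
  by field; rewrite !gt_eqF.
have -> : 1 + (theta - 1)^-1^-1 = theta by rewrite invrK addrC subrK.
rewrite mulrDr lerD2l.
have /(ler_wpM2l (ltW t0)) := IH (fun k => a k.+1).
move/le_trans; apply; rewrite mulrCA ler_wpM2l ?invr_ge0 ?(ltW ti)//.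
rewrite big_distrr/=; apply: ler_sum => k _.
by rewrite /bump/= add1n [theta ^+ k.+1]exprS mulrA.
Qed.

Section SobolevLeDiff.
Context (R : realType) (n : nat).
Variables (mu : {measure set (borelRn R n) -> \bar R}) (C : R).
Variable (D : set (cube R n)).
Hypothesis S : doubling_setting mu C D.
Variable kappa : nat.
Hypothesis k0 : (0 < kappa)%N.
Local Notation X := (borelRn R n).
Local Notation lev := (lev (setting_grid S)).
Local Notation mass := (mass mu).
Local Notation lam := (layer_rate C).
Local Notation sf := (setting_sigma_finite S).
Local Notation gen_err := (gen_err S kappa).
Local Notation gen_proj := (gen_proj S kappa).
Local Notation pol := (pol S kappa).
Implicit Types (x y z c : 'rV[R]_n) (m j : int) (Q P : cube R n) (f g h : X -> R).

(** A piecewise polynomial varies little at a scale that is [i] generations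
    finer: inside a cube by Markov's inequality, and across the boundary of a
    cube because the points involved lie in a thin layer. *)
Lemma piecewise_polynomial_variation : exists2 K : R, 0 <= K &
  forall j (p : cube R n -> X -> R) (i : nat), (forall Q, polyfun kappa (p Q)) ->
  exists h, [/\ measurable_fun [set: X] h, forall x, 0 <= h x,
    forall x y, supdist x y < 2 ^ (j - i%:Z) ->
      (p (lev j x) x - p (lev j y) y) ^+ 2 <= h x + h y &
    (\int[mu]_x (h x)%:E <=
      (K * lam ^+ i)%:E * \int[mu]_x ((p (lev j x) x) ^+ 2)%:E)%E].
Proof.
have [A A0 hA] := polyfun_lipschitz R n kappa.
have [K K0 hK] := polyfun_sup_le_L2 S kappa.
have lam0 := layer_rate_gt0 S; have /andP[lam23 lam1] := layer_rate_itv S.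
pose K1 : R := A ^+ 2 + 2 * lam ^- 3.
have K10 : 0 <= K1 by rewrite addr_ge0 ?sqr_ge0// mulr_ge0// invr_ge0 exprn_ge0// ltW.
exists (K1 * K); first exact: mulr_ge0.
move=> j p i pp; pose t : R := 2 ^ (j - i%:Z).
pose M Q : R := projT1 (cid (hK j Q.1 (p Q) (pp Q))).
have MP Q : gen D j Q -> [/\ 0 <= M Q, forall x, cube_set Q x -> `|p Q x| <= M Q &
    ((M Q ^+ 2 * mass Q)%:E <=
      K%:E * \int[mu]_(x in cube_set Q) ((p Q x) ^+ 2)%:E)%E].
  move=> GQ; have := projT2 (cid (hK j Q.1 (p Q) (pp Q))).
  by rewrite -/(M Q); move: (M Q) => r; rewrite (gen_corner (setting_grid S) GQ).
pose hQ Q x : R := (A ^+ 2 * 4^-1 ^+ i + 2 * \1_(layer t Q : set X) x) * M Q ^+ 2.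
have hQ0 Q x : 0 <= hQ Q x.
  by rewrite mulr_ge0 ?sqr_ge0// addr_ge0// mulr_ge0 ?sqr_ge0 ?exprn_ge0// indicE ler0n.
have mhQ Q : measurable_fun [set: X] (hQ Q).
  apply: measurable_funM => //; apply: measurable_funD => //.
  apply: measurable_funM => //; apply: measurable_indic; exact: measurable_layer.
exists (fun x => hQ (lev j x) x); split => //.
- exact: (measurable_lev (setting_grid S) (h := hQ)).
- have inside x y : supdist x y < t -> ~ layer t (lev j x) x ->
      (p (lev j x) x - p (lev j y) y) ^+ 2 <= hQ (lev j x) x.
    move=> xy xL; have xQ := lev_mem (setting_grid S) j x.
    have yQ := not_layer_ball xQ xL xy; rewrite (lev_meq yQ).
    have [M0 MQ _] := MP _ (gen_lev (setting_grid S) j x).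
    have := hA _ _ _ (pp _) (lev_side_gt0 (setting_grid S) j x) MQ x y xQ yQ.
    have h1 : supdist x y / side (lev j x) <= 2^-1 ^+ i.
      have p0 := pow2_gt0 R j; rewrite lev_side ler_pdivrMr//.
      apply: le_trans (ltW xy) _; rewrite /t (pow2_nat R j i) mulrA -exprMn.
      by rewrite mulVf ?expr1n ?mul1r// pnatr_eq0.
    move=> h2; have h3 : `|p (lev j x) x - p (lev j x) y| <= A * M (lev j x) * 2^-1 ^+ i.
      by apply: le_trans h2 _; rewrite ler_wpM2l// mulr_ge0.
    rewrite -(real_normK (num_real _)); apply: (@le_trans _ _
      ((A * M (lev j x) * 2^-1 ^+ i) ^+ 2)).
      by rewrite lerXn2r ?nnegrE// mulr_ge0 ?exprn_ge0// mulr_ge0.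
    have e2 : (2^-1 : R) ^+ 2 = 4^-1 by rewrite expr2; field.
    have e4 : (2^-1 ^+ i) ^+ 2 = 4^-1 ^+ i :> R by rewrite -exprM mulnC exprM e2.
    by rewrite /hQ indicE memNset// mulr0 addr0 !exprMn e4 mulrAC.
  move=> x y xy; have yx : supdist y x < t by rewrite supdistC.
  have [xL|xL] := pselect (layer t (lev j x) x); last first.
    by apply: le_trans (inside _ _ xy xL) _; rewrite lerDl.
  have [yL|yL] := pselect (layer t (lev j y) y); last first.
    rewrite -sqrrN opprB; apply: le_trans (inside _ _ yx yL) _.
    by rewrite lerDr.
  have big z : layer t (lev j z) z -> 2 * (p (lev j z) z) ^+ 2 <= hQ (lev j z) z.
    move=> zL; have [M0 MQ _] := MP _ (gen_lev (setting_grid S) j z).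
    have h1 := MQ z (lev_mem _ _ _).
    have h2 : (p (lev j z) z) ^+ 2 <= M (lev j z) ^+ 2.
      by rewrite -(real_normK (num_real (p _ z))) lerXn2r ?nnegrE.
    have h3 : 0 <= A ^+ 2 * 4^-1 ^+ i * M (lev j z) ^+ 2.
      by rewrite mulr_ge0 ?sqr_ge0// mulr_ge0 ?sqr_ge0 ?exprn_ge0.
    have h5 : \1_(layer t (lev j z) : set X) z = 1 :> R by rewrite indicE mem_set.
    by rewrite /hQ h5 mulrDl mulr1; lra.
  apply: le_trans (lerD (big x xL) (big y yL)).
  have := sqr_ge0 (p (lev j x) x + p (lev j y) y); lra.
rewrite -(integral_lev (setting_grid S) mu j (h := fun Q x => (hQ Q x)%:E)); first last.
- by move=> Q x; rewrite lee_fin.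
- by move=> Q; apply/measurable_EFinP.
rewrite -(integral_lev (setting_grid S) mu j (h := fun Q x => ((p Q x) ^+ 2)%:E)); first last.
- by move=> Q x; rewrite lee_fin sqr_ge0.
- by move=> Q; apply/measurable_EFinP; apply: measurable_funX; exact: (measurable_polyfun (pp Q)).
have K2 : 0 <= K1 * K * lam ^+ i.
  by rewrite !mulr_ge0// exprn_ge0// ltW.
rewrite -esumZl//; last first.
  by move=> Q; apply: integral_ge0 => x _; rewrite lee_fin sqr_ge0.
apply: le_esum => Q GQ; have [M0 MQ MK] := MP Q GQ.
have Q0 := gen_side GQ.
have mQ : measurable (cube_set Q : set X) by exact: measurable_cube.
have mL : measurable (layer t Q : set X) by exact: measurable_layer.
have muL : (mu (layer t Q) <= (lam ^- 3 * lam ^+ i * mass Q)%:E)%E.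
  by rewrite -(gen_corner (setting_grid S) GQ); exact: (layer_decay S).
have LQ : layer t Q `&` cube_set Q = layer t Q by apply/setIidl => x [].
have -> : (\int[mu]_(x in cube_set Q) (hQ Q x)%:E = (M Q ^+ 2)%:E *
    ((A ^+ 2 * 4^-1 ^+ i)%:E * mu (cube_set Q) + 2%:E * mu (layer t Q)))%E.
  have eh x : (hQ Q x)%:E = ((M Q ^+ 2)%:E * ((A ^+ 2 * 4^-1 ^+ i)%:E +
      2%:E * (\1_(layer t Q : set X) x : R)%:E))%E.
    by rewrite -!EFinM /hQ mulrC.
  under eq_integral do rewrite eh.
  have c0 : 0 <= A ^+ 2 * 4^-1 ^+ i by rewrite mulr_ge0 ?sqr_ge0 ?exprn_ge0.
  have mi : measurable_fun (cube_set Q : set X)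
      (fun x : X => (\1_(layer t Q : set X) x : R)%:E).
    by apply/measurable_EFinP; exact: measurable_indic.
  have m2i : measurable_fun (cube_set Q : set X)
      (fun x : X => 2%:E * (\1_(layer t Q : set X) x : R)%:E)%E.
    exact: emeasurable_funM.
  rewrite ge0_integralZl//; first last.
  - by rewrite lee_fin sqr_ge0.
  - by move=> x _; rewrite adde_ge0 ?lee_fin// mulr_ge0// indicE ler0n.
  - exact: emeasurable_funD.
  congr (_ * _)%E; rewrite ge0_integralD//.
  rewrite (integral_cst mu mQ (A ^+ 2 * 4^-1 ^+ i)%:E); congr (_ + _)%E.
  rewrite ge0_integralZl// ?lee_fin//.
  by rewrite integral_indic// LQ.
rewrite (massE S Q0).
apply: (@le_trans _ _ ((K1 * lam ^+ i)%:E * (M Q ^+ 2 * mass Q)%:E)%E); last first.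
  have -> : (K1 * K * lam ^+ i)%:E = ((K1 * lam ^+ i)%:E * K%:E)%E.
    by rewrite -EFinM mulrAC.
  rewrite -muleA; apply: lee_wpmul2l => //.
  by rewrite lee_fin mulr_ge0// exprn_ge0// ltW.
apply: (@le_trans _ _ ((M Q ^+ 2)%:E * ((A ^+ 2 * 4^-1 ^+ i)%:E * (mass Q)%:E +
    2%:E * (lam ^- 3 * lam ^+ i * mass Q)%:E))%E).
  apply: lee_wpmul2l; first by rewrite lee_fin sqr_ge0.
  by apply: leeD => //; apply: lee_wpmul2l => //; rewrite lee_fin.
rewrite -!EFinM lee_fin.
have h4 : 4^-1 ^+ i <= lam ^+ i :> R by apply: lerXn2r; rewrite ?nnegrE; lra.
have m0 := mass_ge0 mu Q.
have -> : K1 * lam ^+ i * (M Q ^+ 2 * mass Q) = M Q ^+ 2 * (A ^+ 2 * lam ^+ i * mass Q +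
    2 * (lam ^- 3 * lam ^+ i * mass Q)) by rewrite /K1; ring.
rewrite ler_wpM2l ?sqr_ge0// lerD2r ler_wpM2r// ler_wpM2l ?sqr_ge0//.
Qed.

(** For points at distance about [2 ^ m], the mass of the cube is comparable to
    that of the ball in the kernel of the Sobolev norm. *)
Definition near_set m : set (X * X) :=
  [set p | supdist (p.1 : 'rV[R]_n) p.2 < 2 ^ m].

Definition near_kernel m x y : R := \1_(near_set m) ((x, y) : X * X) / mass (lev m x).

Lemma near_kernel_ge0 m x y : 0 <= near_kernel m x y.
Proof. by rewrite divr_ge0 ?mass_ge0// indicE ler0n. Qed.

Lemma measurable_near_kernel m : measurable_fun [set: X * X]
  (fun p : X * X => near_kernel m p.1 p.2).
Proof.
apply: measurable_funM.
  have := @measurable_indic _ _ R setT _ (measurable_supdist_lt (n := n) (pow2_gt0 R m)).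
  by congr measurable_fun; apply/funext => -[].
apply: (measurableT_comp (f := fun x : X => (mass (lev m x))^-1)) => //.
exact: (measurable_lev_cst (setting_grid S) (fun Q => (mass Q)^-1)).
Qed.

Lemma near_kernel_row m x : (\int[mu]_y (near_kernel m x y)%:E <= (C ^+ 5)%:E)%E.
Proof.
have M0 := mass_gt0 S (lev_side_gt0 (setting_grid S) m x).
have mB : measurable [set y : X | supdist x y < 2 ^ m].
  have := measurable_xsection (x : X) (measurable_supdist_lt (n := n) (pow2_gt0 R m)).
  by congr measurable; apply/seteqP; split => y; rewrite /xsection/= inE.
rewrite (eq_integral (fun y : X => ((mass (lev m x))^-1)%:E *
    (\1_[set y : X | (supdist x y < 2 ^ m)%R] y : R)%:E)%E); last first.
  by move=> y _; rewrite -EFinM /near_kernel mulrC; congr ((_ * _)%:E).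
rewrite ge0_integralZl//; last 2 first.
- by apply/measurable_EFinP; exact: measurable_indic.
- by rewrite lee_fin invr_ge0 ltW.
rewrite integral_indic// setIT.
apply: (@le_trans _ _ (((mass (lev m x))^-1)%:E * (C ^+ 5 * mass (lev m x))%:E)%E).
  by apply: lee_wpmul2l; [rewrite lee_fin invr_ge0 ltW|exact: (mu_supball_le S)].
by rewrite -EFinM lee_fin mulrCA mulVf ?mulr1// gt_eqF.
Qed.

Lemma near_kernel_sym m x y : near_kernel m x y <= C ^+ 7 * near_kernel m y x.
Proof.
have M0 z := mass_gt0 S (lev_side_gt0 (setting_grid S) m z).
rewrite /near_kernel !indicE.
have [/set_mem xy|xy] := boolP ((x, y) \in near_set m); last first.
  by rewrite mul0r mulr_ge0 ?(C_exp_ge0 S)// divr_ge0 ?ler0n// ltW.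
have yx : near_set m (y, x) by rewrite /near_set/= supdistC.
rewrite mem_set// !mul1r ler_pdivlMr// mulrC ler_pdivrMr//.
by apply: (mass_lev_near S); exact: yx.
Qed.

(** Schur's test: by symmetry up to a constant, the row bound is also a column
    bound. *)
Lemma near_kernel_schur m h : measurable_fun [set: X] h -> (forall x, 0 <= h x) ->
  (\int[mu]_x \int[mu]_y ((h x + h y) * near_kernel m x y)%:E <=
    (C ^+ 5 + C ^+ 12)%:E * \int[mu]_x (h x)%:E)%E.
Proof.
move=> mh h0; have mnk := measurable_near_kernel m.
have nk0 := near_kernel_ge0 m.
have mk1 : measurable_fun [set: X * X] (fun p : X * X => (h p.1 * near_kernel m p.1 p.2)%:E).
  apply/measurable_EFinP; apply: measurable_funM => //.
  by apply: (measurableT_comp mh); exact: measurable_fst.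
have mk2 : measurable_fun [set: X * X] (fun p : X * X => (h p.2 * near_kernel m p.1 p.2)%:E).
  apply/measurable_EFinP; apply: measurable_funM => //.
  by apply: (measurableT_comp mh); exact: measurable_snd.
have mk3 : measurable_fun [set: X * X]
    (fun p : X * X => ((C ^+ 7)%:E * (h p.1 * near_kernel m p.1 p.2)%:E)%E).
  exact: emeasurable_funM.
have hk0 x y z : (0 <= (h z * near_kernel m x y)%:E)%E by rewrite lee_fin mulr_ge0.
have row : (\int[mu]_x \int[mu]_y (h x * near_kernel m x y)%:E <=
    (C ^+ 5)%:E * \int[mu]_x (h x)%:E)%E.
  rewrite -ge0_integralZl//; last 3 first.
  - exact/measurable_EFinP.
  - by move=> x _; rewrite lee_fin.
  - by rewrite lee_fin (C_exp_ge0 S).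
  apply: ge0_le_integral => //.
  - by move=> x _; apply: integral_ge0.
  - exact: (measurable_inner sf (F := fun x y => (h x * near_kernel m x y)%:E)).
  - by apply: emeasurable_funM => //; exact/measurable_EFinP.
  - move=> x _; under eq_integral do rewrite EFinM.
    rewrite ge0_integralZl//; last 3 first.
    + by apply/measurable_EFinP; exact: (measurable_fun_pair2 x mnk).
    + by move=> y _; rewrite lee_fin.
    + by rewrite lee_fin.
    rewrite muleC; apply: lee_wpmul2r; first by rewrite lee_fin.
    exact: near_kernel_row.
have -> : (\int[mu]_x \int[mu]_y ((h x + h y) * near_kernel m x y)%:E =
    \int[mu]_x \int[mu]_y ((h x * near_kernel m x y)%:E + (h y * near_kernel m x y)%:E))%E.
  by apply: eq_integral => x _; apply: eq_integral => y _; rewrite mulrDl EFinD.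
rewrite (iteratedD sf mk1 mk2)// EFinD ge0_muleDl ?lee_fin ?(C_exp_ge0 S)//.
apply: leeD => //.
rewrite (swap_integrals sf (F := fun x y => (h y * near_kernel m x y)%:E))//.
apply: (@le_trans _ _ (\int[mu]_x \int[mu]_y ((C ^+ 7)%:E * (h x * near_kernel m x y)%:E))%E).
  apply: (le_iterated sf (F := fun x y => (h x * near_kernel m y x)%:E)).
  - apply/measurable_EFinP; apply: measurable_funM.
      by apply: (measurableT_comp mh); exact: measurable_fst.
    exact: (measurableT_comp mnk (@measurable_swap _ _ X X)).
  - exact: mk3.
  - by move=> x y.
  - move=> x y; rewrite -EFinM lee_fin [leRHS]mulrCA; apply: ler_wpM2l => //; exact: near_kernel_sym.
rewrite (iteratedZ sf mk1)// ?(C_exp_ge0 S)//.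
have -> : (C ^+ 12)%:E = ((C ^+ 7)%:E * (C ^+ 5)%:E)%E by rewrite -EFinM -exprD.
by rewrite -muleA; apply: lee_wpmul2l => //; rewrite lee_fin (C_exp_ge0 S).
Qed.

Lemma L2_int_sqr_sub f g g' : L2 mu f -> L2 mu g -> L2 mu g' ->
  (\int[mu]_x ((g x - g' x) ^+ 2)%:E <=
   2%:E * \int[mu]_x ((f x - g x) ^+ 2)%:E + 2%:E * \int[mu]_x ((f x - g' x) ^+ 2)%:E)%E.
Proof.
move=> fL gL g'L.
have := integral_young mu measurableT (L2_measurable (L2N (L2B fL gL)))
  (L2_measurable (L2B fL g'L)) (ltr01 : 0 < 1 :> R).
rewrite invr1 (_ : 1 + 1 = 2 :> R)//.
rewrite (eq_integral (fun x : X => ((g x - g' x) ^+ 2)%:E)); last first.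
  by move=> x _; congr ((_ ^+ 2)%:E); ring.
by under [X in (_ <= 2%:E * X + _)%E -> _]eq_integral do rewrite sqrrN.
Qed.

(** The two ingredients of the telescoping sum: a difference of consecutive
    projections is controlled by the errors of these, while the last projection
    is controlled by [f] itself, with a factor that tends to [0]. *)
Lemma gen_proj_variation : exists2 K : R, 0 <= K &
  forall m (i : nat) f, L2 mu f ->
  (exists h, [/\ measurable_fun [set: X] h, forall x, 0 <= h x,
    forall x y, supdist x y < 2 ^ m ->
      ((gen_proj (m + i%:Z) f x - gen_proj (m + i.+1%:Z) f x) -
       (gen_proj (m + i%:Z) f y - gen_proj (m + i.+1%:Z) f y)) ^+ 2 <= h x + h y &
    (\int[mu]_x (h x)%:E <= (K * lam ^+ i)%:E * gen_err (m + i.+1%:Z) f)%E]) /\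
  (exists h, [/\ measurable_fun [set: X] h, forall x, 0 <= h x,
    forall x y, supdist x y < 2 ^ m ->
      (gen_proj (m + i%:Z) f x - gen_proj (m + i%:Z) f y) ^+ 2 <= h x + h y &
    (\int[mu]_x (h x)%:E <= (K * lam ^+ i)%:E * \int[mu]_x ((f x) ^+ 2)%:E)%E]).
Proof.
have [K K0 hK] := piecewise_polynomial_variation.
have lam0 := layer_rate_gt0 S.
exists (K * 4); first exact: mulr_ge0.
move=> m i f fL; have KL : 0 <= K * lam ^+ i by rewrite mulr_ge0// exprn_ge0// ltW.
have pL j := L2_proj S kappa j fL.
have final (I J : \bar R) : (0 <= J)%E -> (I <= 2%:E * J + 2%:E * J)%E ->
    ((K * lam ^+ i)%:E * I <= (K * 4 * lam ^+ i)%:E * J)%E.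
  move=> J0 IJ; apply: (@le_trans _ _ ((K * lam ^+ i)%:E * (4%:E * J))%E).
    apply: lee_wpmul2l; first by rewrite lee_fin.
    apply: le_trans IJ _; rewrite -ge0_muleDl// ?lee_fin//.
    by rewrite -EFinD (_ : 2 + 2 = 4 :> R)// -natrD.
  by rewrite muleA -EFinM mulrAC.
split.
- pose p Q x := pol Q f x - pol (lev (m + i.+1%:Z) Q.1) f x.
  have pp Q : polyfun kappa (p Q) by apply: polyfunB; exact: pol_polyfun.
  have pE x : p (lev (m + i%:Z) x) x = gen_proj (m + i%:Z) f x - gen_proj (m + i.+1%:Z) f x.
    rewrite /p /gen_proj; congr (_ - pol _ f x).
    apply: (lev_mono (setting_dim S) (m := m + i%:Z)); first by rewrite lerD2l lez_nat.
    by apply: lev_meq; apply: corner_mem; exact: lev_side_gt0.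
  have [h [mh h0 hxy hint]] := hK (m + i%:Z) p i pp.
  exists h; split => //; first by move=> x y xy; rewrite -!pE; apply: hxy; rewrite addrK.
  apply: le_trans hint _; apply: final; first exact: gen_err_ge0.
  under eq_integral do rewrite pE.
  apply: le_trans (L2_int_sqr_sub fL (pL (m + i%:Z)) (pL (m + i.+1%:Z))) _.
  apply: leeD => //; apply: lee_wpmul2l => //.
  by apply: (gen_err_mono S) => //; rewrite lerD2l lez_nat.
- have [h [mh h0 hxy hint]] := hK (m + i%:Z) (fun Q => pol Q f) i (fun Q => pol_polyfun S kappa Q f).
  exists h; split => //; first by move=> x y xy; apply: hxy; rewrite addrK.
  apply: le_trans hint _; apply: final; first by apply: integral_ge0 => x _; rewrite lee_fin sqr_ge0.
  have := L2_int_sqr_sub fL (pL (m + i%:Z)) (L2_0 mu).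
  under eq_integral do rewrite subr0.
  under [X in (_ <= _ + 2%:E * X)%E -> _]eq_integral do rewrite subr0.
  move=> h1; apply: le_trans h1 _; apply: leeD => //; apply: lee_wpmul2l => //.
  exact: gen_err_le_sqr.
Qed.

Definition near_energy m f : \bar R :=
  (\int[mu]_x \int[mu]_y ((f x - f y) ^+ 2 * near_kernel m x y)%:E)%E.

Lemma measurable_near_energy m f : measurable_fun [set: X] f ->
  measurable_fun [set: X * X]
    (fun p : X * X => ((f p.1 - f p.2) ^+ 2 * near_kernel m p.1 p.2)%:E).
Proof.
move=> mf; apply/measurable_EFinP; apply: measurable_funM.
- exact: measurable_sqdiff.
- exact: measurable_near_kernel.
Qed.

(** The terms of the telescoping sum of [f] from generation [m] upwards. *)
Definition increment m f (k : nat) : X -> R :=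
  if k is i.+1 then gen_proj (m + i%:Z) f \- gen_proj (m + i.+1%:Z) f
  else f \- gen_proj m f.

Lemma increment_sum m f N x :
  \sum_(k < N.+1) increment m f k x = f x - gen_proj (m + N%:Z) f x.
Proof.
elim: N => [|N IH]; first by rewrite big_ord1 addr0.
by rewrite big_ord_recr/= IH addrA subrK.
Qed.

Lemma increment_variation : exists2 K : R, 0 <= K &
  forall m f, L2 mu f -> forall k : nat,
  exists h, [/\ measurable_fun [set: X] h, forall x, 0 <= h x,
    forall x y, supdist x y < 2 ^ m ->
      (increment m f k x - increment m f k y) ^+ 2 <= h x + h y &
    (\int[mu]_x (h x)%:E <= (K * lam ^+ k)%:E * gen_err (m + k%:Z) f)%E].
Proof.
have [K K0 hK] := gen_proj_variation.
have lam0 := layer_rate_gt0 S.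
exists (2 + K / lam); first by rewrite addr_ge0// divr_ge0// ltW.
move=> m f fL [|i].
- exists (fun x => 2 * increment m f 0 x ^+ 2); split.
  + apply: measurable_funM => //; apply: measurable_funX.
    exact: L2_measurable (L2B fL (L2_proj S kappa m fL)).
  + by move=> x; rewrite mulr_ge0// sqr_ge0.
  + move=> x y _; move: (increment _ _ _ x) (increment _ _ _ y) => a b.
    have := sqr_ge0 (a + b); lra.
  + under eq_integral do rewrite EFinM.
    rewrite addr0 expr0 mulr1 ge0_integralZl//; last 2 first.
    * apply/measurable_EFinP; apply: measurable_funX.
      exact: L2_measurable (L2B fL (L2_proj S kappa m fL)).
    * by move=> x _; rewrite lee_fin sqr_ge0.
    apply: lee_wpmul2r; first exact: gen_err_ge0.
    by rewrite lee_fin lerDl divr_ge0// ltW.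
- have [[h [mh h0 hxy hint]] _] := hK m i f fL.
  exists h; split => //; apply: le_trans hint _.
  apply: lee_wpmul2r; first exact: gen_err_ge0.
  rewrite lee_fin exprS mulrA ler_wpM2r ?exprn_ge0 ?(ltW lam0)//.
  by rewrite mulrDl divfK ?gt_eqF// lerDr mulr_ge0// ltW.
Qed.

Lemma le_add_geometric (a b : \bar R) (c q : R) : 0 <= q < 1 ->
  (forall N : nat, (a <= b + (c * q ^+ N)%:E)%E) -> (a <= b)%E.
Proof.
move=> /andP[q0 q1] h; apply/lee_addgt0Pr => e e0.
have q1' : `|q| < 1 by rewrite ger0_norm.
have /cvgrPdist_lt /(_ e e0) [N _ /(_ N (leqnn N))] := cvg_geometric c q1'.
rewrite /geometric/= sub0r normrN => hN.
apply: le_trans (h N) _; apply: leeD => //.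
by rewrite lee_fin; apply: le_trans (ler_norm _) (ltW hN).
Qed.

(** Schur's test applied to the telescoping sum, after the Cauchy-Schwarz
    inequality with the weights [theta ^+ k]. The last projection of the sum
    disappears in the limit, because [lam < 1]. *)
Lemma near_energy_le (theta : R) : 1 < theta -> exists2 K : R, 0 <= K &
  forall m f, L2 mu f ->
  (near_energy m f <=
    K%:E * \esum_(k in [set: nat]) (((theta * lam) ^+ k)%:E * gen_err (m + k%:Z) f))%E.
Proof.
move=> t1; have t0 : 0 < theta by lra.
have [K1 K10 hK1] := increment_variation.
have [K2 K20 hK2] := gen_proj_variation.
have lam0 := layer_rate_gt0 S; have /andP[_ lam1] := layer_rate_itv S.
pose ct := (1 - theta^-1)^-1.
have ct0 : 0 <= ct by rewrite invr_ge0 subr_ge0 ltW// invf_lt1.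
pose c5 := C ^+ 5 + C ^+ 12.
have c50 : 0 <= c5 by rewrite addr_ge0 ?(C_exp_ge0 S).
have c2t0 : 0 <= 2 * ct by rewrite mulr_ge0.
exists (c5 * (2 * ct * K1)); first by rewrite !mulr_ge0.
move=> m f fL; have mf := L2_measurable fL.
have [hh hhP] := choice (hK1 m f fL).
set E := (\esum_(k in _) _)%E.
have [I fI'] : exists c : R, (\int[mu]_x ((f x) ^+ 2)%:E = c%:E)%E.
  exists (fine (\int[mu]_x ((f x) ^+ 2)%:E)%E); rewrite fineK// ge0_fin_numE.
    by case: fL.
  by apply: integral_ge0 => x _; rewrite lee_fin sqr_ge0.
apply: (@le_add_geometric _ _ (c5 * 2 * K2 * I) lam).
  by rewrite (ltW lam0).
move=> N; have [_ [r [mr r0 rxy rint]]] := hK2 m N f fL.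
pose H x : R := 2 * ct * (\sum_(k < N.+1) theta ^+ k * hh k x) + 2 * r x.
have hh0 k x : 0 <= hh k x by have [_ + _ _] := hhP k; apply.
have mhh k : measurable_fun [set: X] (hh k) by have [] := hhP k.
have th0 k x : 0 <= theta ^+ k * hh k x by rewrite mulr_ge0// exprn_ge0// ltW.
have mth k : measurable_fun [set: X] (fun x => theta ^+ k * hh k x).
  exact: measurable_funM.
have H0 x : 0 <= H x.
  by rewrite addr_ge0 ?mulr_ge0// ?sumr_ge0.
have mH : measurable_fun [set: X] H.
  apply: measurable_funD; apply: measurable_funM => //.
  by apply: measurable_sum => k.
have Hxy x y : supdist x y < 2 ^ m -> (f x - f y) ^+ 2 <= H x + H y.
  move=> xy; have e1 := increment_sum m f N x; have e2 := increment_sum m f N y.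
  have := rxy x y xy.
  have := weighted_cauchy_schwarz (fun k => increment m f k x - increment m f k y) N.+1 t1.
  rewrite sumrB e1 e2 -/ct.
  set A := (f x - gen_proj (m + N%:Z) f x) - _; set B := gen_proj (m + N%:Z) f x - _.
  have -> : f x - f y = A + B by rewrite /A /B; ring.
  move=> hA hB.
  have hs : \sum_(k < N.+1) theta ^+ k * (increment m f k x - increment m f k y) ^+ 2 <=
      \sum_(k < N.+1) theta ^+ k * hh k x + \sum_(k < N.+1) theta ^+ k * hh k y.
    rewrite -big_split/=; apply: ler_sum => k _; rewrite -mulrDr.
    apply: ler_wpM2l; first by rewrite exprn_ge0// ltW.
    by have [_ _ + _] := hhP k; apply.
  have {hs hA} := le_trans hA (ler_wpM2l ct0 hs).
  have := sqr_ge0 (A - B); rewrite /H.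
  move: (\sum_(k < N.+1) theta ^+ k * hh k x) (\sum_(k < N.+1) theta ^+ k * hh k y) => u v.
  by clearbody A B ct; move: (r x) (r y) hB => r1 r2; clear; lra.
have Hint : (\int[mu]_x (H x)%:E <=
    (2 * ct * K1)%:E * E + (2 * K2 * I * lam ^+ N)%:E)%E.
  have -> : (\int[mu]_x (H x)%:E = (2 * ct)%:E * \int[mu]_x
      (\sum_(k < N.+1) theta ^+ k * hh k x)%:E + 2%:E * \int[mu]_x (r x)%:E)%E.
    rewrite -ge0_integralZl//; last 2 first.
    - by apply/measurable_EFinP; apply: measurable_sum => k.
    - by move=> x _; rewrite lee_fin sumr_ge0.
    rewrite -ge0_integralZl//; last 2 first.
    - exact/measurable_EFinP.
    - by move=> x _; rewrite lee_fin.
    rewrite -ge0_integralD//.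
    - by move=> x _; rewrite mule_ge0 ?lee_fin ?sumr_ge0.
    - apply: emeasurable_funM => //.
      by apply/measurable_EFinP; apply: measurable_sum => k.
    - by move=> x _; rewrite mule_ge0 ?lee_fin.
    - by apply: emeasurable_funM => //; exact/measurable_EFinP.
  apply: leeD.
    rewrite [in leRHS]EFinM -muleA; apply: lee_wpmul2l; first by rewrite lee_fin.
    under eq_integral do rewrite -sumEFin.
    rewrite ge0_integral_sum//; last 2 first.
    - by move=> k; apply/measurable_EFinP.
    - by move=> k x _; rewrite lee_fin.
    rewrite /E -esumZl//; last first.
      by move=> k; rewrite mule_ge0 ?gen_err_ge0 ?lee_fin ?exprn_ge0// mulr_ge0 ?ltW.
    apply: (@le_trans _ _ (\sum_(k < N.+1) (K1%:E *
        (((theta * lam) ^+ k)%:E * gen_err (m + k%:Z) f)))%E).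
      apply: lee_sum => k _.
      under eq_integral do rewrite EFinM.
      rewrite ge0_integralZl//; last 3 first.
      + exact/measurable_EFinP.
      + by move=> x _; rewrite lee_fin.
      + by rewrite lee_fin exprn_ge0// ltW.
      have [_ _ _ hint] := hhP k.
      apply: (@le_trans _ _ ((theta ^+ k)%:E * ((K1 * lam ^+ k)%:E * gen_err (m + k%:Z) f))%E).
        by apply: lee_wpmul2l => //; rewrite lee_fin exprn_ge0// ltW.
      by rewrite !muleA -!EFinM exprMn mulrCA mulrA.
    rewrite -(big_mkord xpredT (fun k => (K1%:E *
        (((theta * lam) ^+ k)%:E * gen_err (m + k%:Z) f))%E)).
    have t0k k : (0 <= K1%:E * (((theta * lam) ^+ k)%:E * gen_err (m + k%:Z) f))%E.
      by rewrite !mule_ge0 ?gen_err_ge0 ?lee_fin ?exprn_ge0// mulr_ge0 ?ltW.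
    by rewrite -nneseries_esumT//; exact: nneseries_lim_ge.
  have -> : (2 * K2 * I * lam ^+ N)%:E = (2%:E * ((K2 * lam ^+ N)%:E * I%:E))%E.
    by rewrite -!EFinM; congr EFin; ring.
  by apply: lee_wpmul2l => //; rewrite -fI'.
have e0 : (0 <= E)%E.
  by apply: esum_ge0 => k _; rewrite mule_ge0 ?gen_err_ge0 ?lee_fin ?exprn_ge0// mulr_ge0 ?ltW.
have I0 : 0 <= I.
  by rewrite -lee_fin -fI'; apply: integral_ge0 => x _; rewrite lee_fin sqr_ge0.
apply: (@le_trans _ _ (c5%:E * \int[mu]_x (H x)%:E)%E).
  apply: le_trans (near_kernel_schur m mH H0).
  apply: (le_iterated sf).
  - exact: measurable_near_energy.
  - apply/measurable_EFinP; apply: measurable_funM; last exact: measurable_near_kernel.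
    apply: measurable_funD.
    + by apply: (measurableT_comp mH); exact: measurable_fst.
    + by apply: (measurableT_comp mH); exact: measurable_snd.
  - by move=> x y; rewrite lee_fin mulr_ge0 ?sqr_ge0 ?near_kernel_ge0.
  - move=> x y; rewrite lee_fin.
    have [xy|xy] := pselect (supdist (x : 'rV[R]_n) y < 2 ^ m).
      by apply: ler_wpM2r; [exact: near_kernel_ge0|exact: Hxy].
    have -> : near_kernel m x y = 0 by rewrite /near_kernel indicE memNset// mul0r.
    by rewrite !mulr0.
apply: (@le_trans _ _ (c5%:E * ((2 * ct * K1)%:E * E + (2 * K2 * I * lam ^+ N)%:E))%E).
  by apply: lee_wpmul2l => //; rewrite lee_fin.
rewrite ge0_muleDr ?mule_ge0 ?lee_fin ?mulr_ge0 ?exprn_ge0 ?(ltW lam0)//.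
rewrite muleA -!EFinM; apply: leeD => //.
by rewrite lee_fin le_eqVlt; apply/orP; left; apply/eqP; ring.
Qed.

Variable s : R.
Hypothesis s0 : 0 < s.
Local Notation weight := (weight s).
Local Notation ratio := (ratio s).
Local Notation kernel := (kernel mu s).

(** For [2 ^ (m - 1) <= supdist x y < 2 ^ m], the ball has radius
    [r >= 2 ^ m / 4] and the points of the cube are within [3 / 2 * 2 ^ m] of its
    centre, which is at most [6 * r]; this gives the exponent of [C]. *)
Lemma kernel_le x y : x != y -> exists m,
  kernel x y <= ratio * C ^+ (2 * (7 * n)).+1 * (weight m * near_kernel m x y).
Proof.
move=> xy; have d0 := supdist_gt0 xy; have e0 := enorm_gt0 xy.
have [m /andP[h1 h2]] := dyadic_scale d0; exists m.
have p0 := pow2_gt0 R m; have p1 : 2 ^ m = 2 * 2 ^ (m - 1) :> R by exact: (pow2_nat R m 1).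
have ed := supdist_le_enorm x y.
set c := 2^-1 *: (x + y); set r := enorm (x - y) / 2.
have r0 : 0 < r by rewrite divr_gt0.
have B0 := ball_mass_gt0 S c r0; set B := ball_mass mu c r in B0.
have M0 := mass_gt0 S (lev_side_gt0 (setting_grid S) m x).
have bm : mass (lev m x) <= C ^+ (2 * (7 * n)).+1 * B.
  apply: (mass_le_ball S (N := 6)) => //; first exact: lev_side_gt0.
  move=> z zQ i; have xQ := lev_mem (setting_grid S) m x.
  have := zQ i; have := xQ i; rewrite lev_side => /andP[? ?] /andP[? ?].
  have xyi := coord_le_supdist x y i.
  have : r * 4 >= 2 ^ m by rewrite /r; lra.
  rewrite !mxE => ?.
  have : `|x 0 i - y 0 i| <= 2 ^ m by apply: le_trans xyi (ltW h2).
  rewrite !ler_norml => /andP[? ?]; apply/andP; split; lra.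
have nk : near_kernel m x y = (mass (lev m x))^-1.
  by rewrite /near_kernel indicE mem_set ?mul1r.
have bi : B^-1 <= C ^+ (2 * (7 * n)).+1 * near_kernel m x y.
  by rewrite nk ler_pdivlMr// mulrC ler_pdivrMr.
have ew : ((enorm (x - y) `^ s) ^+ 2)^-1 <= ratio * weight m.
  have -> : (enorm (x - y) `^ s) ^+ 2 = enorm (x - y) `^ (2 * s).
    by rewrite -powR_mulrn ?powR_ge0// -powRrM mulrC.
  rewrite (weight_shift s m 1) expr1 mulrA mulfV ?gt_eqF ?ratio_gt0// mul1r.
  have q0 := pow2_gt0 R (m - 1).
  rewrite /weight powRN lef_pV2 ?posrE ?powR_gt0//.
  apply: ge0_ler_powR.
  - by rewrite mulr_ge0// ltW.
  - by rewrite nnegrE ltW.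
  - by rewrite nnegrE ltW.
  - exact: le_trans h1 ed.
rewrite mulrACA; apply: ler_pM => //; rewrite invr_ge0 ?sqr_ge0//.
exact: ltW.
Qed.

(** The decay [lam] of the layers must beat the growth [ratio] of the weights,
    with some room left for the weight [theta > 1] of the Cauchy-Schwarz
    inequality: [theta] is chosen such that [theta * lam * ratio] is halfway
    between [lam * ratio] and [1]. *)
Lemma sobolev_le_diff : lam * ratio < 1 -> exists2 K : R, 0 <= K &
  forall f, L2 mu f -> (sobolev_energy mu s f <= K%:E * diff_energy S kappa s f)%E.
Proof.
move=> lr1; have lam0 := layer_rate_gt0 S; have r0 := ratio_gt0 s.
have lr0 : 0 < lam * ratio by rewrite mulr_gt0.
pose theta := (1 + (lam * ratio)^-1) / 2.
have il : 1 < (lam * ratio)^-1 by rewrite invf_gt1.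
have t1 : 1 < theta by rewrite /theta; lra.
have t0 : 0 < theta by lra.
have tl0 : 0 <= theta * lam by rewrite mulr_ge0 ?ltW.
pose q := theta * lam * ratio.
have q01 : 0 <= q < 1.
  rewrite mulr_ge0 ?(ltW r0)//= /q.
  have -> : theta * lam * ratio = (lam * ratio + 1) / 2.
    by rewrite /theta -mulrA mulrAC mulrDl mul1r mulVf ?gt_eqF.
  by lra.
have [K K0 hK] := near_energy_le t1.
pose Kw := ratio * C ^+ (2 * (7 * n)).+1.
have Kw0 : 0 <= Kw by rewrite mulr_ge0 ?(ltW r0) ?(C_exp_ge0 S).
exists (Kw * (K * (1 - q)^-1)).
  have /andP[_ q1] := q01; apply: mulr_ge0 => //; apply: mulr_ge0 => //.
  by rewrite invr_ge0 subr_ge0 ltW.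
move=> f fL; have mf := L2_measurable fL.
have w0 m : 0 <= weight m := weight_ge0 s m.
pose G m x y := ((weight m)%:E * ((f x - f y) ^+ 2 * near_kernel m x y)%:E)%E.
have nk0 m x y : (0 <= ((f x - f y) ^+ 2 * near_kernel m x y)%:E)%E.
  by rewrite lee_fin mulr_ge0 ?sqr_ge0 ?near_kernel_ge0.
have G0 m x y : (0 <= G m x y)%E by rewrite mule_ge0// lee_fin.
have mG m : measurable_fun [set: X * X] (fun p : X * X => G m p.1 p.2).
  by apply: emeasurable_funM => //; exact: measurable_near_energy.
have cint : countable [set: int] by [].
apply: (@le_trans _ _ (\int[mu]_x \int[mu]_y (Kw%:E * \esum_(m in [set: int]) G m x y))%E).
  apply: (le_iterated sf (F := fun x y => ((f x - f y) ^+ 2 * kernel x y)%:E)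
    (G := fun x y => (Kw%:E * \esum_(m in [set: int]) G m x y)%E)).
  - exact: (measurable_sobolev S s mf).
  - by apply: emeasurable_funM => //; exact: measurable_esum.
  - by move=> x y; rewrite lee_fin mulr_ge0 ?sqr_ge0 ?kernel_ge0.
  move=> x y; have [->|xy] := eqVneq x y.
    rewrite subrr expr0n mul0r mule_ge0 ?lee_fin//; exact: esum_ge0.
  have [m hm] := kernel_le xy.
  apply: (@le_trans _ _ (Kw%:E * G m x y)%E).
    rewrite /G -!EFinM lee_fin.
    have -> : Kw * (weight m * ((f x - f y) ^+ 2 * near_kernel m x y)) =
        (f x - f y) ^+ 2 * (Kw * (weight m * near_kernel m x y)) by ring.
    by apply: ler_wpM2l => //; rewrite sqr_ge0.
  apply: lee_wpmul2l; first by rewrite lee_fin.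
  rewrite -[leLHS](esum_set1 (t := m) (a := fun m => G m x y))//.
  by rewrite [leLHS]esum_mkcond; apply: le_esum => j _; case: ifP.
rewrite (iteratedZ sf)//; last 2 first.
- exact: measurable_esum.
- by move=> x y; exact: esum_ge0.
rewrite (iterated_esum sf cint mG G0) [in leRHS]EFinM -muleA.
apply: lee_wpmul2l; first by rewrite lee_fin.
rewrite EFinM -muleA.
apply: (@le_trans _ _ (K%:E * \esum_(m in [set: int]) \esum_(k in [set: nat])
   ((q ^+ k)%:E * ((weight (m + k%:Z))%:E * gen_err (m + k%:Z) f)))%E); last first.
  apply: lee_wpmul2l; first by rewrite lee_fin.
  apply: (esum_convolution (fun k => k%:Z) (F := fun m => ((weight m)%:E * gen_err m f)%E)) => //.
  by move=> m; rewrite mule_ge0 ?lee_fin ?gen_err_ge0.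
rewrite -esumZl//; last first.
  move=> m; apply: esum_ge0 => k _.
  by have /andP[q0 _] := q01; rewrite !mule_ge0 ?lee_fin ?exprn_ge0 ?gen_err_ge0.
apply: le_esum => m _.
rewrite (iteratedZ sf (measurable_near_energy m mf) (nk0 m) (w0 m)).
apply: (@le_trans _ _ ((weight m)%:E * (K%:E * \esum_(k in [set: nat])
  (((theta * lam) ^+ k)%:E * gen_err (m + k%:Z) f)))%E).
  by apply: lee_wpmul2l; [rewrite lee_fin|exact: hK].
rewrite muleCA; apply: lee_wpmul2l; first by rewrite lee_fin.
rewrite -esumZl//; last first.
  by move=> k; rewrite mule_ge0 ?lee_fin ?exprn_ge0 ?gen_err_ge0.
apply: le_esum => k _.
rewrite !muleA -!EFinM (weight_shift s (m + k%:Z) k) addrK /q.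
have rk : ratio ^+ k != 0 by rewrite expf_neq0// gt_eqF.
rewrite le_eqVlt; apply/orP; left; apply/eqP; congr (_%:E * _)%E.
by rewrite [in RHS]exprMn !mulrA mulfK// mulrC.
Qed.

End SobolevLeDiff.

(** * The three norms satisfy the triangle inequality *)

Section Triangle.
Context (R : realType) (n : nat).
Variables (mu : {measure set (borelRn R n) -> \bar R}) (C : R).
Variable (D : set (cube R n)).
Hypothesis S : doubling_setting mu C D.
Variables (kappa : nat) (s : R).
Local Notation X := (borelRn R n).
Local Notation lev := (lev (setting_grid S)).
Local Notation sf := (setting_sigma_finite S).
Local Notation gen_err := (gen_err S kappa).
Local Notation gen_proj := (gen_proj S kappa).
Local Notation gen_alpert := (gen_alpert mu D kappa).
Local Notation pol := (pol S kappa).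
Implicit Types (x y : 'rV[R]_n) (m : int) (Q : cube R n) (f g h : X -> R) (t : R).

Lemma sobolev_young t f g : 0 < t -> L2 mu f -> L2 mu g ->
  (sobolev_energy mu s f <= (1 + t)%:E * sobolev_energy mu s g +
    (1 + t^-1)%:E * sobolev_energy mu s (f \- g)%R)%E.
Proof.
move=> t0 fL gL; have [mf mg] := (L2_measurable fL, L2_measurable gL).
have md : measurable_fun [set: X] (f \- g) by exact: measurable_funB.
have c1 : 0 <= 1 + t by rewrite addr_ge0// ltW.
have c2 : 0 <= 1 + t^-1 by rewrite addr_ge0// invr_ge0 ltW.
have k0 h x y : (0 <= ((h x - h y) ^+ 2 * kernel mu s x y)%:E)%E.
  by rewrite lee_fin mulr_ge0 ?sqr_ge0 ?kernel_ge0.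
have mk h := @measurable_sobolev _ _ mu C D S s h.
have mZ (c : R) h : measurable_fun [set: X] h -> measurable_fun [set: X * X]
    (fun p : X * X => c%:E * ((h p.1 - h p.2) ^+ 2 * kernel mu s p.1 p.2)%:E)%E.
  by move=> mh; apply: emeasurable_funM => //; exact: mk.
rewrite /sobolev_energy -(iteratedZ sf (mk _ mg) (k0 g) c1).
rewrite -(iteratedZ sf (mk _ md) (k0 (f \- g)) c2).
rewrite -(iteratedD sf (mZ (1 + t) _ mg) (mZ (1 + t^-1) _ md)); last 2 first.
- by move=> x y; apply: mule_ge0; [rewrite lee_fin|exact: k0].
- by move=> x y; apply: mule_ge0; [rewrite lee_fin|exact: (k0 (f \- g))].
apply: (le_iterated sf (mk _ mf) (G := fun x y =>
  ((1 + t)%:E * ((g x - g y) ^+ 2 * kernel mu s x y)%:E +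
   (1 + t^-1)%:E * (((f \- g) x - (f \- g) y) ^+ 2 * kernel mu s x y)%:E)%E) _ (k0 f)).
  by apply: emeasurable_funD; exact: mZ.
move=> x y; have := kernel_ge0 mu s x y; move: (kernel mu s x y) => k kge0.
rewrite -!EFinM -EFinD lee_fin ![_ * (_ * k)]mulrA -mulrDl; apply: ler_wpM2r => //.
have -> : f x - f y = (g x - g y) + ((f \- g) x - (f \- g) y) by rewrite /=; ring.
exact: sqr_young.
Qed.

Lemma gen_alpert_young t m f g : 0 < t -> L2 mu f -> L2 mu g ->
  (gen_alpert m f <= (1 + t)%:E * gen_alpert m g + (1 + t^-1)%:E * gen_alpert m (f \- g)%R)%E.
Proof.
move=> t0 fL gL; have dL : L2 mu (f \- g) := L2B fL gL.
have c1 : 0 <= 1 + t by rewrite addr_ge0// ltW.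
have c2 : 0 <= 1 + t^-1 by rewrite addr_ge0// invr_ge0 ltW.
have i0 h Q : (0 <= \int[mu]_x ((alpert_proj mu D kappa Q h x) ^+ 2)%:E)%E.
  by apply: integral_ge0 => x _; rewrite lee_fin sqr_ge0.
rewrite /gen_alpert -!esumZl// -esumD; last 2 first.
- by move=> Q _; apply: mule_ge0; [rewrite lee_fin|exact: i0].
- by move=> Q _; apply: mule_ge0; [rewrite lee_fin|exact: i0].
apply: le_esum => Q GQ.
set a := alpert_proj mu D kappa Q f; set b := alpert_proj mu D kappa Q g.
set c := alpert_proj mu D kappa Q (f \- g).
have VL h : alpert_space mu D kappa Q h -> L2 mu h by exact: (alpert_L2 S GQ).
have VB h h' := @alpert_spaceB _ _ _ _ _ S kappa m Q h h' GQ.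
have aP : is_oproj mu (alpert_space mu D kappa Q) f a := alpert_projP S kappa GQ fL.
have bP : is_oproj mu (alpert_space mu D kappa Q) g b := alpert_projP S kappa GQ gL.
have cP : is_oproj mu (alpert_space mu D kappa Q) (f \- g) c := alpert_projP S kappa GQ dL.
have [aL bL cL] : [/\ L2 mu a, L2 mu b & L2 mu c].
  by split; apply: VL; [case: aP|case: bP|case: cP].
clearbody a b c.
(* The projections are only determined up to null functions, so [b] need not be
   [a \- c]; but both of them are projections of [g]. *)
have b'P : is_oproj mu (alpert_space mu D kappa Q) g (fun x => a x - c x).
  apply/(is_oprojP _ VL gL); split; first by apply: VB; [case: aP|case: cP].
  move=> h Vh; have hL := VL _ Vh.
  have [_ ea] := (is_oprojP _ VL fL).1 aP; have [_ ec] := (is_oprojP _ VL dL).1 cP.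
  have e1 : ip mu f h - ip mu a h = 0 by rewrite -ipBl ?ea.
  have e2 : ip mu f h - ip mu g h - ip mu c h = 0.
    by rewrite -(ipBl fL gL hL) -(ipBl dL cL hL) ec.
  rewrite (ipBl gL (L2B aL cL) hL) (ipBl aL cL hL).
  by move: (ip mu f h) (ip mu g h) (ip mu a h) (ip mu c h) e1 e2 => u v w z; lra.
have b'L : L2 mu (fun x => a x - c x) by exact: L2B.
have -> : (\int[mu]_x ((b x) ^+ 2)%:E = \int[mu]_x ((a x - c x) ^+ 2)%:E)%E.
  have e := is_oproj_ip VL gL VB bP b'P.
  by rewrite !ipE2// e// ipC e.
rewrite (eq_integral (fun x : X => ((a x - c x + c x) ^+ 2)%:E)); last first.
  by move=> x _; rewrite subrK.
exact: (integral_young mu measurableT (L2_measurable b'L) (L2_measurable cL) t0).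
Qed.

Let weighted_young (F G H : int -> \bar R) (a b : R) :
  0 <= a -> 0 <= b -> (forall m, 0 <= G m)%E -> (forall m, 0 <= H m)%E ->
  (forall m, F m <= a%:E * G m + b%:E * H m)%E ->
  (\esum_(m in [set: int]) ((weight s m)%:E * F m) <=
   a%:E * (\esum_(m in [set: int]) ((weight s m)%:E * G m)) +
   b%:E * (\esum_(m in [set: int]) ((weight s m)%:E * H m)))%E.
Proof.
move=> a0 b0 G0 H0 FGH; have w0 m : (0 <= (weight s m)%:E)%E.
  by rewrite lee_fin weight_ge0.
have wG m : (0 <= (weight s m)%:E * G m)%E by rewrite mule_ge0.
have wH m : (0 <= (weight s m)%:E * H m)%E by rewrite mule_ge0.
rewrite -!esumZl// -esumD; last 2 first.
- by move=> m _; apply: mule_ge0; [rewrite lee_fin|exact: wG].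
- by move=> m _; apply: mule_ge0; [rewrite lee_fin|exact: wH].
apply: le_esum => m _; apply: (@le_trans _ _ ((weight s m)%:E * (a%:E * G m + b%:E * H m))%E).
  exact: lee_wpmul2l.
by rewrite ge0_muleDr ?mule_ge0 ?lee_fin// [in leRHS]muleCA [X in (_ <= _ + X)%E]muleCA.
Qed.

Lemma norm_sobolev_triangle f g : L2 mu f -> L2 mu g ->
  (norm_sobolev mu s f <= norm_sobolev mu s g + norm_sobolev mu s (f \- g)%R)%E.
Proof.
move=> fL gL; rewrite !(norm_sobolevE S).
have e0 h : (0 <= sobolev_energy mu s h)%E.
  apply: integral_ge0 => x _; apply: integral_ge0 => y _.
  by rewrite lee_fin mulr_ge0 ?sqr_ge0 ?kernel_ge0.
by apply: sqrte_triangle => // t t0; exact: sobolev_young.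
Qed.

Lemma norm_diff_triangle f g : L2 mu f -> L2 mu g ->
  (norm_diff mu D kappa s f <= norm_diff mu D kappa s g + norm_diff mu D kappa s (f \- g)%R)%E.
Proof.
move=> fL gL; have dL : L2 mu (f \- g) := L2B fL gL.
rewrite !(norm_diffE S)//.
have e0 h : (0 <= diff_energy S kappa s h)%E.
  by apply: esum_ge0 => m _; rewrite mule_ge0 ?gen_err_ge0 ?lee_fin ?weight_ge0.
apply: sqrte_triangle => // t t0; apply: weighted_young.
- by rewrite addr_ge0// ltW.
- by rewrite addr_ge0// invr_ge0 ltW.
- by move=> m; exact: gen_err_ge0.
- by move=> m; exact: gen_err_ge0.
- by move=> m; exact: gen_err_young.
Qed.

Lemma norm_dyadic_triangle f g : L2 mu f -> L2 mu g ->
  (norm_dyadic mu D kappa s f <=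
    norm_dyadic mu D kappa s g + norm_dyadic mu D kappa s (f \- g)%R)%E.
Proof.
move=> fL gL; rewrite !(norm_dyadicE S).
have e0 h : (0 <= dyadic_energy mu D kappa s h)%E.
  by apply: esum_ge0 => m _; rewrite mule_ge0 ?gen_alpert_ge0 ?lee_fin ?weight_ge0.
apply: sqrte_triangle => // t t0; apply: weighted_young.
- by rewrite addr_ge0// ltW.
- by rewrite addr_ge0// invr_ge0 ltW.
- by move=> m; exact: gen_alpert_ge0.
- by move=> m; exact: gen_alpert_ge0.
- by move=> m; exact: gen_alpert_young.
Qed.

End Triangle.

(** * Completions for comparable norms *)

Section Completions.
Context (R : realType) (n : nat).
Variable mu : {measure set (borelRn R n) -> \bar R}.
Local Notation X := (borelRn R n).
Implicit Types (N : (X -> R) -> \bar R) (f g : X -> R) (u v : nat -> 'rV[R]_n -> R).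

Record seminorm N : Prop := Seminorm {
  seminorm_ge0 : forall f, (0 <= N f)%E;
  seminorm_triangle : forall f g, L2 mu f -> L2 mu g ->
    (N f <= N g + N (f \- g)%R)%E }.

Definition comparable N1 N2 : Prop := exists2 K : R, 0 < K &
  forall f, L2 mu f -> (N1 f <= K%:E * N2 f)%E /\ (N2 f <= K%:E * N1 f)%E.

Lemma comparable_sym N1 N2 : comparable N1 N2 -> comparable N2 N1.
Proof. by move=> [K K0 h]; exists K => // f /h[]. Qed.

Lemma comparable_trans N1 N2 N3 :
  comparable N1 N2 -> comparable N2 N3 -> comparable N1 N3.
Proof.
move=> [K K0 h] [L L0 k]; exists (K * L); first exact: mulr_gt0.
have K0' : (0 <= K%:E)%E by rewrite lee_fin ltW.
have L0' : (0 <= L%:E)%E by rewrite lee_fin ltW.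
move=> f fL; have [h1 h2] := h f fL; have [k1 k2] := k f fL; split.
  rewrite EFinM -muleA; apply: le_trans h1 _; exact: lee_wpmul2l.
rewrite mulrC EFinM -muleA; apply: le_trans k2 _; exact: lee_wpmul2l.
Qed.

Lemma finite_energyL2 N f : finite_energy mu N f -> L2 mu f.
Proof. by move=> [/L2P]. Qed.

Lemma cauchyL2 N u k : cauchy_energy mu N u -> L2 mu (u k).
Proof. by move=> [/(_ k)/finite_energyL2]. Qed.

Lemma cauchyBL2 N u v k : cauchy_energy mu N u -> cauchy_energy mu N v ->
  L2 mu (u k \- v k).
Proof. by move=> uC vC; apply: L2B; [exact: cauchyL2 uC|exact: cauchyL2 vC]. Qed.

Lemma comparable_cauchy N1 N2 u : comparable N1 N2 ->
  cauchy_energy mu N1 u -> cauchy_energy mu N2 u.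
Proof.
move=> [K K0 h] uC; have [uf uc] := uC; split=> [k|e e0].
  have [uk Nu] := uf k; split => //.
  have [_ /le_lt_trans] := h _ (cauchyL2 k uC); apply.
  by rewrite lte_mul_pinfty// lee_fin ltW.
have [M hM] := uc (e / K) (divr_gt0 e0 K0); exists M => i j Mi Mj.
have [_ /le_lt_trans] := h _ (L2B (cauchyL2 i uC) (cauchyL2 j uC)); apply.
by rewrite muleC -lte_pdivlMr// -EFinM; exact: hM.
Qed.

Lemma comparable_cvg0 N1 N2 (w : nat -> X -> R) : seminorm N2 -> comparable N1 N2 ->
  (forall k, L2 mu (w k)) -> N1 (w k) @[k --> \oo] --> 0%E ->
  N2 (w k) @[k --> \oo] --> 0%E.
Proof.
move=> N2s [K K0 h] wL w0.
apply: (@squeeze_cvge _ _ _ _ (fun=> 0%E) _ (fun k => K%:E * N1 (w k))%E).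
- apply: nearW => k; rewrite seminorm_ge0//=.
  by have [] := h _ (wL k).
- exact: cvg_cst.
- by have := cvgeZl (isT : K%:E \is a fin_num) w0; rewrite mule0.
Qed.

Lemma comparable_class N1 N2 u : seminorm N1 -> seminorm N2 -> comparable N1 N2 ->
  cauchy_energy mu N1 u -> cauchy_class mu N1 u = cauchy_class mu N2 u.
Proof.
move=> s1 s2 c12 uC; have c21 := comparable_sym c12.
have uC2 := comparable_cauchy c12 uC.
apply/seteqP; split => v [vC v0]; split.
- exact: comparable_cauchy c12 vC.
- apply: (comparable_cvg0 (w := fun k => u k \- v k) s2 c12) => // k.
  exact: cauchyBL2 uC vC.
- exact: comparable_cauchy c21 vC.
- apply: (comparable_cvg0 (w := fun k => u k \- v k) s1 c21) => // k.
  exact: cauchyBL2 uC2 vC.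
Qed.

Lemma comparable_completion N1 N2 : seminorm N1 -> seminorm N2 ->
  comparable N1 N2 -> completion mu N1 = completion mu N2.
Proof.
move=> s1 s2 c12; have c21 := comparable_sym c12.
apply/seteqP; split => A [u uC ->]; exists u.
- exact: comparable_cauchy c12 uC.
- exact: comparable_class.
- exact: comparable_cauchy c21 uC.
- exact: comparable_class.
Qed.

Lemma cauchy_class_self N u : seminorm N -> cauchy_energy mu N u -> cauchy_class mu N u u.
Proof.
move=> Ns uC; split => //; have [_ uc] := uC.
apply/fine_cvgP; split.
  have [M hM] := uc 1 ltr01; exists M => // k /= Mk.
  by rewrite ge0_fin_numE ?seminorm_ge0//; apply: lt_trans (hM _ _ Mk Mk) (ltry _).
apply/cvgrPdist_lt => e e0; have [M hM] := uc e e0; exists M => // k /= Mk.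
have := hM _ _ Mk Mk; have := seminorm_ge0 Ns (u k \- u k).
case: (N _) => [r| |]//=; rewrite lee_fin lte_fin => r0 re.
by rewrite sub0r normrN ger0_norm.
Qed.

(** By the triangle inequality in both directions, these norms form a Cauchy
    sequence of reals. *)
Lemma cauchy_norm_cvg N u : seminorm N -> cauchy_energy mu N u ->
  cvgn (fun k => N (u k)).
Proof.
move=> Ns uC; have [uf uc] := uC.
have Nfin k : N (u k) \is a fin_num.
  by rewrite ge0_fin_numE ?seminorm_ge0//; have [_] := uf k.
have dist (e : R) i j : (N (u i \- u j)%R < e%:E)%E -> fine (N (u i)) < fine (N (u j)) + e.
  move=> he; rewrite -lte_fin EFinD !fineK//.
  apply: le_lt_trans (seminorm_triangle Ns (cauchyL2 i uC) (cauchyL2 j uC)) _.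
  by rewrite lteD2lE.
have : cvgn (fun k => fine (N (u k))).
  apply/cauchy_cvgP/cauchy_exP => e e0; have [M hM] := uc e e0.
  exists (fine (N (u M))), M => // k /= Mk; rewrite /ball/= ltr_distlC.
  have h1 := dist e k M (hM _ _ Mk (leqnn _)).
  have h2 := dist e M k (hM _ _ (leqnn _) Mk).
  by rewrite h1 andbT ltrBlDr.
move=> /(cvgP _)/cvg_ex[l /= hl]; apply/cvg_ex; exists l%:E.
by apply/fine_cvgP; split => //; exact: nearW.
Qed.

(** The norm of a class is the limit of the norms along any of its sequences;
    such a sequence is Cauchy for both norms, so that both limits exist and
    inherit the comparison of the terms. *)
Lemma comparable_equivalent N1 N2 N : seminorm N1 -> seminorm N2 -> seminorm N ->
  comparable N1 N2 -> comparable N N1 ->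
  equivalent_norms (completion mu N) (completion_norm N1) (completion_norm N2).
Proof.
move=> s1 s2 sN c12 cN; have [K K0 h] := c12; exists K => // A [u uC AE].
pose v := xget (fun _ _ => 0) A.
have Av : A v.
  by rewrite /v; apply: (xgetPex _ (P := A)); exists u; rewrite AE; exact: cauchy_class_self.
have vC : cauchy_energy mu N v by move: Av; rewrite AE => -[].
have v1 := comparable_cauchy cN vC; have v2 := comparable_cauchy c12 v1.
have cv1 := cauchy_norm_cvg s1 v1; have cv2 := cauchy_norm_cvg s2 v2.
rewrite /completion_norm -/v; split.
- rewrite -limeMl//; apply: lee_lim => //; first exact: is_cvgeZl.
  by apply: nearW => k; have [] := h _ (cauchyL2 k v1).
- rewrite -limeMl//; apply: lee_lim => //; first exact: is_cvgeZl.
  by apply: nearW => k; have [] := h _ (cauchyL2 k v1).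
Qed.

End Completions.

(** * Comparison of the three norms *)

Section Comparison.
Context (R : realType) (n : nat).
Variable mu : {measure set (borelRn R n) -> \bar R}.
Local Notation X := (borelRn R n).
Implicit Types (E N : (X -> R) -> \bar R) (f g : X -> R).

Lemma comparable_sqrte N1 N2 E1 E2 (K1 K2 : R) : 0 <= K1 -> 0 <= K2 ->
  (forall f, 0 <= E1 f)%E -> (forall f, 0 <= E2 f)%E ->
  (forall f, L2 mu f -> N1 f = sqrte (E1 f)) ->
  (forall f, L2 mu f -> N2 f = sqrte (E2 f)) ->
  (forall f, L2 mu f -> (E1 f <= K1%:E * E2 f)%E) ->
  (forall f, L2 mu f -> (E2 f <= K2%:E * E1 f)%E) -> comparable mu N1 N2.
Proof.
move=> K10 K20 E10 E20 NE1 NE2 h1 h2; pose K := K1 + K2 + 1.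
have K0 : 0 < K by rewrite ltr_wpDl// addr_ge0.
exists (Num.sqrt K); first by rewrite sqrtr_gt0.
have root (a b : \bar R) (k : R) : (0 <= b)%E -> k <= K -> (a <= k%:E * b)%E ->
    (sqrte a <= (Num.sqrt K)%:E * sqrte b)%E.
  move=> b0 kK ab; rewrite -[(Num.sqrt K)%:E]/(sqrte K%:E) -sqrteM ?lee_fin ?(ltW K0)//.
  rewrite lee_sqrt ?mule_ge0 ?lee_fin ?(ltW K0)//.
  by apply: le_trans ab _; apply: lee_wpmul2r; rewrite ?lee_fin.
move=> f fL; rewrite NE1// NE2//; split.
  by apply: root (h1 f fL) => //; rewrite /K; lra.
by apply: root (h2 f fL) => //; rewrite /K; lra.
Qed.

Lemma integral_null (A : set X) (F : X -> \bar R) : mu setT = 0%E ->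
  (\int[mu]_(x in A) F x = 0)%E.
Proof.
move=> mu0; rewrite (eq_measure_integral mzero) ?integral_measure_zero// => B mB _.
have B0 : (mu B <= 0)%E by rewrite -mu0; apply: le_measure; rewrite ?inE.
by apply/eqP; rewrite eq_le B0 measure_ge0.
Qed.

Lemma comparable_zero N1 N2 : (forall f, N1 f = 0%E) -> (forall f, N2 f = 0%E) ->
  comparable mu N1 N2.
Proof. by move=> e1 e2; exists 1 => // f _; rewrite e1 e2 mule0. Qed.

Lemma seminorm_zero N : (forall f, N f = 0%E) -> seminorm mu N.
Proof. by move=> e; split => *; rewrite !e ?adde0. Qed.

End Comparison.

Section NormComparison.
Context (R : realType) (n : nat).
Variables (mu : {measure set (borelRn R n) -> \bar R}) (C : R).
Variable (D : set (cube R n)).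
Hypothesis S : doubling_setting mu C D.
Variables (kappa : nat) (s : R).
Hypothesis k0 : (0 < kappa)%N.
Hypothesis s0 : 0 < s.
Local Notation X := (borelRn R n).
Implicit Types (f g : X -> R).

Let sob_ge0 f : (0 <= sobolev_energy mu s f)%E.
Proof.
apply: integral_ge0 => x _; apply: integral_ge0 => y _.
by rewrite lee_fin mulr_ge0 ?sqr_ge0 ?kernel_ge0.
Qed.

Let diff_ge0 f : (0 <= diff_energy S kappa s f)%E.
Proof. by apply: esum_ge0 => m _; rewrite mule_ge0 ?gen_err_ge0 ?lee_fin ?weight_ge0. Qed.

Let dyadic_ge0 f : (0 <= dyadic_energy mu D kappa s f)%E.
Proof. by apply: esum_ge0 => m _; rewrite mule_ge0 ?gen_alpert_ge0 ?lee_fin ?weight_ge0. Qed.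

Lemma dyadic_diff_comparable :
  comparable mu (norm_dyadic mu D kappa s) (norm_diff mu D kappa s).
Proof.
apply: (comparable_sqrte (K1 := 1) (K2 := (1 - (ratio s)^-1)^-1) _ _ dyadic_ge0 diff_ge0) => //.
- exact: geometric_ge0.
- by move=> f _; exact: (norm_dyadicE S).
- by move=> f fL; exact: norm_diffE.
- by move=> f fL; rewrite mul1e; exact: dyadic_energy_le.
- by move=> f fL; exact: diff_energy_le.
Qed.

Lemma sobolev_diff_comparable : layer_rate C * ratio s < 1 ->
  comparable mu (norm_sobolev mu s) (norm_diff mu D kappa s).
Proof.
move=> /(sobolev_le_diff S k0 s0)[K K0 hK].
apply: (comparable_sqrte K0 (K_diff_ge0 S s0) sob_ge0 diff_ge0).
- by move=> f _; exact: (norm_sobolevE S).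
- by move=> f fL; exact: norm_diffE.
- exact: hK.
- by move=> f fL; exact: diff_le_sobolev.
Qed.

Lemma three_seminorms : [/\ seminorm mu (norm_sobolev mu s),
  seminorm mu (norm_dyadic mu D kappa s) & seminorm mu (norm_diff mu D kappa s)].
Proof.
split; split.
- by move=> f; exact: sqrte_ge0.
- by move=> f g; exact: (norm_sobolev_triangle S).
- by move=> f; exact: sqrte_ge0.
- by move=> f g; exact: (norm_dyadic_triangle S).
- by move=> f; exact: sqrte_ge0.
- by move=> f g; exact: (norm_diff_triangle S).
Qed.

End NormComparison.

Section SmallExponent.
Context (R : realType) (C : R).
Hypothesis C1 : 1 <= C.

(** The threshold on [s] is where the growth [ratio s] of the weights
    compensates the decay of the boundary layers. *)
Definition threshold : R := - ln (layer_rate C) / (2 * ln 2).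

Let ln2 : 0 < ln (2 : R). Proof. by rewrite ln_gt0// ltr1n. Qed.

Lemma threshold_gt0 : 0 < threshold.
Proof.
have /andP[h1 h2] := layer_rate_bounds C1.
rewrite divr_gt0 ?mulr_gt0// oppr_gt0 ln_lt0// h2 andbT; lra.
Qed.

Lemma lt_threshold (s : R) : s < threshold -> layer_rate C * ratio s < 1.
Proof.
have /andP[h1 h2] := layer_rate_bounds C1; have l0 : 0 < layer_rate C by lra.
rewrite /threshold ltr_pdivlMr ?mulr_gt0// => h.
rewrite -[layer_rate C]lnK ?posrE// /ratio /powR pnatr_eq0/= -expRD expR_lt1.
by lra.
Qed.

End SmallExponent.

(** A doubling measure may vanish identically; then all cubes are null and the
    masses of cubes cannot be inverted, but all the norms are zero. *)
Lemma null_norms (R : realType) (n : nat) (mu : {measure set (borelRn R n) -> \bar R})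
    (D : set (cube R n)) (kappa : nat) (s : R) f : mu setT = 0%E ->
  [/\ norm_sobolev mu s f = 0%E, norm_dyadic mu D kappa s f = 0%E &
      norm_diff mu D kappa s f = 0%E].
Proof.
move=> mu0; split; rewrite -[RHS]sqrte0; congr sqrte.
- exact: integral_null.
- by apply: esum1 => Q _; rewrite integral_null// mule0.
- by apply: esum1 => Q _; rewrite integral_null.
Qed.

Lemma comparable_norms (R : realType) (n : nat) (mu : {measure set (borelRn R n) -> \bar R})
    (C : R) (D : set (cube R n)) (kappa : nat) (s : R) :
  1 <= C -> (0 < n)%N -> locally_finite mu -> doubling mu C -> dyadic_grid D ->
  (0 < kappa)%N -> 0 < s -> s < threshold C ->
  [/\ seminorm mu (norm_sobolev mu s),
      seminorm mu (norm_dyadic mu D kappa s),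
      seminorm mu (norm_diff mu D kappa s),
      comparable mu (norm_sobolev mu s) (norm_dyadic mu D kappa s) &
      comparable mu (norm_dyadic mu D kappa s) (norm_diff mu D kappa s)].
Proof.
move=> C1 n0 lf db DG k0 s0 st; have [mu0|mu0] := eqVneq (mu setT) 0%E.
  have N0 f := null_norms D kappa s f mu0.
  by split; [apply: seminorm_zero|apply: seminorm_zero|apply: seminorm_zero|
    apply: comparable_zero|apply: comparable_zero] => f; have [] := N0 f.
have S : doubling_setting mu C D by split.
have [s1 s2 s3] := three_seminorms S kappa s.
have dd := dyadic_diff_comparable S k0 s0; split => //.
apply: comparable_trans (comparable_sym dd).
exact: (sobolev_diff_comparable S k0 s0 (lt_threshold C1 st)).
Qed.

Theorem theorem19 (R : realType) (C : R) :
  exists2 s0 : R, 0 < s0 &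
  forall (n : nat) (mu : {measure set (borelRn R n) -> \bar R}),
    (0 < n)%N -> locally_finite mu -> doubling mu C ->
  forall (D : set (cube R n)), dyadic_grid D ->
  forall (kappa : nat), (0 < kappa)%N ->
  forall (s : R), 0 < s < s0 ->
  let W := completion mu (norm_sobolev mu s) in
  let WD := completion mu (norm_dyadic mu D kappa s) in
  let Wdiff := completion mu (norm_diff mu D kappa s) in
  [/\ W = WD, WD = Wdiff,
      equivalent_norms W (completion_norm (norm_sobolev mu s))
                         (completion_norm (norm_dyadic mu D kappa s)) &
      equivalent_norms W (completion_norm (norm_dyadic mu D kappa s))
                         (completion_norm (norm_diff mu D kappa s))].
Proof.
(* Only the null measure is doubling with a constant below 1. *)
pose C' := Num.max C 1; have C'1 : 1 <= C' by rewrite le_max lexx orbT.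
exists (threshold C'); first exact: threshold_gt0.
move=> n mu n0 lf db D DG kappa k0 s /andP[s0 st] W WD Wdiff.
have db' : doubling mu C'.
  move=> Q Q0; apply: le_trans (db Q Q0) _; apply: lee_wpmul2r => //.
  by rewrite lee_fin le_max lexx.
have [sS sD sd cSD cDd] := comparable_norms C'1 n0 lf db' DG k0 s0 st.
split.
- exact: comparable_completion.
- exact: comparable_completion.
- apply: comparable_equivalent => //; exists 1 => // f _; by rewrite mul1e.
- exact: comparable_equivalent.
Qed.
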